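(* Let $\overline{\varepsilon}>0$, let $n\ge 0$, let $\vec{s}\in\mathbb{R}^{2n+1}$ be real parameters ordered as $s_n^{\uparrow}<s_n^{\downarrow}<\cdots<s_1^{\uparrow}<s_1^{\downarrow}<s_0^{\uparrow}$, and let $\vec{\chi}\in\mathbb{R}^n$, such that the multi-phase solution $v^{\vec{s},\vec{\chi}}(x,t;\overline{\varepsilon})$ is $2\pi$-periodic in $x$. Then for every $t$ the dispersive action profile of $v^{\vec{s},\vec{\chi}}(\cdot,t;\overline{\varepsilon})$ coincides with the Dobrokhotov–Krichever profile: $$f(c\,|\,v^{\vec{s},\vec{\chi}}(x,t;\overline{\varepsilon});\overline{\varepsilon})=f(c\,|\,\vec{s})\qquad\text{for all }c\in\mathbb{R},$$ and thus has finitely many non-empty gaps. Equivalently, $n_\star(v^{\vec{s},\vec{\chi}}(x,t;\overline{\varepsilon}))=n$, $S_i^{\uparrow}(v^{\vec{s},\vec{\chi}}(x,t;\overline{\varepsilon});\overline{\varepsilon})=s_i^{\uparrow}$ for $0\le i\le n$, and $S_i^{\downarrow}(v^{\vec{s},\vec{\chi}}(x,t;\overline{\varepsilon});\overline{\varepsilon})=s_i^{\downarrow}$ for $1\le i\le n$.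
   Context: **Multi-phase solutions.** For $\vec{s},\vec{\chi}$ as in the claim, $$v^{\vec{s},\vec{\chi}}(x,t;\overline{\varepsilon})=s_n^{\uparrow}-\sum_{i=1}^n(s_{i-1}^{\uparrow}-s_i^{\downarrow})+2\overline{\varepsilon}\,\mathrm{Im}\,\partial_x\log\det M(x,t),$$ where $M(x,t)$ is the $n\times n$ matrix with entries ($\delta_{ij}$ the Kronecker delta) $$M_{ij}(x,t)=\frac{1}{s_{i-1}^{\uparrow}-s_j^{\downarrow}}\Big(-1+\delta_{ij}Z_i\,e^{\mathbf{i}\frac{s_{i-1}^{\uparrow}-s_i^{\downarrow}}{\overline{\varepsilon}}\left(x-\chi_i-\frac12(s_i^{\downarrow}+s_{i-1}^{\uparrow})t\right)}\Big),$$ $$Z_i=\sqrt{\frac{s_{i-1}^{\uparrow}-s_n^{\uparrow}}{s_i^{\downarrow}-s_n^{\uparrow}}}\prod_{j\ne i}\sqrt{\frac{(s_i^{\downarrow}-s_j^{\downarrow})(s_{i-1}^{\uparrow}-s_{j-1}^{\uparrow})}{(s_{i-1}^{\uparrow}-s_j^{\downarrow})(s_i^{\downarrow}-s_{j-1}^{\uparrow})}}.$$ For $n=0$, $v\equiv s_0^\uparrow$. These are solutions of the Benjamin–Ono equation $\partial_tv+v\partial_xv=\frac{\overline{\varepsilon}}{2}J[\partial_x^2v]$, where $J$ is the Hilbert transform with $Je^{\pm\mathbf{i}kx}=\mp\mathbf{i}e^{\pm\mathbf{i}kx}$ ($k>0$), $J1=0$. **Dobrokhotov–Krichever profile.** $f(c|\vec{s})$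 is the piecewise-linear function of $c\in\mathbb{R}$ with slopes $\pm1$, with local minima exactly at the $s_i^{\uparrow}$, local maxima exactly at the $s_i^{\downarrow}$, and $f(c|\vec{s})-|c-a|\to0$ as $c\to\pm\infty$, where $a=s_n^{\uparrow}+\sum_{i=1}^n|s_i^{\downarrow}-s_{i-1}^{\uparrow}|$. **Lax operator.** Write $w=e^{\mathbf{i}x}$, $\mathbb{T}=\{|w|=1\}$. The Hardy space $H_\bullet$ is the closure of $\mathbb{C}[w]$ in $L^2(\mathbb{T},dx/2\pi)$ with orthogonal projection $\pi_\bullet$ and orthonormal basis $|h\rangle=w^h$, $h\ge0$. For bounded real $2\pi$-periodic $v$, $L_\bullet(v;\overline{\varepsilon})=-\overline{\varepsilon}D_\bullet+\pi_\bullet L(v)\pi_\bullet$ is self-adjoint on $H_\bullet$, where $D_\bullet|h\rangle=h|h\rangle$ and $L(v)$ is multiplication by $v$. **Dispersive action profile.** For bounded real $2\pi$-periodic $v$, the function $\Phi_0^{BA}(u|v;\overline{\varepsilon})=\langle0|(u-L_\bullet(v;\overline{\varepsilon}))^{-1}|0\rangle$ is meromorphic in $u\in\mathbb{C}$ with simple real poles $S_i^{\uparrow}(v;\overline{\varepsilon})$ ($0\le i\le n_\star(v)$) and simple real zeroes $S_i^{\downarrow}(v;\overline{\varepsilon})$ ($1\le i\le n_\star(v)$), $n_\star(v)\in\{0,1,2,\ldots\}\cup\{\infty\}$, strictly interlacing as $\cdots<S_1^{\uparrow}<S_1^{\downarrow}<S_0^{\uparrow}$ and accumulating at most at $-\infty$,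 and $\Phi_0^{BA}(u|v;\overline{\varepsilon})=\frac{1}{u-S_0^{\uparrow}}\prod_{i=1}^{n_\star}\frac{u-S_i^{\downarrow}}{u-S_i^{\uparrow}}$. The dispersive action profile $f(c|v;\overline{\varepsilon})$ is the piecewise-linear function of $c\in\mathbb{R}$ with slopes $\pm1$, local minima exactly at the $S_i^{\uparrow}$, local maxima exactly at the $S_i^{\downarrow}$, and $f(c|v;\overline{\varepsilon})-|c-a|\to0$ as $c\to\pm\infty$ for $a=\int_0^{2\pi}v(x)\frac{dx}{2\pi}$. Its gaps are the intervals $(S_i^{\uparrow},S_i^{\downarrow})$, on which the slope is $+1$, and $n_\star(v)$ is the number of non-empty gaps. *)

(* Defs.v *)
From HB Require Import structures.
From mathcomp Require Import all_boot all_order all_algebra.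
From mathcomp Require Import all_classical all_reals all_analysis.
From mathcomp Require Import complex.
Import Order.TTheory GRing.Theory Num.Theory.
Import numFieldNormedType.Exports.
Set Implicit Arguments.
Unset Strict Implicit.
Unset Printing Implicit Defensive.
Local Open Scope card_scope.
Local Open Scope classical_set_scope.
Local Open Scope ring_scope.
Local Open Scope complex_scope.

Definition expi (R : realType) (x : R) : R[i] := cos x +i* sin x.

Definition cderive (R : realType) (g : R -> R[i]) (x : R) : R[i] :=
  derive1 (fun y => complex.Re (g y)) x +i* derive1 (fun y => complex.Im (g y)) x.

(* The parameters are su : 'I_n.+1 -> R, with su i = s_i^up for 0 <= i <= n,
   and sd, chi : 'I_n -> R shifted by one: for i : 'I_n, sd i = s_{i+1}^down and
   chi i = chi_{i+1}.  The two neighbours of s_{i+1}^down are then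
   s_i^up = su_above su i and s_{i+1}^up = su_below su i. *)
Definition su_above (R : realType) (n : nat) (su : 'I_n.+1 -> R) (i : 'I_n) : R :=
  su (widen_ord (leqnSn n) i).

Definition su_below (R : realType) (n : nat) (su : 'I_n.+1 -> R) (i : 'I_n) : R :=
  su (lift ord0 i).

Definition Zcoef (R : realType) (n : nat) (su : 'I_n.+1 -> R) (sd : 'I_n -> R)
    (i : 'I_n) : R :=
  Num.sqrt ((su_above su i - su ord_max) / (sd i - su ord_max)) *
  \prod_(j < n | j != i)
    Num.sqrt (((sd i - sd j) * (su_above su i - su_above su j)) /
              ((su_above su i - sd j) * (sd i - su_above su j))).

Definition phase (R : realType) (eps : R) (n : nat) (su : 'I_n.+1 -> R)
    (sd chi : 'I_n -> R) (x t : R) (i : 'I_n) : R :=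
  (su_above su i - sd i) / eps *
  (x - chi i - 2^-1 * (sd i + su_above su i) * t).

Definition Mmat (R : realType) (eps : R) (n : nat) (su : 'I_n.+1 -> R)
    (sd chi : 'I_n -> R) (x t : R) : 'M[R[i]]_n :=
  \matrix_(i, j)
    (((su_above su i - sd j)^-1)%:C *
     (-1 + (i == j)%:R * (Zcoef su sd i)%:C * expi (phase eps su sd chi x t i))).

(* d/dx log det M is the logarithmic derivative (d/dx det M) / det M, which does
   not depend on a branch of the logarithm. *)
Definition multiphase (R : realType) (eps : R) (n : nat) (su : 'I_n.+1 -> R)
    (sd chi : 'I_n -> R) (x t : R) : R :=
  su ord_max - \sum_(i < n) (su_above su i - sd i) +
  2 * eps * complex.Im (cderive (fun y => \det (Mmat eps su sd chi y t)) x /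
                        \det (Mmat eps su sd chi x t)).

Definition is_slope (R : realType) (s : R) : Prop := s = 1 \/ s = -1.

(* One-sided linearity near every point; by compactness there are finitely many
   break points on each bounded interval. *)
Definition pw_linear_pm1 (R : realType) (f : R -> R) : Prop :=
  forall c, exists sl sr : R, [/\ is_slope sl, is_slope sr &
    \forall h \near (0 : R)^'+,
      f (c + h) = f c + sr * h /\ f (c - h) = f c - sl * h].

Definition local_min (R : realType) (f : R -> R) (c : R) : Prop :=
  \forall x \near c, f c <= f x.

Definition local_max (R : realType) (f : R -> R) (c : R) : Prop :=
  \forall x \near c, f x <= f c.

Definition is_profile (R : realType) (mins maxs : set R) (a : R) (f : R -> R) : Prop :=
  [/\ pw_linear_pm1 f,
      (forall c, local_min f c <-> mins c),
      (forall c, local_max f c <-> maxs c),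
      f c - `|c - a| @[c --> +oo] --> (0 : R) &
      f c - `|c - a| @[c --> -oo] --> (0 : R)].

Definition is_DK_profile (R : realType) (n : nat) (su : 'I_n.+1 -> R) (sd : 'I_n -> R)
    (f : R -> R) : Prop :=
  is_profile (range su) (range sd)
    (su ord_max + \sum_(i < n) `|sd i - su_above su i|) f.

(* Elements of L^2(T, dx/2pi) are represented by functions of x restricted to
   [0, 2pi], where w = e^{ix}; equality is almost everywhere equality there. *)
Definition torus (R : realType) : set R := `[0, 2 * pi].

Definition torus_eq (R : realType) (f g : R -> R[i]) : Prop :=
  f = g %[ae (@lebesgue_measure R) in torus (R := R)].

Definition sqnorm (R : realType) (f : R -> R[i]) : \bar R :=
  (((2 * pi)^-1)%:E *
   \int[@lebesgue_measure R]_(x in torus (R := R)) ((Normc.normc (f x)) ^+ 2)%:E)%E.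

Definition L2 (R : realType) (f : R -> R[i]) : Prop :=
  [/\ measurable_fun (torus (R := R)) (fun x => complex.Re (f x)),
      measurable_fun (torus (R := R)) (fun x => complex.Im (f x)) &
      (sqnorm f < +oo)%E].

Definition mean (R : realType) (v : R -> R) : R :=
  (2 * pi)^-1 * \int[@lebesgue_measure R]_(x in torus (R := R)) v x.

Definition cmean (R : realType) (f : R -> R[i]) : R[i] :=
  mean (fun x => complex.Re (f x)) +i* mean (fun x => complex.Im (f x)).

(* <f|g>, antilinear in f. *)
Definition braket (R : realType) (f g : R -> R[i]) : R[i] :=
  cmean (fun x => (f x)^* * g x).

Definition ket (R : realType) (h : nat) (x : R) : R[i] := expi x ^+ h.

Definition hardy (R : realType) (f : R -> R[i]) : Prop :=
  L2 f /\
  forall e : R, 0 < e ->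
    exists p : {poly R[i]}, (sqnorm (fun x => (f x - p.[expi x])%R) < e%:E)%E.

(* The orthogonal projection of g onto the Hardy space is (the class of) p. *)
Definition hardy_proj (R : realType) (g p : R -> R[i]) : Prop :=
  [/\ L2 g, hardy p & forall q, hardy q -> braket q (fun x => g x - p x) = 0].

(* Unbounded operators are given by their graphs.  D_graph is the self-adjoint
   operator diagonal in the basis (ket h), on its maximal domain. *)
Definition D_graph (R : realType) (f g : R -> R[i]) : Prop :=
  [/\ hardy f, hardy g &
      forall h : nat, braket (ket h) g = h%:R * braket (ket h) f].

Definition lax_graph (R : realType) (eps : R) (v : R -> R) (f g : R -> R[i]) : Prop :=
  hardy g /\
  exists d p, [/\ D_graph f d, hardy_proj (fun x => (v x)%:C * f x) p &
                  torus_eq g (fun x => - eps%:C * d x + p x)].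

(* f lies in the domain of the Lax operator L and (u - L) f = g. *)
Definition shifted_lax (R : realType) (eps : R) (v : R -> R) (u : R[i])
    (f g : R -> R[i]) : Prop :=
  exists2 l, lax_graph eps v f l & torus_eq g (fun x => u * f x - l x).

(* z = <0| (u - L)^-1 |0>: the operator u - L is injective, |0> lies in its range
   and z is the overlap of |0> with its preimage. *)
Definition PhiBA (R : realType) (eps : R) (v : R -> R) (u z : R[i]) : Prop :=
  (forall f, shifted_lax eps v u f (fun=> 0) -> torus_eq f (fun=> 0)) /\
  exists2 f, shifted_lax eps v u f (ket 0) & z = braket (ket 0) f.

(* Poles and zeroes of the meromorphic function Phi are read off its limits at
   points adherent to its set of definition: this set is dense, but it omits the
   eigenvalues of L, at which the singularity of Phi may be removable. *)
Definition Phi_adherent (R : realType) (eps : R) (v : R -> R) (p : R) : Prop :=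
  forall d : R, 0 < d ->
    exists u z, [/\ 0 < Normc.normc (u - p%:C), Normc.normc (u - p%:C) < d &
                    PhiBA eps v u z].

Definition Phi_pole (R : realType) (eps : R) (v : R -> R) (p : R) : Prop :=
  Phi_adherent eps v p /\
  forall K : R, exists2 d : R, 0 < d &
    forall u z, 0 < Normc.normc (u - p%:C) -> Normc.normc (u - p%:C) < d ->
      PhiBA eps v u z -> K < Normc.normc z.

Definition Phi_zero (R : realType) (eps : R) (v : R -> R) (p : R) : Prop :=
  Phi_adherent eps v p /\
  forall e : R, 0 < e -> exists2 d : R, 0 < d &
    forall u z, 0 < Normc.normc (u - p%:C) -> Normc.normc (u - p%:C) < d ->
      PhiBA eps v u z -> Normc.normc z < e.

(* x is the element of A having exactly i elements of A above it. *)
Definition is_nth_largest (R : realType) (A : set R) (i : nat) (x : R) : Prop :=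
  A x /\ [set y | A y /\ x < y] #= `I_i.

(* S_i^up(v) = x, for i >= 0. *)
Definition is_S_up (R : realType) (eps : R) (v : R -> R) (i : nat) (x : R) : Prop :=
  is_nth_largest (Phi_pole eps v) i x.

(* S_i^down(v) = x, for i >= 1. *)
Definition is_S_down (R : realType) (eps : R) (v : R -> R) (i : nat) (x : R) : Prop :=
  (0 < i)%N /\ is_nth_largest (Phi_zero eps v) i.-1 x.

(* Each gap (S_i^up, S_i^down), i >= 1, is counted by its right end point, a zero
   of Phi. *)
Definition n_star (R : realType) (eps : R) (v : R -> R) : \bar R :=
  counting (Phi_zero eps v).

Definition is_dispersive_action_profile (R : realType) (eps : R) (v : R -> R)
    (f : R -> R) : Prop :=
  is_profile (Phi_pole eps v) (Phi_zero eps v) (mean v) f.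

(* Main.v *)
(* Write a_i = s_(i-1)^up, b_i = s_i^down, s = s_n^up, A = diag(a), B = diag(b).  The
   weights nu_j in prod_i (u - a_i) / (u - b_i) = 1 - sum_j nu_j / (u - b_j) are
   positive; with beta_j = sqrt nu_j they define a real orthogonal Cauchy matrix O such
   that A O = O (B + beta beta^T).  Put Y = W O, where W is diagonal with entries
   sqrt ((b_i - s) / (a_i - s)) e^(i phase_i), so that |W| < 1, and X = (1 - Y)^-1,
   p = beta^T (X - 1) beta.  Up to left and right diagonal factors M is the
   complex conjugate of 1 - Y, and the displacement identity above gives
   v = s + sum_i (a_i - b_i) + p + conj p.

   Periodicity of v forces the wave numbers (a_i - b_i) / eps to be positive integers:
   the least non-integral one would survive in p(x + 2 pi) - p(x).  Hence X - 1 is a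
   uniform limit of polynomials in w = e^(ix) without constant term.  With
   rho = (u - B)^-1 beta and
   Phi(u) = prod_i (u - b_i) / ((u - s) prod_i (u - a_i)),
   the function f = Phi(u) (1 + rho^T (X - 1) beta) belongs to the Hardy space, and by
   the displacement identity u f + eps D f - v f differs from 1 by the conjugate of an
   element of w H.  Therefore (u - L) f = |0>, and <0|(u - L)^-1|0> = <0|f> = Phi(u),
   whose poles and zeroes are the s_i^up and s_i^down.

   Two profiles with the same extrema have, at each point, slopes whose differences on
   the left and on the right agree; so their difference is locally affine, hence
   affine, and it vanishes at infinity. *)
Require Import Defs.
From mathcomp Require Import all_boot all_order all_algebra.
From mathcomp Require Import all_classical all_reals all_analysis.
From mathcomp Require Import complex measurable_realfun perm ring lra.
Import Order.TTheory GRing.Theory Num.Theory.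
Import numFieldNormedType.Exports.
Set Implicit Arguments.
Unset Strict Implicit.
Unset Printing Implicit Defensive.
Local Open Scope ring_scope.

(** * Displacement identities *)

(** The preimage of |0> is verified rather than derived, and the shape of the proof comes from
    avoiding calculus in that check. D is tested through Fourier coefficients only, and those of X
    obey a recursion read off from X = 1 + Y X. The moduli of W are such that Y (B - s + beta
    beta^T) times the adjoint of Y is B - s; this is what controls the term conj p of the potential.

    [PhiBA] is a relation: a value at u presupposes that u - L is injective. Off the real axis
    injectivity follows from the symmetry of L; at a real u, a value that happens to exist is forced
    by the explicit preimage. Limits at real points therefore see a rational function only.

    Integrality meets two obstacles. Periodicity of v concerns Re p alone; it says something about p
    because all wave numbers of p are positive, so that squares of its exponential sums average to
    zero. And the least non-integral wave number may be shared by several indices; these are told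
    apart by their time frequencies, which is where periodicity at all times enters. *)

Lemma displacement_resolvent (T : pzRingType) (A B G Y X : T) :
  A * Y = Y * (B + G) -> X * (1 - Y) = 1 -> (1 - Y) * X = 1 ->
  X * (A - B) * X = X * A - B * X + (X - 1) * G * X.
Proof.
move=> AY XY YX.
have XYE : X * Y = X - 1 by rewrite -XY mulrBr mulr1 opprB addrC subrK.
have -> : A - B = A * (1 - Y) - (1 - Y) * B + Y * G.
  rewrite mulrBr mulrBl mulr1 mul1r AY mulrDr opprB addrAC.
  by rewrite opprD !addrA subrK subrK.
rewrite mulrDr [X * (_ - _)]mulrBr (mulrDl _ (X * (Y * G))) [(X * _ - _) * X]mulrBl.
rewrite !mulrA XYE XY mul1r.
by rewrite -[X * A * _ * X]mulrA YX mulr1.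
Qed.

(** Sandwich [Y * G * Z = D - Y * D * Z] between X and V. Applied with Z and V the adjoints of Y and
    X, it evaluates products of an analytic and an anti-analytic function. *)
Lemma displacement_product (T : pzRingType) (D G Y Z X V : T) :
  Y * (D + G) * Z = D -> X * (1 - Y) = 1 -> (1 - Z) * V = 1 ->
  (X - 1) * G * (V - 1) = X * D + D * V - D.
Proof.
move=> YZ XY ZV.
have XYE : X * Y = X - 1 by rewrite -XY mulrBr mulr1 opprB addrC subrK.
have ZVE : Z * V = V - 1 by rewrite -ZV mulrBl mul1r opprB addrC subrK.
have YGZ : Y * G * Z = D - Y * D * Z.
  by rewrite -[D in D - _]YZ mulrDr mulrDl addrAC subrr add0r.
have -> : (X - 1) * G * (V - 1) = X * D * V - (X - 1) * D * (V - 1).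
  rewrite -{1}XYE -{1}ZVE !mulrA -(mulrA X Y) -(mulrA X _ Z) YGZ.
  by rewrite [X * (_ - _)]mulrBr [LHS]mulrBl !mulrA XYE -(mulrA _ Z V) ZVE.
rewrite mulrBr mulr1 !mulrBl mul1r opprB [RHS]addrAC addrC.
by rewrite opprB [LHS]addrA [_ + (X * D - D)]addrC -[LHS]addrA [X * D * V + _]addrC subrK addrC.
Qed.

Section Functional.
Variables (F : fieldType) (n : nat) (rho beta : 'cV[F]_n).
Definition bil (Z : 'M[F]_n) : F := (rho^T *m Z *m beta) 0 0.

Lemma bilD (Z1 Z2 : 'M[F]_n : pzRingType) : bil (Z1 + Z2) = bil Z1 + bil Z2.
Proof. by rewrite /bil mulmxDr mulmxDl mxE. Qed.

Lemma bilN (Z : 'M[F]_n : pzRingType) : bil (- Z) = - bil Z.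
Proof. by rewrite /bil mulmxN mulNmx mxE. Qed.

Lemma bilB (Z1 Z2 : 'M[F]_n : pzRingType) : bil (Z1 - Z2) = bil Z1 - bil Z2.
Proof. by rewrite bilD bilN. Qed.

Lemma bil_scalar c Z : bil (c%:M * Z) = c * bil Z.
Proof. by rewrite /bil -mulmxE mul_scalar_mx -scalemxAr -scalemxAl mxE. Qed.

Lemma bilE Z : bil Z = \sum_i \sum_j rho i 0 * Z i j * beta j 0.
Proof.
rewrite /bil mxE exchange_big; apply: eq_bigr => j _ /=.
rewrite mxE mulr_suml; apply: eq_bigr => i _; by rewrite mxE.
Qed.
End Functional.

Lemma bil_rank1 (F : fieldType) (n : nat) (rho beta : 'cV[F]_n) (Z1 Z2 : 'M[F]_n) :
  bil rho beta (Z1 * (beta *m beta^T) * Z2) = bil rho beta Z1 * bil beta beta Z2.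
Proof.
rewrite /bil -!mulmxE.
have -> : rho^T *m (Z1 *m (beta *m beta^T) *m Z2) *m beta =
  (rho^T *m Z1 *m beta) *m (beta^T *m Z2 *m beta) by rewrite !mulmxA.
by rewrite mxE big_ord1.
Qed.

(* D stands for u - B, so that bil beta beta Z = bil rho beta (D * Z) when
   rho = D^-1 beta. *)
Lemma lax_algebra (F : fieldType) (n : nat) (rho beta : 'cV[F]_n)
    (A B Y Z X V : 'M[F]_n) (s u : F) :
  let G := beta *m beta^T in
  let L := bil rho beta in
  let p := bil beta beta in
  (u%:M - B) *m rho = beta -> B^T = B ->
  A * Y = Y * (B + G) -> X * (1 - Y) = 1 -> (1 - Y) * X = 1 ->
  Y * (B - s%:M + G) * Z = B - s%:M -> (1 - Z) * V = 1 ->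
  (u - (s + p 1) - p (X - 1) - p (V - 1)) * (1 + L (X - 1)) +
    L (X * (A - B) * (X - 1)) =
  u - (s + p 1) - p (V - 1) - L ((B - s%:M) * V).
Proof.
move=> G L p Drho BT AY XY YX YZ ZV.
have LD (Z1 Z2 : 'M[F]_n : pzRingType) : L (Z1 + Z2) = L Z1 + L Z2 := bilD _ _ _ _.
have LB (Z1 Z2 : 'M[F]_n : pzRingType) : L (Z1 - Z2) = L Z1 - L Z2 := bilB _ _ _ _.
have pE M : p M = u * L M - L (B * M).
  rewrite -bil_scalar -bilB -mulrBl /L /p /bil.
  by rewrite -[in X in (X *m _ *m _) 0 0 = _]Drho trmx_mul linearB /= tr_scalar_mx BT -mulmxE !mulmxA.
have -> : L (X * (A - B) * (X - 1)) =
    L (X * B) - L (B * X) + L ((X - 1) * G * (X - 1)) + L ((X - 1) * G * 1).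
  rewrite -!bilB -!bilD; congr (bil _ _ _).
  rewrite mulrBr (displacement_resolvent AY XY YX) mulr1 mulrBr.
  rewrite !mulr1 [(X - 1) * G * (X - 1)]mulrBr mulr1.
  rewrite -[RHS]addrA subrK addrAC; congr (_ + _).
  by rewrite opprB addrC addrA subrK.
rewrite /L /G !bil_rank1 -/G -/L -/p.
have E := displacement_product YZ XY ZV.
have : L (X - 1) * p (V - 1) = L ((X - 1) * G * (V - 1)) by rewrite /L /G bil_rank1.
rewrite E !LB LD [X * (_ - _)]mulrBr. rewrite !(LB, LD).
rewrite !pE !mulrBr !mulr1 !LB.
have -> : X * s%:M = s%:M * X by rewrite -!mulmxE scalar_mxC.
have -> : L s%:M = s * L 1 by rewrite -bil_scalar mulr1.
rewrite [L (s%:M * X)]bil_scalar -/L.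
(* The displacement identity enters as an equation between scalars: the goal differs from it by a
   ring identity only. *)
have sub_eq (a b x y : F) : a = b -> x - y = b - a -> x = y.
  by move=> ->; rewrite subrr => /subr0_eq.
move/sub_eq; apply; ring.
Qed.

(** By cyclicity the factors 1 - Y cancel X inside the trace, and the rank-one term leaves beta^T (X
    - 1) beta. This turns the logarithmic derivative of det M into the function p of the
    potential. *)
Lemma trace_displacement (F : fieldType) (n : nat) (beta : 'cV[F]_n)
    (A B Y X : 'M[F]_n) :
  A * Y = Y * (B + beta *m beta^T) -> X * (1 - Y) = 1 -> (1 - Y) * X = 1 ->
  \tr ((A - B) * X) = \tr A - \tr B + bil beta beta (X - 1).
Proof.
move=> AY XY YX.
have XYE : X * Y = X - 1 by rewrite -XY mulrBr mulr1 opprB addrC subrK.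
have E : A - B = A * (1 - Y) - (1 - Y) * B + Y * (beta *m beta^T).
  rewrite mulrBr mulrBl mulr1 mul1r AY mulrDr opprB addrAC.
  by rewrite opprD !addrA subrK subrK.
have -> : (A - B) * X = A - (1 - Y) * B * X + Y * (beta *m beta^T) * X.
  by rewrite E mulrDl [(_ - _) * X]mulrBl -[A * _ * X]mulrA YX mulr1.
have XY' : X *m (1%:M - Y) = 1%:M := XY.
have XYE' : X *m Y = X - 1%:M := XYE.
rewrite !mxtraceD raddfN /= -mulmxE; congr (_ - _ + _).
  by rewrite mxtrace_mulC mulmxA XY' mul1mx.
rewrite mxtrace_mulC !mulmxA XYE' mxtrace_mulC mulmxA /mxtrace big_ord1.
by [].
Qed.

(** * Cauchy matrices *)

Section Cauchy.
Variables (F : fieldType) (n : nat) (a b : 'I_n -> F).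

Lemma size_prod_XsubC_card (P : pred 'I_n) (c : 'I_n -> F) :
  size (\prod_(k < n | P k) ('X - (c k)%:P)) = #|P|.+1.
Proof. by rewrite -big_filter size_prod_XsubC size_filter -sum1_count sum1_card. Qed.

(** Lagrange interpolation: P has degree below n, so it equals its interpolant at the n distinct
    nodes b_j. *)
Lemma partial_fractions (P : {poly F}) (u : F) :
  injective b -> (size P <= n)%N -> (forall j, u != b j) ->
  P.[u] / \prod_j (u - b j) =
  \sum_j P.[b j] / (\prod_(k < n | k != j) (b j - b k)) / (u - b j).
Proof.
move=> binj szP ub.
pose B j := \prod_(k < n | k != j) ('X - (b k)%:P).
have B_horner j x : (B j).[x] = \prod_(k < n | k != j) (x - b k).
  by rewrite horner_prod; apply: eq_bigr => k _; rewrite hornerXsubC.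
have Bb_neq0 j : \prod_(k < n | k != j) (b j - b k) != 0.
  apply/prodf_neq0 => k kj; rewrite subr_eq0; apply: contra kj => /eqP /binj ->.
  by [].
pose Q := \sum_j (P.[b j] / \prod_(k < n | k != j) (b j - b k)) *: B j.
have szB j : (size (B j) <= n)%N.
  by rewrite size_prod_XsubC_card cardC1 card_ord prednK // (leq_trans _ (ltn_ord j)).
have PQ : P = Q.
  apply/subr0_eq; apply: (@roots_geq_poly_eq0 _ _ [seq b j | j <- enum 'I_n]).
  - apply/allP => _ /mapP[j _ ->]; rewrite /root hornerD hornerN horner_sum.
    have Bz k : k != j -> (B k).[b j] = 0.
      by move=> kj; rewrite B_horner (bigD1 j) 1?eq_sym //= subrr mul0r.
    rewrite subr_eq0 (bigD1 j) //= [X in _ + X]big1 ?addr0 => [|k kj].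
      by rewrite hornerZ B_horner divfK.
    by rewrite hornerZ Bz // mulr0.
  - by rewrite map_inj_uniq ?enum_uniq.
  - rewrite size_map size_enum_ord (leq_trans (size_polyD _ _)) // geq_max szP.
    rewrite size_polyN (leq_trans (size_sum _ _ _)) //.
    by apply/bigmax_leqP => j _; rewrite (leq_trans (size_scale_leq _ _)).
rewrite [in LHS]PQ horner_sum mulr_suml; apply: eq_bigr => j _.
rewrite hornerZ B_horner [\prod_j (u - b j)](bigD1 j) //=.
have uj : u - b j != 0 by rewrite subr_eq0.
have ue : \prod_(k < n | k != j) (u - b k) != 0.
  by apply/prodf_neq0 => k _; rewrite subr_eq0.
have := Bb_neq0 j.
move: (\prod_(k < n | k != j) (u - b k)) ue => U ue.
move: (\prod_(k < n | k != j) (b j - b k)) => V V0.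
by field; rewrite ue uj V0.
Qed.

(** Residues: -[nu_wt j] is the residue of prod (u - a_k) / (u - b_k) at b_j, and [mu_wt i] is that
    of the inverse function at a_i. The remaining factors are grouped as ratios whose signs can be
    read off from the interlacing. *)
Definition nu_wt j := (a j - b j) * \prod_(k < n | k != j) ((b j - a k) / (b j - b k)).
Definition mu_wt i := (a i - b i) * \prod_(k < n | k != i) ((a i - b k) / (a i - a k)).

Hypotheses (binj : injective b) (ainj : injective a) (ab : forall i j, a i != b j).

Lemma sum_nu (u : F) : (forall j, u != b j) ->
  \sum_j nu_wt j / (u - b j) = 1 - \prod_j (u - a j) / \prod_j (u - b j).
Proof.
move=> ub.
(* Both products are monic of degree n, so their difference has degree below n and qualifies for
   [partial_fractions]. *)
pose P := \prod_j ('X - (b j)%:P) - \prod_j ('X - (a j)%:P).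
have hP x : P.[x] = \prod_j (x - b j) - \prod_j (x - a j).
  by rewrite /P hornerD hornerN !horner_prod; congr (_ - _);
     apply: eq_bigr => j _; rewrite hornerXsubC.
have szP : (size P <= n)%N.
  apply/leq_sizeP => k; rewrite leq_eqVlt => /orP[/eqP <-|nk].
    have mon (c : 'I_n -> F) : (\prod_j ('X - (c j)%:P))`_n = 1.
      have /monicP := monic_prod_XsubC (index_enum 'I_n) xpredT c.
      rewrite lead_coefE; congr (_`_ _ = _).
      by rewrite size_prod_XsubC_card card_ord.
    by rewrite coefB !mon subrr.
  rewrite coefB !nth_default ?subrr // size_prod_XsubC_card card_ord //.
have Ub0 : \prod_j (u - b j) != 0 by apply/prodf_neq0 => j _; rewrite subr_eq0.
have := partial_fractions binj szP ub.
rewrite hP mulrBl divff // => ->; apply: eq_bigr => j _; congr (_ / _).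
rewrite hP [X in X - _](bigD1 j) //= subrr mul0r sub0r (bigD1 j) //= /nu_wt.
by rewrite prodf_div -mulNr opprB mulrA.
Qed.

(** Partial fractions of the quotient of prod over k != i of (u - a_k) by prod (u - b_j), at u =
    a_l, where the numerator vanishes unless l = i. These are the orthogonality relations between
    the rows of the Cauchy matrix. *)
Lemma sum_nu2 i l : \sum_j nu_wt j / (a i - b j) / (a l - b j) = (i == l)%:R / mu_wt i.
Proof.
pose P := \prod_(k < n | k != i) ('X - (a k)%:P).
have hP x : P.[x] = \prod_(k < n | k != i) (x - a k).
  by rewrite horner_prod; apply: eq_bigr => k _; rewrite hornerXsubC.
have szP : (size P <= n)%N.
  by rewrite size_prod_XsubC_card cardC1 card_ord prednK // (leq_trans _ (ltn_ord i)).
have := partial_fractions binj szP (ab l).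
rewrite hP; under [in X in _ = X]eq_bigr => j _ do rewrite hP.
have nuE j : \prod_(k < n | k != i) (b j - a k) / \prod_(k < n | k != j) (b j - b k) =
    nu_wt j / (a i - b j).
  have bai : a i - b j != 0 by rewrite subr_eq0.
  apply: (canRL (mulfK bai)); rewrite /nu_wt prodf_div mulrAC mulrA; congr (_ / _).
  rewrite -[a i - _]opprB -[a j - _]opprB mulrN mulNr; congr (- _).
  have D1 m : \prod_k (b j - a k) = (b j - a m) * \prod_(k < n | k != m) (b j - a k).
    by rewrite (bigD1 m).
  by rewrite mulrC -!D1.
under [in X in _ = X]eq_bigr => j _ do rewrite nuE.
move=> <-; rewrite /mu_wt prodf_div; case: eqVneq => [<-|il].
  have Ub0 : \prod_(j < n | j != i) (a i - b j) != 0.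
    by apply/prodf_neq0 => j _; rewrite subr_eq0.
  by rewrite mul1r [X in _ / X](bigD1 i) //= mulrA invf_div.
rewrite (bigD1 l) 1?eq_sym //= subrr !mul0r.
by [].
Qed.
End Cauchy.

Section RealCauchy.
Variables (R : rcfType) (n : nat) (a b : 'I_n -> R).
Hypotheses (ba : forall i, b i < a i) (ab_lt : forall i j : 'I_n, (i < j)%N -> a j < b i).

Lemma interlace_b_inj : injective b.
Proof.
move=> i j bij; apply: val_inj; case: (ltngtP i j) => // ij; exfalso.
  by have := lt_trans (ba j) (ab_lt ij); rewrite bij ltxx.
by have := lt_trans (ba i) (ab_lt ij); rewrite bij ltxx.
Qed.

Lemma interlace_a_neq_b i j : a i != b j.
Proof.
case: (ltngtP i j) => [ij|ij|/val_inj <-]; last by rewrite gt_eqF.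
  by rewrite gt_eqF // (lt_trans (ba j)) // (lt_trans (ab_lt ij)).
by rewrite lt_eqF // ab_lt.
Qed.

(** By interlacing, a_k and b_k lie on the same side of b_j. *)
Lemma nu_ratio_gt0 j k : k != j -> 0 < (b j - a k) / (b j - b k).
Proof.
move=> kj; have [kj'|jk|/val_inj jk] := ltngtP k j; last by rewrite jk eqxx in kj.
  rewrite -mulrNN -invrN mulr_gt0 ?invr_gt0 // !opprB subr_gt0.
    by rewrite (lt_trans (ba j)) // (lt_trans (ab_lt kj')).
  by rewrite (lt_trans (ba j)) // (ab_lt kj').
rewrite mulr_gt0 ?invr_gt0 // subr_gt0; first exact: ab_lt.
by rewrite (lt_trans (ba k)) ?ab_lt.
Qed.

Lemma mu_ratio_gt0 i k : k != i -> 0 < (a i - b k) / (a i - a k).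
Proof.
move=> ki; have [ki'|ik|/val_inj ik] := ltngtP k i; last by rewrite ik eqxx in ki.
  rewrite -mulrNN -invrN mulr_gt0 ?invr_gt0 // !opprB subr_gt0; first exact: ab_lt.
  by rewrite (lt_trans (ab_lt ki')).
rewrite mulr_gt0 ?invr_gt0 // subr_gt0.
  by rewrite (lt_trans (ba k)) // (lt_trans (ab_lt ik)).
by rewrite (lt_trans (ab_lt ik)).
Qed.

Lemma nu_wt_gt0 j : 0 < nu_wt a b j.
Proof.
by rewrite mulr_gt0 ?subr_gt0 // prodr_gt0 // => k kj; apply: nu_ratio_gt0.
Qed.

Lemma mu_wt_gt0 i : 0 < mu_wt a b i.
Proof.
by rewrite mulr_gt0 ?subr_gt0 // prodr_gt0 // => k ki; apply: mu_ratio_gt0.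
Qed.

Definition alpha_vec : 'cV[R]_n := \col_i Num.sqrt (mu_wt a b i).
Definition beta_vec : 'cV[R]_n := \col_j Num.sqrt (nu_wt a b j).
Definition cauchy_mx : 'M[R]_n :=
  \matrix_(i, j) (alpha_vec i 0 * beta_vec j 0 / (a i - b j)).

Lemma alpha_vec2 i : alpha_vec i 0 ^+ 2 = mu_wt a b i.
Proof. by rewrite mxE sqr_sqrtr // ltW // mu_wt_gt0. Qed.
Lemma beta_vec2 j : beta_vec j 0 ^+ 2 = nu_wt a b j.
Proof. by rewrite mxE sqr_sqrtr // ltW // nu_wt_gt0. Qed.
Lemma alpha_gt0 i : 0 < alpha_vec i 0.
Proof. by rewrite mxE sqrtr_gt0 mu_wt_gt0. Qed.
Lemma beta_gt0 j : 0 < beta_vec j 0.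
Proof. by rewrite mxE sqrtr_gt0 nu_wt_gt0. Qed.

Lemma cauchy_mxK : cauchy_mx *m cauchy_mx^T = 1%:M.
Proof.
apply/matrixP => i l; rewrite !mxE.
transitivity (alpha_vec i 0 * alpha_vec l 0 *
    \sum_j nu_wt a b j / (a i - b j) / (a l - b j)).
  rewrite mulr_sumr; apply: eq_bigr => j _; rewrite -beta_vec2 [_^T _ _]mxE.
  rewrite [cauchy_mx i j]mxE [cauchy_mx l j]mxE.
  have i0 : a i - b j != 0 by rewrite subr_eq0 interlace_a_neq_b.
  have l0 : a l - b j != 0 by rewrite subr_eq0 interlace_a_neq_b.
  by field; rewrite i0 l0.
rewrite sum_nu2; [|exact: interlace_b_inj|exact: interlace_a_neq_b].
case: eqVneq => [<-|]; last by rewrite mul0r mulr0.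
by rewrite mul1r -alpha_vec2 expr2 divff // mulf_neq0 // gt_eqF // alpha_gt0.
Qed.

Lemma cauchy_mxTK : cauchy_mx^T *m cauchy_mx = 1%:M.
Proof. exact/mulmx1C/cauchy_mxK. Qed.

Lemma cauchy_mx_beta : cauchy_mx *m beta_vec = alpha_vec.
Proof.
apply/matrixP => i l; rewrite (ord1 l) mxE.
transitivity (alpha_vec i 0 * \sum_j nu_wt a b j / (a i - b j)).
  rewrite mulr_sumr; apply: eq_bigr => j _.
  rewrite -beta_vec2 [cauchy_mx i j]mxE expr2.
  have i0 : a i - b j != 0 by rewrite subr_eq0 interlace_a_neq_b.
  by field; rewrite i0.
(* At u = a_i the product in [sum_nu] vanishes, so the sum is 1. *)
rewrite sum_nu; [|exact: interlace_b_inj|exact: interlace_a_neq_b].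
by rewrite [X in X / _](bigD1 i) //= subrr !mul0r subr0 mulr1.
Qed.

Lemma cauchy_mx_displacement :
  diag_mx (\row_i a i) *m cauchy_mx =
  cauchy_mx *m (diag_mx (\row_i b i) + beta_vec *m beta_vec^T).
Proof.
rewrite mulmxDr mulmxA cauchy_mx_beta; apply/matrixP => i j.
rewrite mul_diag_mx mul_mx_diag !mxE big_ord1 !mxE.
have i0 : a i - b j != 0 by rewrite subr_eq0 interlace_a_neq_b.
by field; rewrite i0.
Qed.

(** Compare traces in diag(a) = O (diag(b) + beta beta^T) O^T. *)
Lemma sum_beta2 : \sum_j beta_vec j 0 ^+ 2 = \sum_j (a j - b j).
Proof.
have : diag_mx (\row_i a i) =
    cauchy_mx *m (diag_mx (\row_i b i) + beta_vec *m beta_vec^T) *m cauchy_mx^T.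
  by rewrite -cauchy_mx_displacement -mulmxA cauchy_mxK mulmx1.
move/(congr1 mxtrace).
rewrite mxtrace_mulC mulmxA cauchy_mxTK mul1mx raddfD /= !mxtrace_diag.
have rowE (c : 'I_n -> R) : \sum_j (\row_i c i) 0 j = \sum_j c j.
  by apply: eq_bigr => j _; rewrite mxE.
rewrite sumrB !rowE => ->; rewrite addrAC subrr add0r.
by apply: eq_bigr => j _; rewrite !mxE big_ord1 !mxE.
Qed.

End RealCauchy.

(** * Neumann series for a diagonal contraction times an orthogonal matrix *)

Section Neumann.
Variable (C : numClosedFieldType).

(** The squared Frobenius norm: a real orthogonal factor on the left preserves it and a diagonal
    factor scales it row by row, which suits Y = W O. *)
Definition frob2 (m k : nat) (Z : 'M[C]_(m, k)) : C := \sum_i \sum_j `|Z i j| ^+ 2.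

Lemma frob2_ge0 m k (Z : 'M[C]_(m, k)) : 0 <= frob2 Z.
Proof. by apply: sumr_ge0 => i _; apply: sumr_ge0 => j _; rewrite exprn_ge0. Qed.

Lemma frob2_entry m k (Z : 'M[C]_(m, k)) i j : `|Z i j| ^+ 2 <= frob2 Z.
Proof.
rewrite /frob2 (bigD1 i) //= (bigD1 j) //= -addrA lerDl addr_ge0 //.
  by apply: sumr_ge0 => l _; rewrite exprn_ge0.
by apply: sumr_ge0 => l _; apply: sumr_ge0 => l' _; rewrite exprn_ge0.
Qed.

Lemma frob2_eq0 m k (Z : 'M[C]_(m, k)) : frob2 Z = 0 -> Z = 0.
Proof.
move=> Z0; apply/matrixP => i j; rewrite mxE; apply/eqP; rewrite -normr_eq0 -sqrf_eq0.
by rewrite eq_le exprn_ge0 // andbT -Z0 frob2_entry.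
Qed.

Lemma frob2_trace m k (Z : 'M[C]_(m, k)) :
  frob2 Z = \tr ((map_mx Num.conj Z)^T *m Z).
Proof.
rewrite /frob2 exchange_big /=; apply: eq_bigr => j _; rewrite mxE.
by apply: eq_bigr => i _; rewrite !mxE normCK mulrC.
Qed.

Lemma frob2_orthogonal m k (O : 'M[C]_m) (Z : 'M[C]_(m, k)) :
  map_mx Num.conj O = O -> O^T *m O = 1%:M -> frob2 (O *m Z) = frob2 Z.
Proof.
move=> Oreal OO; rewrite !frob2_trace map_mxM Oreal trmx_mul.
by rewrite -mulmxA (mulmxA O^T) OO mul1mx.
Qed.

Lemma frob2_diag m k (w : 'rV[C]_m) (Z : 'M[C]_(m, k)) r :
  (forall i, `|w 0 i| ^+ 2 <= r) -> frob2 (diag_mx w *m Z) <= r * frob2 Z.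
Proof.
move=> wr; rewrite mul_diag_mx /frob2 mulr_sumr; apply: ler_sum => i _.
rewrite mulr_sumr; apply: ler_sum => j _.
by rewrite mxE normrM exprMn ler_wpM2r // exprn_ge0.
Qed.

(** The weight d is free so that the coefficient of the first term can be kept close to 1: that term
    later carries a factor r < 1, and the product has to stay below 1. *)
Lemma frob2D m k (Z1 Z2 : 'M[C]_(m, k)) d : 0 < d ->
  frob2 (Z1 + Z2) <= (1 + d) * frob2 Z1 + (1 + d^-1) * frob2 Z2.
Proof.
move=> d0; rewrite /frob2 !mulr_sumr -big_split; apply: ler_sum => i _ /=.
rewrite !mulr_sumr -big_split; apply: ler_sum => j _ /=.
rewrite mxE; apply: (@le_trans _ _ ((`|Z1 i j| + `|Z2 i j|) ^+ 2)).
  by rewrite lerXn2r ?nnegrE ?addr_ge0 // ler_normD.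
rewrite -subr_ge0.
have -> : (1 + d) * `|Z1 i j| ^+ 2 + (1 + d^-1) * `|Z2 i j| ^+ 2 -
    (`|Z1 i j| + `|Z2 i j|) ^+ 2 = (d * `|Z1 i j| - `|Z2 i j|) ^+ 2 / d.
  by field; rewrite gt_eqF.
rewrite divr_ge0 ?(ltW d0) // -realEsqr rpredB ?rpredM ?normr_real //.
exact: gtr0_real.
Qed.

(** Y contracts the squared Frobenius norm by r. The constant K is chosen before w and O, which
    makes the convergence uniform over all phases, hence over x and t. *)
Lemma neumann_series n r : 0 < r -> r < 1 -> exists2 K : C, 0 <= K &
  forall (w : 'rV[C]_n) (O : 'M[C]_n), (forall i, `|w 0 i| ^+ 2 <= r) ->
    map_mx Num.conj O = O -> O^T *m O = 1%:M ->
    let Y := diag_mx w *m O in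
    1%:M - Y \in unitmx /\
    forall m i j, `|(invmx (1%:M - Y) - \sum_(k < m) Y ^+ k) i j| ^+ 2 <= r ^+ m * K.
Proof.
move=> r0 r1.
(* With this d, (1 + d) r = (1 + r) / 2, so X = Y X + 1 leaves (1 - r) / 2 times the squared norm of
   X on the left; K is the resulting bound. *)
pose d := (1 - r) / (2 * r).
have d0 : 0 < d by rewrite divr_gt0 ?subr_gt0 // mulr_gt0.
pose K := (1 + d^-1) * frob2 (1%:M : 'M[C]_n) / ((1 - r) / 2).
have K0 : 0 <= K.
  rewrite /K !mulr_ge0 ?frob2_ge0 ?invr_ge0 ?addr_ge0 ?invr_ge0 ?(ltW d0) //.
  by rewrite mulr_ge0 ?invr_ge0 // subr_ge0 ltW.
exists K => // w O wr Oreal OO Y.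
have contr k (Z : 'M[C]_(n, k)) : frob2 (Y *m Z) <= r * frob2 Z.
  by rewrite -mulmxA (le_trans (frob2_diag _ wr)) // frob2_orthogonal.
have unit : 1%:M - Y \in unitmx.
  rewrite unitmxE unitfE; apply/negP; rewrite -det_tr => /det0P[v v0].
  move/(congr1 trmx); rewrite trmx_mul trmxK trmx0 mulmxBl mul1mx => /subr0_eq vY.
  have := contr _ v^T; rewrite -vY -subr_ge0 -{2}[frob2 _]mul1r -mulrBl => h.
  have : frob2 v^T = 0.
    apply/eqP; rewrite eq_le frob2_ge0 andbT.
    by move: h; rewrite nmulr_rge0 // subr_lt0.
  by move/frob2_eq0/(congr1 trmx); rewrite trmxK trmx0 => v0'; rewrite v0' eqxx in v0.
split=> // m i j.
set X := invmx _.
have XE : X = Y *m X + 1%:M.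
  by rewrite -(mulmxV unit) -/X mulmxBl mul1mx addrC subrK.
have XK : frob2 X <= K.
  rewrite /K ler_pdivlMr; last by rewrite divr_gt0 // subr_gt0.
  have : frob2 X <= (1 + d) * (r * frob2 X) + (1 + d^-1) * frob2 (1%:M : 'M[C]_n).
    rewrite {1}XE (le_trans (frob2D _ _ d0)) // lerD2r ler_wpM2l ?contr //.
    by rewrite addr_ge0 // ltW.
  have -> : frob2 X * ((1 - r) / 2) = frob2 X - (1 + d) * (r * frob2 X).
    by rewrite /d; field; rewrite gt_eqF.
  by rewrite lerBlDl.
have -> : X - \sum_(k < m) Y ^+ k = Y ^+ m *m X.
  have -> : \sum_(k < m) Y ^+ k = (1%:M - Y ^+ m) *m X.
    have E : (\sum_(k < m) Y ^+ k) *m (1%:M - Y) = 1%:M - Y ^+ m.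
      rewrite mulmxE; elim: (m) => [|l IH]; first by rewrite big_ord0 mul0r subrr.
      by rewrite big_ord_recr mulrDl IH mulrBr mulr1 -exprSr addrA subrK.
    by rewrite -E -mulmxA mulmxV // mulmx1.
  by rewrite mulmxBl mul1mx opprB addrC subrK.
have powr l : frob2 (Y ^+ l *m X) <= r ^+ l * frob2 X.
  elim: l => [|l IH]; first by rewrite expr0 mul1mx expr0 mul1r.
  rewrite exprS -mulmxE -mulmxA (le_trans (contr _ _)) // exprS -mulrA.
  by rewrite ler_wpM2l // ltW.
apply: (le_trans (frob2_entry _ _ _)); apply: (le_trans (powr _)).
by rewrite ler_wpM2l // exprn_ge0 // ltW.
Qed.
End Neumann.

Local Open Scope complex_scope.

(** * The potential *)

Section ComplexDerivative.
Variable (R : realType).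
Implicit Types (f g : R -> R[i]) (x : R).

Definition is_cderive (f : R -> R[i]) (x : R) (df : R[i]) : Prop :=
  is_derive x 1 (fun y => complex.Re (f y)) (complex.Re df) /\
  is_derive x 1 (fun y => complex.Im (f y)) (complex.Im df).

Lemma is_cderive_val f x df : is_cderive f x df -> cderive f x = df.
Proof.
move=> [[_ dRe] [_ dIm]]; rewrite /cderive !derive1E dRe dIm; by case: df {dRe dIm}.
Qed.

Lemma is_cderive_cst (c : R[i]) x : is_cderive (fun=> c) x 0.
Proof. by split; apply: is_derive_cst. Qed.

Lemma is_cderiveD f g x df dg :
  is_cderive f x df -> is_cderive g x dg -> is_cderive (fun y => f y + g y) x (df + dg).
Proof.
move=> [fR fI] [gR gI]; split.
  rewrite [X in is_derive _ _ X _](_ : _ =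
    (fun y => complex.Re (f y)) + (fun y => complex.Re (g y))); last first.
    by apply/funext => y /=; rewrite raddfD.
  by rewrite raddfD; apply: is_deriveD.
rewrite [X in is_derive _ _ X _](_ : _ =
  (fun y => complex.Im (f y)) + (fun y => complex.Im (g y))); last first.
  by apply/funext => y /=; rewrite raddfD.
by rewrite raddfD; apply: is_deriveD.
Qed.

Lemma is_cderiveM f g x df dg :
  is_cderive f x df -> is_cderive g x dg ->
  is_cderive (fun y => f y * g y) x (df * g x + f x * dg).
Proof.
have ReM (z w : R[i]) : complex.Re (z * w) =
    complex.Re z * complex.Re w - complex.Im z * complex.Im w by case: z; case: w.
have ImM (z w : R[i]) : complex.Im (z * w) =
    complex.Re z * complex.Im w + complex.Im z * complex.Re w by case: z; case: w.
have ReD (z w : R[i]) : complex.Re (z + w) = complex.Re z + complex.Re w by exact: raddfD.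
have ImD (z w : R[i]) : complex.Im (z + w) = complex.Im z + complex.Im w by exact: raddfD.
move=> [fR fI] [gR gI]; split.
  rewrite [X in is_derive _ _ X _](_ : _ =
    (fun y => complex.Re (f y)) * (fun y => complex.Re (g y)) -
    (fun y => complex.Im (f y)) * (fun y => complex.Im (g y))); last first.
    by apply/funext => y /=; rewrite ReM.
  apply: (is_derive_eq (is_deriveB (is_deriveM fR gR) (is_deriveM fI gI))).
  rewrite ReD !ReM /GRing.scale /=; ring.
rewrite [X in is_derive _ _ X _](_ : _ =
  (fun y => complex.Re (f y)) * (fun y => complex.Im (g y)) +
  (fun y => complex.Im (f y)) * (fun y => complex.Re (g y))); last first.
  by apply/funext => y /=; rewrite ImM.
apply: (is_derive_eq (is_deriveD (is_deriveM fR gI) (is_deriveM fI gR))).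
rewrite ImD !ImM /GRing.scale /=; ring.
Qed.

Lemma is_cderiveZ (c : R[i]) f x df :
  is_cderive f x df -> is_cderive (fun y => c * f y) x (c * df).
Proof.
by move=> /(is_cderiveM (is_cderive_cst c x)); rewrite mul0r add0r.
Qed.

Lemma is_cderive_sum (I : Type) (r : seq I) (f : I -> R -> R[i]) x df :
  (forall i, is_cderive (f i) x (df i)) ->
  is_cderive (fun y => \sum_(i <- r) f i y) x (\sum_(i <- r) df i).
Proof.
move=> fdf; elim: r => [|i r IH].
  rewrite big_nil; under [X in is_cderive X]eq_fun do rewrite big_nil.
  exact: is_cderive_cst.
rewrite big_cons; under [X in is_cderive X]eq_fun do rewrite big_cons.
exact: is_cderiveD.
Qed.

Lemma is_cderive_prod (I : eqType) (r : seq I) (f : I -> R -> R[i]) x df :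
  uniq r -> (forall i, is_cderive (f i) x (df i)) ->
  is_cderive (fun y => \prod_(i <- r) f i y) x
    (\sum_(k <- r) df k * \prod_(i <- r | i != k) f i x).
Proof.
move=> + fdf; elim: r => [_|i r IH /andP[ir ur]].
  rewrite big_nil; under [X in is_cderive X]eq_fun do rewrite big_nil.
  exact: is_cderive_cst.
rewrite big_cons; under [X in is_cderive X]eq_fun do rewrite big_cons.
have := is_cderiveM (fdf i) (IH ur).
congr (is_cderive _ _ _); congr (_ + _).
  rewrite big_cons eqxx; congr (_ * _).
  rewrite big_seq [RHS]big_seq_cond; apply: eq_bigl => k.
  by case: (boolP (k \in r)) => //= kr; apply/esym; apply: contra ir => /eqP <-.
rewrite mulr_sumr; apply: eq_big_seq => k kr.
rewrite big_cons ifT; first by rewrite mulrCA.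
by apply: contra ir => /eqP ->.
Qed.

(** Jacobi's formula, with the adjugate written through cofactors: the Leibniz expansion is
    differentiated row by row. *)
Lemma is_cderive_det n (M : R -> 'M[R[i]]_n) (dM : 'M[R[i]]_n) x :
  (forall i j, is_cderive (fun y => M y i j) x (dM i j)) ->
  is_cderive (fun y => \det (M y)) x (\sum_i \sum_j dM i j * cofactor (M x) i j).
Proof.
move=> MdM; rewrite /determinant.
have -> : \sum_i \sum_j dM i j * cofactor (M x) i j =
    \sum_(s : 'S_n) (-1) ^+ s *
      \sum_k dM k (s k) * \prod_(i < n | i != k) M x i (s i).
  under [RHS]eq_bigr => s _ do rewrite mulr_sumr.
  rewrite [RHS]exchange_big; apply: eq_bigr => k _.
  (* The terms in which row k is differentiated form the determinant of M with row k replaced by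
     that of dM, to be expanded along this row. *)
  pose N := \matrix_(i, j) (if i == k then dM k j else M x i j).
  transitivity (\det N).
    rewrite (expand_det_row _ k); apply: eq_bigr => j _.
    rewrite mxE eqxx; congr (_ * (_ * \det _)).
    by apply/matrixP => i l; rewrite !mxE [lift k i == k]eq_sym (negbTE (neq_lift _ _)).
  rewrite /determinant; apply: eq_bigr => s _; congr (_ * _).
  rewrite (bigD1 k) //= mxE eqxx; congr (_ * _); apply: eq_bigr => i ik.
  by rewrite mxE (negbTE ik).
apply: is_cderive_sum => s; apply: is_cderiveZ.
apply: is_cderive_prod; first exact: index_enum_uniq.
by move=> i; apply: MdM.
Qed.

Lemma is_cderive_expi_affine (k c x : R) :
  is_cderive (fun y => expi (k * y + c)) x (k%:C * 'i * expi (k * x + c)).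
Proof.
have aff : is_derive x 1 (fun y : R => k * y + c) k.
  have := is_deriveD (is_deriveZ k (is_derive_id x 1)) (is_derive_cst c x 1).
  by rewrite /GRing.scale /= mulr1 addr0.
split.
  apply: (is_derive_eq (is_derive1_comp (g := fun y : R => k * y + c)
    (is_derive_cos (k * x + c)) aff)) => /=; ring.
apply: (is_derive_eq (is_derive1_comp (g := fun y : R => k * y + c)
  (is_derive_sin (k * x + c)) aff)) => /=; ring.
Qed.
End ComplexDerivative.

Section ExpI.
Variable R : realType.
Implicit Types x y : R.

Lemma expiD x y : expi (x + y) = expi x * expi y.
Proof.
rewrite /expi cosD sinD; apply/eqP; rewrite eq_complex /= eqxx /=.
by apply/eqP; ring.
Qed.

Lemma expi0 : expi (0 : R) = 1.
Proof. by rewrite /expi cos0 sin0. Qed.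

Lemma expi_conj x : Num.conj (expi x) = expi (- x).
Proof. by rewrite /expi cosN sinN. Qed.

Lemma expi_mul_conj x : expi x * Num.conj (expi x) = 1.
Proof. by rewrite expi_conj -expiD subrr expi0. Qed.

Lemma norm_expi x : `|expi x| = 1.
Proof.
apply/eqP; rewrite -sqrp_eq1 // normCK; apply/eqP; exact: expi_mul_conj.
Qed.

Lemma expi_neq0 x : expi x != 0.
Proof. by rewrite -normr_eq0 norm_expi oner_neq0. Qed.
End ExpI.

(** * The multi-phase solution in terms of the matrices Y and X *)

Section MultiPhase.
Variables (R : realType) (n : nat) (su : 'I_n.+1 -> R) (sd : 'I_n -> R).
Hypothesis s_ordered : forall i : 'I_n, su_below su i < sd i /\ sd i < su_above su i.
Local Notation a := (su_above su).
Local Notation b := sd.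
Local Notation s := (su ord_max).

Lemma su_decreasing (i j : 'I_n.+1) : (i < j)%N -> su j < su i.
Proof.
case: j => j; elim: j => // j IH jn /=; rewrite ltnS leq_eqVlt => ij.
have jn' : (j < n)%N by [].
have step : su (Ordinal jn) < su (Ordinal (ltnW jn)).
  have [h1 h2] := s_ordered (Ordinal jn').
  have := lt_trans h1 h2; rewrite /su_below /su_above.
  by congr (su _ < su _); apply: val_inj.
case/orP: ij => [/eqP ij|ij]; last exact: lt_trans step (IH _ _).
by rewrite (_ : i = Ordinal (ltnW jn)) //; apply: val_inj.
Qed.

Lemma su_inj : injective su.
Proof.
move=> i j e; apply: val_inj; case: (ltngtP i j) => // /su_decreasing; by rewrite e ltxx.
Qed.

Lemma sd_lt_above i : b i < a i. Proof. by case: (s_ordered i). Qed.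

Lemma above_lt_sd (i j : 'I_n) : (i < j)%N -> a j < b i.
Proof.
move=> ij; apply: le_lt_trans (proj1 (s_ordered i)); rewrite /su_above /su_below.
move: ij; rewrite leq_eqVlt => /orP[/eqP ij|ij].
  by rewrite (_ : widen_ord _ _ = lift ord0 i) //; apply: val_inj; rewrite /= -ij.
by apply/ltW/su_decreasing.
Qed.

Lemma bottom_lt_sd i : s < b i.
Proof.
apply: le_lt_trans (proj1 (s_ordered i)); rewrite /su_below.
have [->|ne] := eqVneq (lift ord0 i) ord_max; first by [].
apply/ltW/su_decreasing; rewrite ltn_neqAle -ltnS ltn_ord andbT.
by apply: contra ne => /eqP e; apply/eqP/val_inj.
Qed.

(** The squared modulus of the i-th diagonal entry of W. It solves (a_i - s) q_i = b_i - s, the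
    relation behind [Bmx_adjoint]. *)
Definition qcoef i : R := (b i - s) / (a i - s).

Lemma bottom_lt_above i : s < a i.
Proof. exact: lt_trans (bottom_lt_sd i) (sd_lt_above i). Qed.

Lemma qcoef_gt0 i : 0 < qcoef i.
Proof. by rewrite divr_gt0 // subr_gt0 ?bottom_lt_sd ?bottom_lt_above. Qed.

Lemma qcoef_lt1 i : qcoef i < 1.
Proof. by rewrite ltr_pdivrMr ?subr_gt0 ?bottom_lt_above // mul1r ltrD2r sd_lt_above. Qed.

Lemma qcoef_bound : exists2 r : R, 0 < r < 1 & forall i, qcoef i <= r.
Proof.
exists (\big[Num.max/2^-1]_i qcoef i); last by move=> i; apply: le_bigmax.
apply/andP; split; first by apply: lt_le_trans (bigmax_ge_id _ _ _ _); lra.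
apply: bigmax_lt => [|i _]; [lra|exact: qcoef_lt1].
Qed.

(** Both sides are non-negative, so it is enough to compare squares, where mu, nu and Z^2 are
    products of the same ratios. The diagonal term of M thereby matches the inverse modulus of W. *)
Lemma Zcoef_cauchy i :
  alpha_vec a b i 0 * beta_vec a b i 0 / (a i - b i) * Zcoef su sd i =
  (Num.sqrt (qcoef i))^-1.
Proof.
have Z0 : 0 <= Zcoef su sd i.
  by rewrite mulr_ge0 ?sqrtr_ge0 // prodr_ge0 // => j _; rewrite sqrtr_ge0.
have ab0 := sd_lt_above i.
have bai : a i - b i != 0 by rewrite gt_eqF // subr_gt0.
apply/eqP; rewrite -(@eqrXn2 _ 2) ?invr_ge0 ?sqrtr_ge0 //; last first.
  rewrite mulr_ge0 // divr_ge0 ?mulr_ge0 // ltW ?subr_gt0 //.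
    exact: alpha_gt0 sd_lt_above above_lt_sd i.
  exact: beta_gt0 sd_lt_above above_lt_sd i.
apply/eqP; rewrite exprVn sqr_sqrtr ?ltW ?qcoef_gt0 //.
pose r1 k := (b i - a k) / (b i - b k).
pose r2 k := (a i - b k) / (a i - a k).
have r1_gt0 k : k != i -> 0 < r1 k by exact: nu_ratio_gt0 sd_lt_above above_lt_sd i k.
have r2_gt0 k : k != i -> 0 < r2 k by exact: mu_ratio_gt0 sd_lt_above above_lt_sd i k.
have Z2 : Zcoef su sd i ^+ 2 = (qcoef i)^-1 * (\prod_(k < n | k != i) (r1 k * r2 k))^-1.
  rewrite /Zcoef exprMn sqr_sqrtr; last first.
    by rewrite divr_ge0 // ltW // subr_gt0 ?bottom_lt_above ?bottom_lt_sd.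
  rewrite /qcoef invf_div -prodrXl -prodfV; congr (_ * _); apply: eq_bigr => k ki.
  have -> : (b i - b k) * (a i - a k) / ((a i - b k) * (b i - a k)) = (r1 k * r2 k)^-1.
    rewrite /r1 /r2 !invfM !invrK; ring.
  by rewrite sqr_sqrtr // invr_ge0 ltW // mulr_gt0 ?r1_gt0 ?r2_gt0.
have prodE : \prod_(k < n | k != i) (r1 k * r2 k) =
    (\prod_(k < n | k != i) r1 k) * (\prod_(k < n | k != i) r2 k).
  exact: big_split.
have muE : mu_wt a b i = (a i - b i) * \prod_(k < n | k != i) r2 k by [].
have nuE : nu_wt a b i = (a i - b i) * \prod_(k < n | k != i) r1 k by [].
rewrite [LHS]exprMn Z2 exprMn exprVn exprMn (alpha_vec2 sd_lt_above above_lt_sd).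
rewrite (beta_vec2 sd_lt_above above_lt_sd) muE nuE prodE.
have p1 : \prod_(k < n | k != i) r1 k != 0 by apply/prodf_neq0 => k /r1_gt0/lt0r_neq0.
have p2 : \prod_(k < n | k != i) r2 k != 0 by apply/prodf_neq0 => k /r2_gt0/lt0r_neq0.
have q0 : qcoef i != 0 by rewrite gt_eqF // qcoef_gt0.
move: (\prod_(k < n | k != i) r1 k) (\prod_(k < n | k != i) r2 k) p1 p2 => P1 P2 p1 p2.
by field; rewrite p1 p2 bai q0.
Qed.

Variables (eps : R) (chi : 'I_n -> R) (t : R).
Hypothesis eps_gt0 : 0 < eps.

Definition Wrow (x : R) : 'rV[R[i]]_n :=
  \row_i ((Num.sqrt (qcoef i))%:C * expi (phase eps su sd chi x t i)).
Definition Omx : 'M[R[i]]_n := map_mx (real_complex R) (cauchy_mx a b).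
Definition betaC : 'cV[R[i]]_n := map_mx (real_complex R) (beta_vec a b).
Definition Amx : 'M[R[i]]_n := diag_mx (\row_i (a i)%:C).
Definition Bmx : 'M[R[i]]_n := diag_mx (\row_i (b i)%:C).
Definition Ymx x := diag_mx (Wrow x) *m Omx.
Definition Xmx x := invmx (1%:M - Ymx x).
Definition pfun x := bil betaC betaC (Xmx x - 1%:M).

Lemma Omx_real : map_mx Num.conj Omx = Omx.
Proof. by apply/matrixP => i j; rewrite !mxE; apply: conjc_real. Qed.

Lemma Omx_TK : Omx^T *m Omx = 1%:M.
Proof.
by rewrite map_trmx -map_mxM (cauchy_mxTK sd_lt_above above_lt_sd) map_mx1.
Qed.

Lemma Omx_KT : Omx *m Omx^T = 1%:M.
Proof. exact/mulmx1C/Omx_TK. Qed.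

Lemma Wrow_norm x i : `|Wrow x 0 i| ^+ 2 = (qcoef i)%:C.
Proof.
rewrite mxE normrM norm_expi mulr1 normc_def /= expr0n addr0 sqrtr_sqr.
rewrite ger0_norm ?sqrtr_ge0 // -rmorphXn sqr_sqrtr // ltW //; exact: qcoef_gt0.
Qed.

Lemma Xmx_unit x : 1%:M - Ymx x \in unitmx.
Proof.
have [r /andP[r0 r1] qr] := qcoef_bound.
have [||K _ H] := @neumann_series R[i] n r%:C; [by rewrite ltcR|by rewrite ltcR|].
have wr i : `|Wrow x 0 i| ^+ 2 <= r%:C by rewrite Wrow_norm lecR.
by have [] := H _ _ wr Omx_real Omx_TK.
Qed.

Lemma Omx_displacement : Amx *m Omx = Omx *m (Bmx + betaC *m betaC^T).
Proof.
have := cauchy_mx_displacement sd_lt_above above_lt_sd.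
move/(congr1 (map_mx (real_complex R))); rewrite !map_mxM map_mxD map_mxM -map_trmx.
rewrite !map_diag_mx /Amx /Bmx.
by congr (diag_mx _ *m _ = _ *m (diag_mx _ + _)); apply/matrixP => i j; rewrite !mxE.
Qed.

Lemma Ymx_displacement x : Amx *m Ymx x = Ymx x *m (Bmx + betaC *m betaC^T).
Proof.
rewrite /Ymx mulmxA /Amx mulmx_diag -/Amx.
rewrite (_ : \row_j _ = \row_j (Wrow x 0 j * (\row_i (a i)%:C) 0 j)); last first.
  by apply/rowP => j; rewrite !mxE mulrC.
by rewrite -mulmx_diag -!mulmxA -/Amx Omx_displacement.
Qed.

Lemma trace_pfun x :
  \sum_i (a i - b i)%:C * Xmx x i i = \sum_i (a i - b i)%:C + pfun x.
Proof.
have U := Xmx_unit x.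
have -> : \sum_i (a i - b i)%:C * Xmx x i i = \tr ((Amx - Bmx) *m Xmx x).
  apply: eq_bigr => i _; rewrite /Amx /Bmx -raddfB mul_diag_mx !mxE; congr (_ * _).
  by rewrite rmorphB.
rewrite (trace_displacement (Ymx_displacement x) (mulVmx U) (mulmxV U)).
congr (_ + _); rewrite /Amx /Bmx !mxtrace_diag -sumrB.
by apply: eq_bigr => i _; rewrite !mxE rmorphB.
Qed.

(** By Jacobi's formula the logarithmic derivative is the trace of M^-1 dM, and dM is diagonal. The
    scalings that relate M to the conjugate of 1 - Y cancel in every diagonal entry, which leaves
    the sum of (a_i - b_i) Re X_ii that [trace_pfun] evaluates. *)
Lemma multiphaseE x : multiphase eps su sd chi x t =
  s + \sum_i (a i - b i) + 2 * complex.Re (pfun x).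
Proof.
pose Xb := map_mx Num.conj (Xmx x); pose Wb := map_mx Num.conj (Wrow x).
pose M := Mmat eps su sd chi x t.
pose al i : R[i] := (alpha_vec a b i 0)%:C.
pose be i : R[i] := (beta_vec a b i 0)%:C.
pose e i := expi (phase eps su sd chi x t i).
have al0 i : al i != 0.
  by rewrite /al fmorph_eq0 gt_eqF // (alpha_gt0 sd_lt_above above_lt_sd).
have be0 i : be i != 0.
  by rewrite /be fmorph_eq0 gt_eqF // (beta_gt0 sd_lt_above above_lt_sd).
pose rho i : R[i] := (Num.sqrt (qcoef i))^-1%:C.
(* The conjugate of X with the two diagonal scalings of M undone; the left scaling al^-1 rho e is
   inverted by al times conj W, as [eW] below shows. *)
pose Minv := \matrix_(i, j) (be i * Xb i j * Wb 0 j * al j).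
have Xbinv : (1%:M - diag_mx Wb *m Omx) *m Xb = 1%:M.
  have := congr1 (map_mx Num.conj) (mulmxV (Xmx_unit x)).
  rewrite map_mxM map_mxB map_mxM map_mx1 Omx_real map_diag_mx.
  by [].
have eW i : rho i * e i * Wb 0 i = 1.
  rewrite /Wb mxE mxE rmorphM /= -/(e i).
  have -> : Num.conj (Num.sqrt (qcoef i))%:C = (Num.sqrt (qcoef i))%:C by exact: conjc_real.
  rewrite mulrACA -rmorphM mulVf ?mul1r; first exact: expi_mul_conj.
  by rewrite gt_eqF // sqrtr_gt0 qcoef_gt0.
have rhoZ i : (al i)^-1 * (be i)^-1 * rho i = ((a i - b i)^-1)%:C * (Zcoef su sd i)%:C.
  rewrite /rho -Zcoef_cauchy; move: (Zcoef su sd i) => Z.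
  rewrite !rmorphM /= -/(al i) -/(be i).
  move: (_^-1)%:C Z%:C => c z; by field; rewrite al0 be0.
clearbody rho.
have ME : M = \matrix_(i, j) ((al i)^-1 * (rho i * e i) *
     (1%:M - diag_mx Wb *m Omx) i j * (be j)^-1).
  have QE i j : (1%:M - diag_mx Wb *m Omx) i j =
      (i == j)%:R - Wb 0 i * (al i * be j * (a i - b j)^-1%:C).
    rewrite mul_diag_mx [LHS]mxE [1%:M i j]mxE [X in _ + X]mxE [X in - X]mxE.
    by rewrite [Omx i j]mxE [cauchy_mx _ _ i j]mxE !rmorphM.
  apply/matrixP => i j; rewrite [LHS]mxE [RHS]mxE QE -/(e i).
  have E : (al i)^-1 * (rho i * e i) * (Wb 0 i * (al i * be j * (a i - b j)^-1%:C)) / be j =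
       (rho i * e i * Wb 0 i) * (a i - b j)^-1%:C.
    move: (al0 i) (be0 j) ((a i - b j)^-1)%:C.
    move: (al i) (be j) (rho i) (e i) (Wb 0 i) => al' be' r e' w al'0 be'0 c.
    by field; rewrite al'0 be'0.
  rewrite mulrBr mulrBl E eW mul1r; have [<-|_] := eqVneq i j.
    rewrite mulrDr mulr1 mul1r [in RHS]addrC mulrN1; congr (_ + _).
    by rewrite [LHS]mulrA -rhoZ; ring.
  by rewrite !mul0r mulr0 mul0r addr0 sub0r mulrN1.
have MM : M *m Minv = 1%:M.
  apply/matrixP => i k; rewrite mxE.
  transitivity ((al i)^-1 * (rho i * e i) * ((1%:M - diag_mx Wb *m Omx) *m Xb) i k *
     Wb 0 k * al k).
    rewrite [(_ *m Xb) i k]mxE mulr_sumr !mulr_suml; apply: eq_bigr => j _.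
    by rewrite ME [X in X * _]mxE [Minv j k]mxE; field; rewrite al0 be0.
  rewrite Xbinv [1%:M i k]mxE; have [<-|_] := eqVneq i k; last by rewrite mulr0 !mul0r.
  by rewrite mulr1 -[_ * _ * Wb 0 i]mulrA eW mulr1 mulVf.
have Munit : M \in unitmx by case: (mulmx1_unit MM).
have MinvE : invmx M = Minv.
  by rewrite -[LHS]mulmx1 -MM mulKmx.
pose dM := diag_mx (\row_i (((a i - b i) / eps)%:C * 'i * ((al i)^-1 * (be i)^-1 * rho i * e i))) : 'M[R[i]]_n.
have dME i j : is_cderive (fun y => Mmat eps su sd chi y t i j) x (dM i j).
  rewrite mxE [X in X *+ _]mxE.
  pose k := (a i - b i) / eps; pose c := k * (- chi i - 2^-1 * (sd i + a i) * t).
  have phE y : phase eps su sd chi y t i = k * y + c by rewrite /phase /c -/k; ring.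
  have := is_cderiveZ ((a i - b j)^-1)%:C (is_cderiveD (is_cderive_cst (-1) x)
    (is_cderiveZ ((i == j)%:R * (Zcoef su sd i)%:C) (is_cderive_expi_affine k c x))).
  congr (is_cderive _ _ _).
    by apply/funext => y; rewrite mxE phE.
  rewrite add0r -phE -/(e i) rhoZ; have [<-|_] := eqVneq i j; last by rewrite !mul0r mulr0.
  rewrite -/k (_ : true%:R = 1 :> R[i]) // mulr1n mul1r.
  move: k%:C ((a i - b i)^-1)%:C (Zcoef su sd i)%:C (e i) => k' c' z e'.
  by move: ('i : R[i]) => I; ring.
rewrite /multiphase (is_cderive_val (is_cderive_det dME)) -/M.
have -> : (\sum_i \sum_j dM i j * cofactor M i j) / \det M =
    \sum_i ((a i - b i) / eps)%:C * ('i * Xb i i).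
  rewrite mulr_suml; apply: eq_bigr => i _.
  rewrite (bigD1 i) //= big1 ?addr0 => [|j ji]; last first.
    by rewrite mxE eq_sym (negbTE ji) mulr0n mul0r.
  have -> : dM i i * cofactor M i i / \det M = dM i i * invmx M i i.
    have -> : invmx M i i = (\det M)^-1 * cofactor M i i.
      by rewrite /invmx Munit mxE /adjugate mxE.
    by rewrite -mulrA [cofactor _ _ _ * _]mulrC.
  rewrite MinvE mxE [X in X *+ _]mxE eqxx mulr1n [Minv i i]mxE.
  transitivity (((a i - b i) / eps)%:C * 'i * ((rho i * e i * Wb 0 i) * Xb i i)).
    rewrite -[LHS]mulrA; congr (_ * _).
    by field; rewrite al0 be0.
  by rewrite eW mul1r mulrA.
have := congr1 (@complex.Re R) (trace_pfun x); rewrite raddfD /= !raddf_sum /=.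
have ReZ (c : R) (z : R[i]) : complex.Re (c%:C * z) = c * complex.Re z.
  by case: z => z1 z2 /=; rewrite mul0r subr0.
have ImZ (c : R) (z : R[i]) : complex.Im (c%:C * z) = c * complex.Im z.
  by case: z => z1 z2 /=; rewrite mul0r addr0.
under eq_bigr => i _ do rewrite ReZ.
move=> E.
have -> : \sum_i complex.Im (((a i - b i) / eps)%:C * ('i * Xb i i)) =
    eps^-1 * \sum_i (a i - b i) * complex.Re (Xmx x i i).
  rewrite mulr_sumr; apply: eq_bigr => i _; rewrite ImZ /Xb mxE.
  by case: (Xmx x i i) => z1 z2 /=; rewrite mul0r mul1r add0r; ring.
have eE z : 2 * eps * (eps^-1 * z) = 2 * z by field; rewrite gt_eqF.
by rewrite E eE sumrN; ring.
Qed.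
End MultiPhase.

Lemma geometric_small (R : realType) (r K e : R) : 0 < r < 1 -> 0 < e ->
  exists m : nat, r ^+ m * K <= e.
Proof.
move=> /andP[r0 r1] e0.
have : (geometric K r @ \oo --> (0 : R))%classic.
  by apply: cvg_geometric; rewrite gtr0_norm.
move/cvgrPdist_lt => /(_ _ e0)[m _ /(_ m)] /= H; exists m.
have := H (leqnn _); rewrite sub0r normrN mulrC => /ltW; apply: le_trans.
exact: ler_norm.
Qed.

(** * Elementary inequalities for the complex modulus *)

Section Normc.
Variable R : realType.
Implicit Types z w : R[i].

Lemma ReB z w : complex.Re (z - w) = complex.Re z - complex.Re w.
Proof. by case: z; case: w. Qed.

Lemma normcE' z : `|z| = (Normc.normc z)%:C. Proof. by []. Qed.

Lemma normc_ge0 z : 0 <= Normc.normc z.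
Proof. by have : 0 <= `|z| := normr_ge0 z; rewrite normcE' lecR. Qed.

Lemma normc_leD z w : Normc.normc (z + w) <= Normc.normc z + Normc.normc w.
Proof.
by have : `|z + w| <= `|z| + `|w| := ler_normD z w; rewrite !normcE' -rmorphD lecR.
Qed.

Lemma normc_opp z : Normc.normc (- z) = Normc.normc z.
Proof. by have : `|- z| = `|z| := normrN z; rewrite !normcE' => /complexI. Qed.

Lemma normc_distC z w : Normc.normc (z - w) = Normc.normc (w - z).
Proof. by rewrite -normc_opp opprB. Qed.

Lemma normc_le_sum (I : Type) (r : seq I) (P : pred I) (F : I -> R[i]) :
  Normc.normc (\sum_(i <- r | P i) F i) <= \sum_(i <- r | P i) Normc.normc (F i).
Proof.
elim/big_rec2: _ => [|i y x _ le_xy]; first by rewrite Normc.normc0.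
by rewrite (le_trans (normc_leD _ _)) // lerD2l.
Qed.

Lemma normc_real (x : R) : Normc.normc x%:C = `|x|.
Proof. by rewrite /Normc.normc /= expr0n addr0 sqrtr_sqr. Qed.

Lemma normc_expi (x : R) : Normc.normc (expi x) = 1.
Proof. by apply: complexI; exact: norm_expi. Qed.

Lemma normc_sqr z : Normc.normc z ^+ 2 = complex.Re z ^+ 2 + complex.Im z ^+ 2.
Proof. by case: z => x y; rewrite /= sqr_sqrtr // addr_ge0 ?sqr_ge0. Qed.

Lemma normc_le_ReIm z : Normc.normc z <= `|complex.Re z| + `|complex.Im z|.
Proof.
rewrite -(@ler_pXn2r _ 2) ?nnegrE ?normc_ge0 ?addr_ge0 // normc_sqr sqrrD !real_normK ?num_real //.
by rewrite addrAC lerDl mulrn_wge0 // mulr_ge0.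
Qed.

Lemma normRe_le z : `|complex.Re z| <= Normc.normc z.
Proof.
rewrite -(@ler_pXn2r _ 2) ?nnegrE ?normc_ge0 // normc_sqr real_normK ?num_real //.
by rewrite lerDl sqr_ge0.
Qed.

Lemma normIm_le z : `|complex.Im z| <= Normc.normc z.
Proof.
rewrite -(@ler_pXn2r _ 2) ?nnegrE ?normc_ge0 // normc_sqr real_normK ?num_real //.
by rewrite lerDr sqr_ge0.
Qed.

Lemma normc_eq0 z : (Normc.normc z == 0) = (z == 0).
Proof. by apply/eqP/eqP => [/Normc.eq0_normc|->]; rewrite ?Normc.normc0. Qed.
End Normc.

Lemma bil_sum (F : fieldType) (n : nat) (rho beta : 'cV[F]_n) m (Z : 'I_m -> 'M[F]_n) :
  bil rho beta (\sum_(k < m) Z k) = \sum_(k < m) bil rho beta (Z k).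
Proof.
rewrite /bil mulmx_sumr mulmx_suml summxE; by apply: eq_bigr.
Qed.

Definition bil_norm (R : realType) (n : nat) (rho beta : 'cV[R[i]]_n) : R :=
  \sum_i \sum_j Normc.normc (rho i 0) * Normc.normc (beta j 0).

Lemma bil_norm_ge0 (R : realType) (n : nat) (rho beta : 'cV[R[i]]_n) :
  0 <= bil_norm rho beta.
Proof.
by apply: sumr_ge0 => j _; apply: sumr_ge0 => l _; rewrite mulr_ge0 ?normc_ge0.
Qed.

Lemma normc_bil_le (R : realType) (n : nat) (rho beta : 'cV[R[i]]_n) (Z : 'M[R[i]]_n) (e : R) :
  (forall i j, Normc.normc (Z i j) <= e) ->
  Normc.normc (bil rho beta Z) <= bil_norm rho beta * e.
Proof.
move=> Ze; rewrite bilE mulr_suml; apply: le_trans (normc_le_sum _ _ _) _.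
apply: ler_sum => i _; rewrite mulr_suml; apply: le_trans (normc_le_sum _ _ _) _.
apply: ler_sum => j _; rewrite !Normc.normcM mulrAC.
by rewrite ler_wpM2l // mulr_ge0 ?normc_ge0.
Qed.

Section Approximation.
Variables (R : realType) (n : nat) (su : 'I_n.+1 -> R) (sd : 'I_n -> R) (eps : R).
Hypothesis s_ordered : forall i : 'I_n, su_below su i < sd i /\ sd i < su_above su i.

(** The number of terms is chosen before chi, t and x, since the approximation by exponential sums
    has to be uniform. It has the form [m.+2] so that the terms 1 and Y are always present and can
    be split off. *)
Lemma Xmx_approx (e : R) : 0 < e -> exists m : nat,
  forall (chi : 'I_n -> R) (t x : R) i j,
    Normc.normc ((Xmx su sd eps chi t x - \sum_(k < m.+2) Ymx su sd eps chi t x ^+ k) i j) <= e.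
Proof.
move=> e0.
have [r /andP[r0 r1] qr] := qcoef_bound s_ordered.
have [||K K0 H] := @neumann_series R[i] n r%:C; [by rewrite ltcR|by rewrite ltcR|].
have KE : K = (complex.Re K)%:C by rewrite RRe_real // ger0_real.
have [|m rm] := @geometric_small R r (complex.Re K) (e ^+ 2) _ (exprn_gt0 2 e0).
  by rewrite r0.
exists m => chi t x i j; rewrite -lecR -normcE'.
have wr l : `|Wrow su sd eps chi t x 0 l| ^+ 2 <= r%:C by rewrite Wrow_norm ?lecR.
have [_ /(_ m.+2 i j)] := H _ _ wr (Omx_real su sd) (Omx_TK s_ordered).
have -> : r%:C ^+ m.+2 * K = (r ^+ m.+2 * complex.Re K)%:C by rewrite rmorphM rmorphXn /= -KE.
move=> h; have e0C : 0 <= e%:C by rewrite lecR ltW.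
have : `|(Xmx su sd eps chi t x - \sum_(k < m.+2) Ymx su sd eps chi t x ^+ k) i j| ^+ 2 <= e%:C ^+ 2.
  apply: le_trans h _; rewrite -rmorphXn lecR; apply: le_trans rm.
  have K0' : 0 <= complex.Re K by rewrite -ler0c -KE.
  by rewrite ler_wpM2r // (ler_wiXn2l (ltW r0) (ltW r1)) // ltnW.
by rewrite ler_pXn2r // nnegrE.
Qed.
End Approximation.

(** * Integrality of the wave numbers *)

Section ExponentialSums.
Variable R : realType.
Implicit Types (S : R -> R -> Prop) (f g : R -> R -> R[i]).

(** Trigonometric polynomials in x and t. The coefficients stay anonymous; S records which pairs of
    wave number and time frequency may occur. *)
Definition expsum S f := exists l : seq (R[i] * (R * R)),
  (forall z, z \in l -> S z.2.1 z.2.2) /\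
  forall x t, f x t = \sum_(z <- l) z.1 * expi (z.2.1 * x + z.2.2 * t).

Lemma expsum_mono S S' f :
  (forall k o, S k o -> S' k o) -> expsum S f -> expsum S' f.
Proof. by move=> SS' [l [lS fE]]; exists l; split => // z /lS /SS'. Qed.

Lemma expsum_ext S f g : (forall x t, f x t = g x t) -> expsum S f -> expsum S g.
Proof. by move=> fg [l [lS fE]]; exists l; split => // x t; rewrite -fg. Qed.

Lemma expsum1 S c k o : S k o -> expsum S (fun x t => c * expi (k * x + o * t)).
Proof.
move=> Sko; exists [:: (c, (k, o))]; split => [z|x t].
  by rewrite inE => /eqP ->.
by rewrite big_seq1.
Qed.

Lemma expsumD S f g : expsum S f -> expsum S g -> expsum S (fun x t => f x t + g x t).
Proof.
move=> [l [lS fE]] [l' [lS' gE]]; exists (l ++ l'); split => [z|x t].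
  by rewrite mem_cat => /orP[/lS|/lS'].
by rewrite big_cat /= fE gE.
Qed.

Lemma expsum_sum (I : Type) (r : seq I) (P : pred I) S (f : I -> R -> R -> R[i]) :
  (forall i, P i -> expsum S (f i)) -> expsum S (fun x t => \sum_(i <- r | P i) f i x t).
Proof.
move=> fS; elim: r => [|i r IH].
  by exists [::]; split => // x t; rewrite !big_nil.
have [Pi|nPi] := boolP (P i).
  by apply: expsum_ext (expsumD (fS i Pi) IH) => x t; rewrite big_cons Pi.
by apply: expsum_ext IH => x t; rewrite big_cons (negbTE nPi).
Qed.

Lemma expsumM S S' S'' f g :
  (forall k o k' o', S k o -> S' k' o' -> S'' (k + k') (o + o')) ->
  expsum S f -> expsum S' g -> expsum S'' (fun x t => f x t * g x t).
Proof.
move=> SS [l [lS fE]] [l' [lS' gE]].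
exists [seq (z.1 * z'.1, (z.2.1 + z'.2.1, z.2.2 + z'.2.2)) | z <- l, z' <- l'].
split => [z|x t].
  by move=> /allpairsP[[u u'] /= [ul ul' ->]] /=; exact: SS (lS u ul) (lS' u' ul').
rewrite fE gE big_allpairs_dep mulr_suml; apply: eq_bigr => z _.
rewrite mulr_sumr; apply: eq_bigr => z' _ /=.
rewrite mulrACA -expiD; congr (_ * expi _); ring.
Qed.

Lemma expsumZ S c f : expsum S f -> expsum S (fun x t => c * f x t).
Proof.
move=> [l [lS fE]]; exists [seq (c * z.1, z.2) | z <- l]; split => [z|x t].
  by move=> /mapP[u ul ->]; exact: (lS u ul).
by rewrite fE big_map mulr_sumr; apply: eq_bigr => z _; rewrite mulrA.
Qed.

Lemma expsum_shift S f d : expsum S f -> expsum S (fun x t => f (x + d) t).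
Proof.
move=> [l [lS fE]]; exists [seq (z.1 * expi (z.2.1 * d), z.2) | z <- l]; split => [z|x t].
  by move=> /mapP[u ul ->]; exact: (lS u ul).
rewrite fE big_map; apply: eq_bigr => z _ /=; rewrite -mulrA -expiD.
by congr (_ * expi _); ring.
Qed.

(* Averaging over pts kills every character of the list: adjoin the translate of
   pts by a point at which a given character is -1. *)
Lemma killing_points (l : seq (R * R)) :
  (forall z, z \in l -> z != (0, 0)) ->
  exists2 pts : seq (R * R), (0 < size pts)%N &
    forall z, z \in l -> \sum_(y <- pts) expi (z.1 * y.1 + z.2 * y.2) = 0.
Proof.
elim: l => [_|z l IH nz]; first by exists [:: (0, 0)].
have [|pts pts0 kill] := IH; first by move=> w wl; apply: nz; rewrite inE wl orbT.
have [d zd] : exists d : R * R, expi (z.1 * d.1 + z.2 * d.2) = -1.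
  have epi : expi (pi : R) = -1 by rewrite /expi cospi sinpi; apply/eqP; rewrite eq_complex /= oppr0 !eqxx.
  have [z1|z1] := eqVneq z.1 0.
    have z2 : z.2 != 0.
      apply: contraTneq (nz z (mem_head _ _)) => z2.
      by rewrite negbK; apply/eqP; rewrite [z]surjective_pairing z1 z2.
    by exists (0, pi / z.2); rewrite /= mulr0 add0r mulrC divfK.
  by exists (pi / z.1, 0); rewrite /= mulr0 addr0 mulrC divfK.
exists (pts ++ [seq (y.1 + d.1, y.2 + d.2) | y <- pts]).
  by rewrite size_cat ltn_addr.
have splitE w : \sum_(y <- pts ++ [seq (y.1 + d.1, y.2 + d.2) | y <- pts])
     expi (w.1 * y.1 + w.2 * y.2) =
   (1 + expi (w.1 * d.1 + w.2 * d.2)) * \sum_(y <- pts) expi (w.1 * y.1 + w.2 * y.2).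
  rewrite big_cat big_map /= mulrDl mul1r; congr (_ + _).
  rewrite mulr_sumr; apply: eq_bigr => y _; rewrite -expiD; congr expi; ring.
move=> w; rewrite inE splitE => /orP[/eqP ->|wl].
  by rewrite zd subrr mul0r.
by rewrite kill // mulr0.
Qed.

Lemma expsum_kill S f g : (forall k o, S k o -> (k, o) != (0, 0)) ->
  expsum S f -> expsum S g ->
  exists2 pts : seq (R * R), (0 < size pts)%N &
    \sum_(y <- pts) f y.1 y.2 = 0 /\ \sum_(y <- pts) g y.1 y.2 = 0.
Proof.
move=> S0 [l [lS fE]] [l' [lS' gE]].
have [|pts pts0 kill] := @killing_points ([seq z.2 | z <- l] ++ [seq z.2 | z <- l']).
  move=> z; rewrite mem_cat => /orP[] /mapP[u ul ->].
    by rewrite [u.2]surjective_pairing; exact: S0 (lS u ul).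
  by rewrite [u.2]surjective_pairing; exact: S0 (lS' u ul).
exists pts => //; split.
  under eq_bigr => y _ do rewrite fE.
  rewrite exchange_big big1_seq //= => z zl; rewrite -mulr_sumr kill ?mulr0 //.
  by rewrite mem_cat map_f.
under eq_bigr => y _ do rewrite gE.
rewrite exchange_big big1_seq //= => z zl; rewrite -mulr_sumr kill ?mulr0 //.
by rewrite mem_cat (map_f _ zl) orbT.
Qed.

(** Let T be the exponential sum close to G. All its wave numbers are positive, so T^2 has mean
    zero, while G^2 = -|G|^2 because G is imaginary. Hence |G|^2 has a mean of order e^2, and D, the
    mean of T times a conjugate character, is of order e. Means are finite averages over killing
    points. *)
Lemma expsum_coef_eq0 (G : R -> R -> R[i]) (D : R[i]) (k o : R) : 0 < k ->
  (forall x t, complex.Re (G x t) = 0) ->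
  (forall e : R, 0 < e -> exists2 Q,
     expsum (fun k' o' => 0 < k' /\ (k', o') != (k, o)) Q &
     forall x t, Normc.normc (G x t - (D * expi (k * x + o * t) + Q x t)) <= e) ->
  D = 0.
Proof.
move=> k0 G0 GQ.
(* Origin of the constant: |G|^2 has mean at most 6 e^2 and |T| <= 2 e + |G|^2 / (4 e), so that |D|
   <= 7/2 e. *)
suff D_le e : 0 < e -> Normc.normc D <= 4 * e.
  apply/eqP; rewrite -normc_eq0 eq_le normc_ge0 andbT; apply/ler_addgt0Pl => e e0.
  have e4 : 0 < e / 4 by lra.
  have := D_le _ e4; lra.
move=> e0; have [Q SQ GT] := GQ e e0.
pose chi (y : R * R) := expi (k * y.1 + o * y.2).
pose T x t := D * expi (k * x + o * t) + Q x t.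
pose S k' o' := (k', o') != (0 : R, 0 : R).
have ST2 : expsum S (fun x t => T x t * T x t).
  have ST : expsum (fun k' _ : R => 0 < k') T.
    apply: expsumD; first exact: expsum1.
    by apply: expsum_mono SQ => ? ? [].
  apply: (expsumM _ ST ST) => k1 o1 k2 o2 h1 h2; rewrite /S xpair_eqE negb_and gt_eqF //.
  exact: addr_gt0.
have SQc : expsum S (fun x t => Q x t * (1 * expi (- k * x + - o * t))).
  apply: expsumM SQ (expsum1 1 (S := fun k' o' => k' = - k /\ o' = - o) _) => //.
  move=> k1 o1 k2 o2 [_ ne] [-> ->]; rewrite /S; apply: contra ne.
  by rewrite !xpair_eqE !subr_eq0.
have [pts pts0 [kT2 kQ]] := expsum_kill (fun _ _ h => h) ST2 SQc.
pose N : R := (size pts)%:R.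
have N0 : 0 < N by rewrite ltr0n.
have sumN (c : R) : \sum_(y <- pts) c = c * N.
  by rewrite big_const_seq count_predT iter_addr_0 mulr_natr.
pose g (y : R * R) := Normc.normc (G y.1 y.2).
have gE y : g y ^+ 2 = - complex.Re (G y.1 y.2 ^+ 2).
  rewrite /g normc_sqr G0 expr0n add0r; move: (G0 y.1 y.2).
  by rewrite [G _ _ ^+ 2]expr2; case: (G _ _) => u v /= ->; ring.
have g_le : \sum_(y <- pts) g y ^+ 2 <= 6 * e ^+ 2 * N.
  (* The part g^2 / 2 on the right is absorbed into the left-hand side, which leaves the bound 6
     e^2. *)
  have : \sum_(y <- pts) g y ^+ 2 <= \sum_(y <- pts) (g y ^+ 2 / 2 + 3 * e ^+ 2).
    have -> : \sum_(y <- pts) g y ^+ 2 =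
        \sum_(y <- pts) complex.Re (T y.1 y.2 * T y.1 y.2 - G y.1 y.2 ^+ 2).
      rewrite -raddf_sum sumrB kT2 sub0r raddfN raddf_sum -sumrN.
      by apply: eq_bigr => y _; rewrite gE.
    apply: ler_sum => y _; have := GT y.1 y.2; rewrite -/(T _ _) -/(g y).
    set d := _ - _; move=> de.
    have -> : T y.1 y.2 * T y.1 y.2 - G y.1 y.2 ^+ 2 = - d * (2 * G y.1 y.2 - d).
      by rewrite /d; ring.
    apply: le_trans (ler_norm _) _; apply: le_trans (normRe_le _) _.
    rewrite Normc.normcM normc_opp.
    have : Normc.normc (2 * G y.1 y.2 - d) <= 2 * g y + e.
      apply: le_trans (normc_leD _ _) _; rewrite normc_opp Normc.normcM.
      have -> : Normc.normc (2 : R[i]) = 2.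
        by rewrite (_ : 2 = 2%:C) ?normc_real ?ger0_norm // rmorphMn.
      by rewrite lerD2l.
    have := normc_ge0 d; have := normc_ge0 (2 * G y.1 y.2 - d).
    have := normc_ge0 (G y.1 y.2); rewrite -/(g y).
    move: (Normc.normc d) (Normc.normc (2 * _ - d)) (g y) de => d' m' g' de g0 m0 d0 mle.
    have : d' * m' <= e * (2 * g' + e) by apply: ler_pM.
    have := sqr_ge0 (g' - 2 * e); nra.
  rewrite big_split -mulr_suml sumN /=; lra.
have T_le : \sum_(y <- pts) Normc.normc (T y.1 y.2) <=
    \sum_(y <- pts) (2 * e + g y ^+ 2 / (4 * e)).
  apply: ler_sum => y _.
  have : Normc.normc (T y.1 y.2) <= g y + e.
    rewrite -[T y.1 y.2](subrK (G y.1 y.2)) addrC; apply: le_trans (normc_leD _ _) _.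
    by rewrite lerD2l normc_distC.
  have : g y <= e + g y ^+ 2 / (4 * e).
    rewrite -subr_ge0.
    have -> : e + g y ^+ 2 / (4 * e) - g y = (g y - 2 * e) ^+ 2 / (4 * e).
      by field; rewrite gt_eqF.
    by rewrite divr_ge0 ?sqr_ge0 // mulr_ge0 // ltW.
  lra.
have DN : D * N%:C = \sum_(y <- pts) T y.1 y.2 * Num.conj (chi y).
  have -> : \sum_(y <- pts) T y.1 y.2 * Num.conj (chi y) =
      \sum_(y <- pts) D + \sum_(y <- pts) Q y.1 y.2 * (1 * expi (- k * y.1 + - o * y.2)).
    rewrite -big_split; apply: eq_bigr => y _ /=; rewrite /T mulrDl -mulrA.
    rewrite expi_mul_conj mulr1 /chi expi_conj mul1r opprD !mulNr.
    by [].
  by rewrite kQ addr0 big_const_seq count_predT iter_addr_0 /N rmorph_nat mulr_natr.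
have : Normc.normc D * N <= \sum_(y <- pts) Normc.normc (T y.1 y.2).
  rewrite -[N]ger0_norm ?(ltW N0) // -normc_real -Normc.normcM DN.
  apply: le_trans (normc_le_sum _ _ _) _; apply: ler_sum => y _.
  by rewrite Normc.normcM expi_conj normc_expi mulr1.
move: T_le; rewrite big_split sumN -mulr_suml /= => T_le DT.
have gN : (\sum_(y <- pts) g y ^+ 2) / (4 * e) <= 3 / 2 * e * N.
  rewrite ler_pdivrMr; last by rewrite mulr_gt0.
  by apply: le_trans g_le _; rewrite le_eqVlt; apply/orP; left; apply/eqP; field.
rewrite -(ler_pM2r N0); apply: le_trans (le_trans DT T_le) _.
have : 0 < e * N by rewrite mulr_gt0.
nra.
Qed.
End ExponentialSums.

Section Integrality.
Variable R : realType.

Lemma expi_2pi_int (k : R) : expi (k * (2 * pi)) = 1 -> k \is a Num.int.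
Proof.
have nat1 (m : nat) : expi (m%:R * (2 * pi) : R) = 1.
  elim: m => [|m IH]; first by rewrite mul0r expi0.
  rewrite -natr1 mulrDl mul1r expiD IH mul1r /expi mulr_natl cos2pi sin2pi.
  by [].
have int1 (m : int) : expi (m%:~R * (2 * pi) : R) = 1.
  case: m => m; first exact: nat1.
  rewrite NegzE mulrNz mulNr -expi_conj pmulrn nat1.
  exact: conjc1.
move=> k1; have kE := subrK (Num.floor k)%:~R k.
set f := k - (Num.floor k)%:~R in kE.
have f0 : 0 <= f by rewrite subr_ge0 floor_le.
have f1 : f < 1 by rewrite ltrBlDl -[1]/(1%:~R) -intrD lt_succ_floor.
have : expi (f * (2 * pi)) = 1.
  by have := expiD (f * (2 * pi)) ((Num.floor k)%:~R * (2 * pi)); rewrite int1 mulr1 -mulrDl kE k1.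
move/(congr1 (@complex.Re R)) => /= cos1.
suff f_eq0 : f = 0 by rewrite -kE f_eq0 add0r.
apply/eqP; rewrite eq_le f0 andbT leNgt; apply/negP => f_gt0.
(* The fractional part f satisfies cos (2 pi f) = 1 - 2 sin^2 (pi f), and the sine is positive on
   the open interval from 0 to pi. *)
have sinf : 0 < sin (f * pi).
  by rewrite sin_gt0_pi // mulr_gt0 ?pi_gt0 //= gtr_pMl ?pi_gt0.
have fE : f * (2 * pi) = (f * pi) *+ 2 by rewrite -mulr_natr; ring.
move: cos1; rewrite fE cos_mulr2n => cos1.
have := cos2Dsin2 (f * pi); have := exprn_gt0 2 sinf.
rewrite -mulr_natr in cos1; lra.
Qed.

Variables (n : nat) (su : 'I_n.+1 -> R) (sd chi : 'I_n -> R) (eps : R).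
Hypothesis s_ordered : forall i : 'I_n, su_below su i < sd i /\ sd i < su_above su i.
Hypothesis eps_gt0 : 0 < eps.
Hypothesis v_periodic : forall x t : R,
  multiphase eps su sd chi (x + 2 * pi) t = multiphase eps su sd chi x t.
Local Notation a := (su_above su).
Local Notation b := sd.

Let kap i := (a i - b i) / eps.
Let om i := - kap i * (2^-1 * (b i + a i)).
Let Y t x := Ymx su sd eps chi t x.
Let cw i : R[i] := (Num.sqrt (qcoef su sd i))%:C * expi (- (kap i * chi i)).

Let kap_gt0 i : 0 < kap i.
Proof. by rewrite divr_gt0 // subr_gt0; case: (s_ordered i). Qed.

Let YE t x i j : Y t x i j = (cw i * Omx su sd i j) * expi (kap i * x + om i * t).
Proof.
rewrite /Y /Ymx mul_diag_mx mxE [Wrow _ _ _ _ _ _ _ _]mxE /phase -/(kap i).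
have -> : kap i * (x - chi i - 2^-1 * (b i + a i) * t) =
  (kap i * x + om i * t) + (- (kap i * chi i)) by rewrite /om; ring.
by rewrite expiD /cw; ring.
Qed.

(* Let k0 be the least non-integral wave number.  No product of at least two entries of
   Y has wave number k0, so that the k0-part of p(x + 2 pi) - p(x) comes from Y alone
   and is a nonzero multiple of e^(2 pi i k0) - 1. *)
Lemma frequency_int i : kap i \is a Num.int.
Proof.
apply/negPn/negP => nint_i.
pose P i := kap i \isn't a Num.int.
have [i0 nint0 min0] := @arg_minP _ _ _ i P kap nint_i.
set k0 := kap i0.
(* The wave numbers of Y lie in U by minimality of k0. If two elements of U added up to k0, both
   would be below k0, hence integers, and k0 would be an integer too; so products land in U2. *)
pose U (k _ : R) := 0 < k /\ (k < k0 -> k \is a Num.int).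
pose U2 (k o : R) := U k o /\ k != k0.
have UU k o k' o' : U k o -> U k' o' -> U2 (k + k') (o + o').
  move=> [k_gt0 kint] [k'_gt0 k'int].
  have sum_int : k + k' <= k0 -> k + k' \is a Num.int.
    by move=> le; rewrite rpredD ?kint ?k'int //; lra.
  split; first by split; [exact: addr_gt0|move/ltW/sum_int].
  apply/eqP => e; have := sum_int; rewrite e lexx => /(_ isT) h.
  by move: nint0; rewrite /P -/k0 h.
have Ukap j : U (kap j) (om j).
  split=> // lt; apply/negPn/negP => /min0; by rewrite leNgt lt.
have YU j l : expsum U (fun x t => Y t x j l).
  have := expsum1 (cw j * Omx su sd j l) (Ukap j).
  by apply: expsum_ext => x t; rewrite YE.
have YX m j l : expsum U2 (fun x t => (Y t x ^+ m.+2) j l).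
  have mulE (Z : R -> R -> 'M[R[i]]_n) : (forall j l, expsum U (fun x t => Z x t j l)) ->
      forall j l, expsum U2 (fun x t => (Y t x * Z x t) j l).
    move=> ZU j' l'.
    have := @expsum_sum R 'I_n (index_enum 'I_n) xpredT U2
      (fun k x t => Y t x j' k * Z x t k l') (fun k _ => expsumM UU (YU j' k) (ZU k l')).
    by apply: expsum_ext => x t; rewrite -mulmxE mxE.
  elim: m j l => [|m IH] j l.
    exact: (mulE (fun x t => Y t x)) YU j l.
  have := @mulE (fun x t => Y t x ^+ m.+2) (fun j l => expsum_mono (fun _ _ h => proj1 h) (IH j l)) j l.
  by apply: expsum_ext => x t; rewrite exprS.
pose c1 j := betaC su sd j 0 * cw j * (alpha_vec a b j 0)%:C.
(* Periodicity of v constrains the real part of p only: G is known to be imaginary, not to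
   vanish. *)
pose G x t := pfun su sd eps chi t (x + 2 * pi) - pfun su sd eps chi t x.
have G0 x t : complex.Re (G x t) = 0.
  have := v_periodic x t.
  rewrite (multiphaseE s_ordered chi t eps_gt0 x).
  rewrite (multiphaseE s_ordered chi t eps_gt0 (x + 2 * pi)) => /addrI h.
  have two0 : (2 : R) != 0 by rewrite pnatr_eq0.
  have h' := mulfI two0 h.
  by rewrite /G ReB; apply/eqP; rewrite subr_eq0; apply/eqP; exact: h'.
have bilY x t : bil (betaC su sd) (betaC su sd) (Y t x) =
    \sum_j c1 j * expi (kap j * x + om j * t).
  rewrite /bil -mulmxA mxE; apply: eq_bigr => j _; rewrite mxE [X in _ * X]mxE.
  have := cauchy_mx_beta (sd_lt_above s_ordered) (above_lt_sd s_ordered).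
  move/matrixP => /(_ j 0) E; rewrite /c1 -E [(_ *m _) j 0]mxE rmorph_sum /=.
  rewrite !mulr_sumr mulr_suml; apply: eq_bigr => l _; rewrite YE rmorphM /=.
  by rewrite [Omx _ _ _ _]mxE [betaC _ _ l _]mxE; ring.
pose S k' o' := 0 < k' /\ (k', o') != (k0, om i0).
have D0 : c1 i0 * (expi (k0 * (2 * pi)) - 1) = 0.
  apply: (expsum_coef_eq0 (o := om i0) (kap_gt0 i0) G0) => e e0.
  pose Bn := bil_norm (betaC su sd) (betaC su sd).
  have Bn0 : 0 <= Bn by exact: bil_norm_ge0.
  (* Adding 1 to the norm keeps the denominator positive, and each of the two values of p in G is
     allowed an error e / 2. *)
  have e'0 : 0 < e / (2 * (Bn + 1)) by rewrite divr_gt0 // mulr_gt0 // ltr_wpDl.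
  have [m Xm] := Xmx_approx eps s_ordered e'0.
  pose Pm x t := bil (betaC su sd) (betaC su sd) (\sum_(k < m.+1) Y t x ^+ k.+1).
  pose Rf x t := \sum_(j | j != i0) c1 j * expi (kap j * x + om j * t) +
    \sum_(k < m) bil (betaC su sd) (betaC su sd) (Y t x ^+ k.+2).
  have PE x t : Pm x t = c1 i0 * expi (k0 * x + om i0 * t) + Rf x t.
    rewrite /Pm bil_sum big_ord_recl expr1 bilY (bigD1 i0) //= -addrA; congr (_ + (_ + _)).
  have PX x t : Normc.normc (pfun su sd eps chi t x - Pm x t) <= e / 2.
    rewrite /pfun /Pm -bilB -addrA -opprD.
    have -> : 1%:M + \sum_(k < m.+1) Y t x ^+ k.+1 = \sum_(k < m.+2) Y t x ^+ k.
      by rewrite [RHS]big_ord_recl expr0.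
    apply: le_trans (normc_bil_le _ _ (Xm chi t x)) _; rewrite -/Bn.
    rewrite mulrA ler_pdivrMr; last by rewrite mulr_gt0 // ltr_wpDl.
    have -> : e / 2 * (2 * (Bn + 1)) = Bn * e + e by field.
    by rewrite lerDl ltW.
  have RS : expsum S Rf.
    apply: expsumD.
      apply: expsum_sum => j ji0; apply: expsum1; split=> //.
      apply: contra ji0; rewrite xpair_eqE => /andP[/eqP kj /eqP oj].
      (* A mode with the wave number and the time frequency of i0 would also share the midpoint of b
         and a, and strict interlacing excludes this for j != i0. *)
      have k00 : - k0 != 0 by rewrite oppr_eq0 gt_eqF // kap_gt0.
      have := oj; rewrite /om kj => /(mulfI k00).
      have [lt|lt|/val_inj -> //] := ltngtP j i0.
        have := above_lt_sd s_ordered lt; have := sd_lt_above s_ordered i0.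
        have := sd_lt_above s_ordered j; lra.
      have := above_lt_sd s_ordered lt; have := sd_lt_above s_ordered i0.
      have := sd_lt_above s_ordered j; lra.
    apply: expsum_sum => k _.
    apply: (@expsum_mono _ U2) => [k' o' [[k'0 _] ne]|].
      by split=> //; rewrite xpair_eqE negb_and ne.
    apply: expsum_ext (fun x t => esym (bilE _ _ _)) _.
    apply: expsum_sum => j _; apply: expsum_sum => l _.
    have := expsumZ (betaC su sd j 0 * betaC su sd l 0) (YX k j l).
    by apply: expsum_ext => x t; ring.
  exists (fun x t => Rf (x + 2 * pi) t + -1 * Rf x t).
    exact: (expsumD (expsum_shift (2 * pi) RS) (expsumZ (-1) RS)).
  move=> x t; rewrite -/k0.
  have -> : G x t - (c1 i0 * (expi (k0 * (2 * pi)) - 1) * expi (k0 * x + om i0 * t) +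
       (Rf (x + 2 * pi) t + -1 * Rf x t)) =
    (pfun su sd eps chi t (x + 2 * pi) - Pm (x + 2 * pi) t) -
    (pfun su sd eps chi t x - Pm x t).
    rewrite /G !PE.
    have -> : k0 * (x + 2 * pi) + om i0 * t = k0 * (2 * pi) + (k0 * x + om i0 * t) by ring.
    rewrite [expi (_ + (_ + _))]expiD.
    have aux (p1 p2 c E h r1 r2 : R[i]) : (p2 - p1) - (c * (E - 1) * h + (r2 + -1 * r1)) =
      (p2 - (c * (E * h) + r2)) - (p1 - (c * h + r1)) by ring.
    exact: aux.
  apply: le_trans (normc_leD _ _) _; rewrite normc_opp.
  by apply: le_trans (lerD (PX (x + 2 * pi) t) (PX x t)) _; rewrite -splitr.
move/eqP: D0; rewrite mulf_eq0 subr_eq0 => /orP[|/eqP/expi_2pi_int k0int]; last first.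
  by move: nint0; rewrite /P -/k0 k0int.
rewrite /c1 !mulf_eq0 (negbTE (expi_neq0 _)) orbF [betaC _ _ _ _]mxE !fmorph_eq0.
have sba := sd_lt_above s_ordered; have sab := above_lt_sd s_ordered.
rewrite (gt_eqF (beta_gt0 sba sab _)) (gt_eqF (alpha_gt0 sba sab _)) orbF /=.
by rewrite gt_eqF // sqrtr_gt0 qcoef_gt0.
Qed.

Lemma frequency_nat i : exists k : nat, (0 < k)%N /\ kap i = k%:R.
Proof.
have /natrP[k kE] : kap i \is a Num.nat by rewrite natrEint frequency_int ltW.
by exists k; split => //; rewrite -(@ltr0n R) -kE.
Qed.
End Integrality.

Local Open Scope classical_set_scope.

(** * Square-integrable functions and the Hardy space *)

Section Mean.
Variable R : realType.
Local Notation mu := (@lebesgue_measure R).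
Local Notation I := (torus (R := R) : set (measurableTypeR R)).
Implicit Types f g : R -> R.

Definition tint f := mu.-integrable I (EFin \o f).

Lemma mtorus : measurable (I : set (measurableTypeR R)).
Proof. exact: measurable_itv. Qed.

Lemma two_pi_gt0 : 0 < 2 * pi :> R.
Proof. by rewrite mulr_gt0 ?pi_gt0. Qed.

Lemma torus_measure : mu I = (2 * pi)%:E.
Proof. by rewrite /torus lebesgue_measure_itv /= lte_fin two_pi_gt0 oppr0 addr0. Qed.

Lemma tint_measurable f : tint f -> measurable_fun I f.
Proof. by move=> /measurable_int /measurable_EFinP. Qed.

Lemma tint_le f g : measurable_fun I f -> (forall x, `|f x| <= g x) -> tint g -> tint f.
Proof.
move=> mf fg ig; apply: (le_integrable mtorus _ _ ig).
  exact/measurable_EFinP.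
by move=> x _ /=; rewrite lee_fin (le_trans (fg x)) // ler_norm.
Qed.

Lemma tint_cst (c : R) : tint (fun=> c).
Proof.
apply: measurable_bounded_integrable => //; first exact: mtorus.
  by rewrite [X in (X < _)%E]torus_measure ltry.
by exists `|c|; split => // M cM x _ /=; exact: ltW.
Qed.

Lemma tint_bounded f (M : R) : measurable_fun I f -> (forall x, `|f x| <= M) -> tint f.
Proof. by move=> mf fM; apply: (tint_le mf fM); apply: tint_cst. Qed.

Lemma tintD f g : tint f -> tint g -> tint (fun x => f x + g x).
Proof. by move=> hf hg; have := integrableD mtorus hf hg. Qed.

Lemma tintZ c f : tint f -> tint (fun x => c * f x).
Proof. by move=> hf; have := integrableZl mtorus c hf. Qed.

Lemma tintB f g : tint f -> tint g -> tint (fun x => f x - g x).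
Proof. by move=> hf hg; have := integrableB mtorus hf hg. Qed.

Lemma tint_norm f : tint f -> tint (fun x => `|f x|).
Proof. by move=> hf; have := integrable_abse hf. Qed.

Lemma meanD f g : tint f -> tint g -> mean (fun x => f x + g x) = mean f + mean g.
Proof. by move=> hf hg; rewrite /mean RintegralD // ?mulrDr //; exact: mtorus. Qed.

Lemma meanZ c f : tint f -> mean (fun x => c * f x) = c * mean f.
Proof. by move=> hf; rewrite /mean RintegralZl // 1?mulrCA //; exact: mtorus. Qed.

Lemma meanB f g : tint f -> tint g -> mean (fun x => f x - g x) = mean f - mean g.
Proof. by move=> hf hg; rewrite /mean RintegralB // ?mulrBr //; exact: mtorus. Qed.

Lemma mean_ge0 f : (forall x, 0 <= f x) -> 0 <= mean f.
Proof.
move=> f0; rewrite /mean mulr_ge0 ?invr_ge0 ?(ltW two_pi_gt0) //.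
by apply: Rintegral_ge0 => x _.
Qed.

Lemma mean_le f g : tint f -> tint g -> (forall x, f x <= g x) -> mean f <= mean g.
Proof.
move=> hf hg fg; rewrite /mean ler_wpM2l ?invr_ge0 ?(ltW two_pi_gt0) //.
by apply: le_Rintegral => //; exact: mtorus.
Qed.

Lemma mean_cst (c : R) : mean (fun=> c) = c.
Proof.
rewrite /mean Rintegral_cst; last exact: mtorus.
have -> : fine (mu (torus (R := R))) = 2 * pi by exact: (congr1 fine torus_measure).
by rewrite mulrC mulfK // gt_eqF // two_pi_gt0.
Qed.

Lemma norm_mean_le f : tint f -> `|mean f| <= mean (fun x => `|f x|).
Proof.
move=> hf; rewrite /mean normrM ger0_norm ?invr_ge0 ?(ltW two_pi_gt0) //.
rewrite ler_wpM2l ?invr_ge0 ?(ltW two_pi_gt0) //.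
by apply: le_normr_Rintegral => //; exact: mtorus.
Qed.

Lemma mean_ae f g : f = g %[ae mu in I] -> measurable_fun I f -> measurable_fun I g ->
  mean f = mean g.
Proof.
move=> fg mf mg; rewrite /mean /Rintegral; congr (_ * fine _).
apply: ae_eq_integral => //; [exact: mtorus|exact/measurable_EFinP|exact/measurable_EFinP|].
by apply: filterS fg => x h Ix; rewrite h.
Qed.
End Mean.

Section ComplexMean.
Variable R : realType.
Local Notation mu := (@lebesgue_measure R).
Local Notation I := (torus (R := R)).
Implicit Types f g : R -> R[i].

Definition cint f := tint (fun x => complex.Re (f x)) /\ tint (fun x => complex.Im (f x)).

Lemma cReD (z w : R[i]) : complex.Re (z + w) = complex.Re z + complex.Re w.
Proof. by case: z; case: w. Qed.
Lemma cImD (z w : R[i]) : complex.Im (z + w) = complex.Im z + complex.Im w.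
Proof. by case: z; case: w. Qed.
Lemma cReM (z w : R[i]) : complex.Re (z * w) =
    complex.Re z * complex.Re w - complex.Im z * complex.Im w.
Proof. by case: z; case: w. Qed.
Lemma cImM (z w : R[i]) : complex.Im (z * w) =
    complex.Re z * complex.Im w + complex.Im z * complex.Re w.
Proof. by case: z; case: w. Qed.
Lemma cReJ (z : R[i]) : complex.Re (Num.conj z) = complex.Re z. Proof. by case: z. Qed.
Lemma cImJ (z : R[i]) : complex.Im (Num.conj z) = - complex.Im z. Proof. by case: z. Qed.

Lemma cintD f g : cint f -> cint g -> cint (fun x => f x + g x).
Proof.
move=> [fR fI] [gR gI]; split.
  by under [X in tint X]eq_fun do rewrite cReD; apply: tintD.
by under [X in tint X]eq_fun do rewrite cImD; apply: tintD.
Qed.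

Lemma cintZ c f : cint f -> cint (fun x => c * f x).
Proof.
move=> [fR fI]; split.
  under [X in tint X]eq_fun do rewrite cReM.
  by apply: tintB; apply: tintZ.
under [X in tint X]eq_fun do rewrite cImM.
by apply: tintD; apply: tintZ.
Qed.

Lemma cint_conj f : cint f -> cint (fun x => Num.conj (f x)).
Proof.
move=> [fR fI]; split.
  by under [X in tint X]eq_fun do rewrite cReJ.
under [X in tint X]eq_fun do rewrite cImJ -mulN1r.
exact: tintZ.
Qed.

Lemma cmeanD f g : cint f -> cint g -> cmean (fun x => f x + g x) = cmean f + cmean g.
Proof.
move=> [fR fI] [gR gI]; rewrite /cmean.
under [X in mean X +i* _]eq_fun do rewrite cReD.
under [X in _ +i* mean X]eq_fun do rewrite cImD.
by rewrite !meanD.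
Qed.

Lemma cmeanZ c f : cint f -> cmean (fun x => c * f x) = c * cmean f.
Proof.
move=> [fR fI]; rewrite /cmean.
under [X in mean X +i* _]eq_fun do rewrite cReM.
under [X in _ +i* mean X]eq_fun do rewrite cImM.
rewrite meanB ?meanD; try exact: tintZ.
by rewrite !meanZ //; case: c.
Qed.

Lemma cmean_conj f : cint f -> cmean (fun x => Num.conj (f x)) = Num.conj (cmean f).
Proof.
move=> [fR fI]; rewrite /cmean.
under [X in mean X +i* _]eq_fun do rewrite cReJ.
under [X in _ +i* mean X]eq_fun do rewrite cImJ -mulN1r.
by rewrite meanZ // mulN1r.
Qed.

Lemma cmean_cst (c : R[i]) : cmean (fun=> c) = c.
Proof. by rewrite /cmean !mean_cst; case: c. Qed.

Lemma cmean0 : cmean (fun=> 0 : R[i]) = 0. Proof. exact: cmean_cst. Qed.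

Lemma cint_cst (c : R[i]) : cint (fun=> c).
Proof. by split; apply: tint_cst. Qed.
End ComplexMean.

Section L2.
Variable R : realType.
Local Notation mu := (@lebesgue_measure R).
Local Notation I := (torus (R := R) : set (measurableTypeR R)).
Local Notation nc := Normc.normc.
Implicit Types f g h : R -> R[i].

Definition cmeasurable f := measurable_fun I (fun x => complex.Re (f x)) /\
  measurable_fun I (fun x => complex.Im (f x)).

Definition norm2 f : R := mean (fun x => nc (f x) ^+ 2).

Lemma cmeasurable_normc2 f : cmeasurable f -> measurable_fun I (fun x => nc (f x) ^+ 2).
Proof.
move=> [mR mI]; under eq_fun do rewrite normc_sqr.
by apply: measurable_funD; apply: measurable_funX.
Qed.

Lemma cmeasurableM f g : cmeasurable f -> cmeasurable g -> cmeasurable (fun x => f x * g x).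
Proof.
move=> [fR fI] [gR gI]; split.
  under eq_fun do rewrite cReM.
  by apply: measurable_funB; apply: measurable_funM.
under eq_fun do rewrite cImM.
by apply: measurable_funD; apply: measurable_funM.
Qed.

Lemma cmeasurableD f g : cmeasurable f -> cmeasurable g -> cmeasurable (fun x => f x + g x).
Proof.
move=> [fR fI] [gR gI]; split.
  by under eq_fun do rewrite cReD; apply: measurable_funD.
by under eq_fun do rewrite cImD; apply: measurable_funD.
Qed.

Lemma cmeasurable_conj f : cmeasurable f -> cmeasurable (fun x => Num.conj (f x)).
Proof.
move=> [fR fI]; split; first by under eq_fun do rewrite cReJ.
by under eq_fun do rewrite cImJ; apply: measurableT_comp.
Qed.

Lemma cmeasurable_cst (c : R[i]) : cmeasurable (fun=> c).
Proof. by split; apply: measurable_cst. Qed.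

(** Trades the finiteness of an extended real norm for integrability, the form in which the rules
    for integrals apply. *)
Lemma L2P f : L2 f <-> cmeasurable f /\ tint (fun x => nc (f x) ^+ 2).
Proof.
split=> [[mR mI fin]|[mf ti]].
  have mf : cmeasurable f by [].
  split=> //; apply/integrableP; split.
    by apply/measurable_EFinP; exact: cmeasurable_normc2.
  have -> : (\int[mu]_(x in I) `|(EFin \o (fun x => (nc (f x) ^+ 2)%R)) x| =
      \int[mu]_(x in I) (nc (f x) ^+ 2)%:E)%E.
    by apply: eq_integral => x _ /=; rewrite ger0_norm // exprn_ge0 // normc_ge0.
  move: fin; rewrite /sqnorm.
  have : (0 <= \int[mu]_(x in I) (nc (f x) ^+ 2)%:E)%E.
    by apply: integral_ge0 => x _; rewrite lee_fin exprn_ge0 // normc_ge0.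
  case: (\int[mu]_(x in I) (nc (f x) ^+ 2)%:E)%E => [r _ _| _|//]; first exact: ltry.
  by rewrite gt0_muley // lte_fin invr_gt0 two_pi_gt0.
have [mR mI] := mf; split=> //; rewrite /sqnorm.
have := integrable_fin_num (@mtorus R) ti.
rewrite /comp => fn; rewrite -(fineK fn) -EFinM; exact: ltry.
Qed.

Lemma sqnormE f : L2 f -> sqnorm f = (norm2 f)%:E.
Proof.
move=> /L2P[mf ti]; rewrite /sqnorm /norm2 /mean EFinM; congr (_ * _)%E.
exact/esym/fineK/(integrable_fin_num (@mtorus R) ti).
Qed.

Lemma norm2_ge0 f : 0 <= norm2 f.
Proof. by apply: mean_ge0 => x; rewrite exprn_ge0 // normc_ge0. Qed.

Lemma normc_mul_le (z w : R[i]) l : 0 < l ->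
  nc z * nc w <= (l * nc z ^+ 2 + l^-1 * nc w ^+ 2) / 2.
Proof.
move=> l0; rewrite -subr_ge0.
have -> : (l * nc z ^+ 2 + l^-1 * nc w ^+ 2) / 2 - nc z * nc w =
   (l * nc z - nc w) ^+ 2 / l / 2 by field; rewrite gt_eqF.
by rewrite !divr_ge0 ?sqr_ge0 // ltW.
Qed.

Lemma L2_mul f g : L2 f -> L2 g -> cint (fun x => Num.conj (f x) * g x).
Proof.
move=> /L2P[mf tf] /L2P[mg tg].
have [mR mI] := cmeasurableM (cmeasurable_conj mf) mg.
have ti : tint (fun x => 2^-1 * (nc (f x) ^+ 2 + nc (g x) ^+ 2)).
  by apply: tintZ; apply: tintD.
have le x : nc (Num.conj (f x) * g x) <= 2^-1 * (nc (f x) ^+ 2 + nc (g x) ^+ 2).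
  rewrite Normc.normcM (_ : nc (Num.conj (f x)) = nc (f x)).
    by have := normc_mul_le (f x) (g x) ltr01; rewrite invr1 !mul1r [leRHS]mulrC.
  by case: (f x) => u v; rewrite /= sqrrN.
split; apply: tint_le ti => // x; apply: le_trans (le x).
  exact: normRe_le.
exact: normIm_le.
Qed.

Lemma L2D f g : L2 f -> L2 g -> L2 (fun x => f x + g x).
Proof.
move=> /L2P[mf tf] /L2P[mg tg]; apply/L2P; split; first exact: cmeasurableD.
have ti : tint (fun x => 2 * (nc (f x) ^+ 2 + nc (g x) ^+ 2)).
  by apply: tintZ; apply: tintD.
apply: tint_le ti; first exact: cmeasurable_normc2 (cmeasurableD mf mg).
move=> x; rewrite ger0_norm ?exprn_ge0 ?normc_ge0 //.
have := normc_leD (f x) (g x); have := normc_ge0 (f x + g x).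
have := sqr_ge0 (nc (f x) - nc (g x)); nra.
Qed.

Lemma L2_bounded f (M : R) : cmeasurable f -> (forall x, nc (f x) <= M) -> L2 f.
Proof.
move=> mf fM; apply/L2P; split=> //; apply: (tint_bounded (M := M ^+ 2)).
  exact: cmeasurable_normc2.
move=> x; rewrite ger0_norm ?exprn_ge0 ?normc_ge0 //.
by rewrite ler_pXn2r ?nnegrE ?normc_ge0 // (le_trans _ (fM x)) ?normc_ge0.
Qed.

Lemma L2M_bounded f g (M : R) : cmeasurable f -> (forall x, nc (f x) <= M) -> L2 g ->
  L2 (fun x => f x * g x).
Proof.
move=> mf fM /L2P[mg tg]; apply/L2P; split; first exact: cmeasurableM.
apply: (tint_le _ _ (tintZ (M ^+ 2) tg)); first exact: cmeasurable_normc2 (cmeasurableM mf mg).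
move=> x; rewrite ger0_norm ?exprn_ge0 ?normc_ge0 // Normc.normcM exprMn.
rewrite ler_wpM2r ?exprn_ge0 ?normc_ge0 //.
by rewrite ler_pXn2r ?nnegrE ?normc_ge0 // (le_trans _ (fM x)) ?normc_ge0.
Qed.

Lemma L2_cst (c : R[i]) : L2 (fun=> c).
Proof. by apply: (@L2_bounded _ (nc c)) => // ; apply: cmeasurable_cst. Qed.

Lemma L2Z c f : L2 f -> L2 (fun x => c * f x).
Proof. by apply: (@L2M_bounded _ _ (nc c)) => //; apply: cmeasurable_cst. Qed.

Lemma L2B f g : L2 f -> L2 g -> L2 (fun x => f x - g x).
Proof.
move=> hf hg; have := L2D hf (L2Z (-1) hg).
by under [X in L2 X]eq_fun do rewrite mulN1r.
Qed.

Lemma braketDr f g h : L2 f -> L2 g -> L2 h ->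
  braket f (fun x => g x + h x) = braket f g + braket f h.
Proof.
move=> hf hg hh; rewrite /braket -cmeanD; [|exact: L2_mul..].
by congr cmean; apply/funext => x; rewrite mulrDr.
Qed.

Lemma braketZr c f g : L2 f -> L2 g -> braket f (fun x => c * g x) = c * braket f g.
Proof.
move=> hf hg; rewrite /braket -cmeanZ; last exact: L2_mul.
by congr cmean; apply/funext => x; rewrite mulrCA.
Qed.

Lemma braketBr f g h : L2 f -> L2 g -> L2 h ->
  braket f (fun x => g x - h x) = braket f g - braket f h.
Proof.
move=> hf hg hh; rewrite -[X in _ = _ + X]mulN1r -braketZr // -braketDr //; last exact: L2Z.
by congr braket; apply/funext => x; rewrite mulN1r.
Qed.

Lemma braket_conj f g : L2 f -> L2 g -> braket g f = Num.conj (braket f g).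
Proof.
move=> hf hg; rewrite /braket -cmean_conj; last exact: L2_mul.
by congr cmean; apply/funext => x; rewrite rmorphM /= conjCK mulrC.
Qed.

Lemma braketDl f g h : L2 f -> L2 g -> L2 h ->
  braket (fun x => f x + g x) h = braket f h + braket g h.
Proof.
move=> hf hg hh; rewrite braket_conj //; last exact: L2D.
by rewrite braketDr // rmorphD /= -!braket_conj.
Qed.

Lemma braketZl c f g : L2 f -> L2 g ->
  braket (fun x => c * f x) g = Num.conj c * braket f g.
Proof.
move=> hf hg; rewrite braket_conj //; last exact: L2Z.
by rewrite braketZr // rmorphM /= -!braket_conj.
Qed.

Lemma braketBl f g h : L2 f -> L2 g -> L2 h ->
  braket (fun x => f x - g x) h = braket f h - braket g h.
Proof.
move=> hf hg hh; rewrite braket_conj //; last exact: L2B.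
by rewrite braketBr // rmorphB /= -!braket_conj.
Qed.

Lemma braket_self f : braket f f = (norm2 f)%:C.
Proof.
rewrite /braket /cmean /norm2.
have RE x : complex.Re (Num.conj (f x) * f x) = nc (f x) ^+ 2.
  by rewrite normc_sqr; case: (f x) => u v /=; ring.
have IE x : complex.Im (Num.conj (f x) * f x) = 0.
  by case: (f x) => u v /=; ring.
under [X in mean X +i* _]eq_fun do rewrite RE.
by under [X in _ +i* mean X]eq_fun do rewrite IE; rewrite mean_cst.
Qed.

(** A weighted substitute for the Cauchy-Schwarz inequality: with l = e^-1 and [norm2 f] at most
    e^2, both terms are of order e. Real and imaginary parts are estimated separately, which costs a
    factor 2. *)
Lemma normc_braket_le f g l : 0 < l -> L2 f -> L2 g ->
  nc (braket f g) <= l * norm2 f + l^-1 * norm2 g.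
Proof.
move=> l0 hf hg; have [tR tI] := L2_mul hf hg.
have /L2P[mf tf] := hf; have /L2P[mg tg] := hg.
have ti : tint (fun x => 2^-1 * (l * nc (f x) ^+ 2 + l^-1 * nc (g x) ^+ 2)).
  by apply: tintZ; apply: tintD; apply: tintZ.
have tE : mean (fun x => 2^-1 * (l * nc (f x) ^+ 2 + l^-1 * nc (g x) ^+ 2)) =
   2^-1 * (l * norm2 f + l^-1 * norm2 g).
  by rewrite meanZ ?meanD ?meanZ //; [apply: tintZ..|apply: tintD; apply: tintZ].
have le x : nc (Num.conj (f x) * g x) <= 2^-1 * (l * nc (f x) ^+ 2 + l^-1 * nc (g x) ^+ 2).
  rewrite Normc.normcM (_ : nc (Num.conj (f x)) = nc (f x)).
    by rewrite [leRHS]mulrC; apply: normc_mul_le.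
  by case: (f x) => u v; rewrite /= sqrrN.
apply: le_trans (normc_le_ReIm _) _.
rewrite [leRHS]splitr ![_ / 2]mulrC.
rewrite -tE; apply: lerD; apply: le_trans (norm_mean_le _) _ => //.
  by apply: mean_le => // [|x]; [exact: tint_norm|apply: le_trans (normRe_le _) (le x)].
by apply: mean_le => // [|x]; [exact: tint_norm|apply: le_trans (normIm_le _) (le x)].
Qed.

Lemma braket_ae f g h : L2 f -> L2 g -> L2 h -> torus_eq g h -> braket f g = braket f h.
Proof.
move=> hf hg hh gh; have [R1 I1] := L2_mul hf hg; have [R2 I2] := L2_mul hf hh.
rewrite /braket /cmean; congr (_ +i* _); apply: mean_ae; try exact: tint_measurable.
  move: gh; apply: filterS; first exact: (ae_filter_ringOfSetsType mu).
  by move=> x E Ix; rewrite E.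
move: gh; apply: filterS; first exact: (ae_filter_ringOfSetsType mu).
by move=> x E Ix; rewrite E.
Qed.

Lemma norm2_eq0 f : L2 f -> norm2 f = 0 -> torus_eq f (fun=> 0).
Proof.
move=> hf f0; have /L2P[mf tf] := hf.
have m2 := cmeasurable_normc2 mf.
have /(ae_eq_integral_abs mu (@mtorus R)) : measurable_fun I (EFin \o (fun x => nc (f x) ^+ 2)).
  exact/measurable_EFinP.
case=> + _; have -> : (\int[mu]_(x in I) `|(EFin \o (fun x => (nc (f x) ^+ 2)%R)) x| = 0)%E.
  have -> : (\int[mu]_(x in I) `|(EFin \o (fun x => (nc (f x) ^+ 2)%R)) x| =
      \int[mu]_(x in I) (nc (f x) ^+ 2)%:E)%E.
    by apply: eq_integral => x _ /=; rewrite ger0_norm // exprn_ge0 // normc_ge0.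
  have fn := integrable_fin_num (@mtorus R) tf.
  rewrite -(fineK fn); congr EFin; move/eqP: f0; rewrite /norm2 /mean mulf_eq0.
  by rewrite invr_eq0 gt_eqF ?two_pi_gt0 //= => /eqP.
move=> /(_ erefl); apply: filterS => x E Ix.
have := E Ix => /= -[] /eqP; rewrite sqrf_eq0 => /eqP; exact: Normc.eq0_normc.
Qed.
End L2.

(** * Uniform limits of polynomials on the unit circle *)

Section UniformPolynomials.
Variable R : realType.
Local Notation nc := Normc.normc.
Implicit Types (f g : R -> R[i]) (p : {poly R[i]}).

(** Boundary values of the disc algebra. Unlike the Hardy space, this class is closed under
    products, and its members are bounded, so that integrability is automatic. *)
Definition unifpoly f := forall e : R, 0 < e ->
  exists p : {poly R[i]}, forall x, nc (f x - p.[expi x]) <= e.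

Lemma expi_mulrn (x : R) k : expi x ^+ k = expi (k%:R * x).
Proof.
elim: k => [|k IH]; first by rewrite expr0 mul0r expi0.
by rewrite exprS IH -expiD -natr1 mulrDl mul1r addrC.
Qed.

Lemma normc_ket (h : nat) (x : R) : nc (ket h x) = 1.
Proof. by rewrite /ket expi_mulrn normc_expi. Qed.

Lemma cmeasurable_expi : cmeasurable (fun x : R => expi x).
Proof.
split=> /=; apply: measurable_funTS.
  by apply: continuous_measurable_fun; apply: continuous_cos.
by apply: continuous_measurable_fun; apply: continuous_sin.
Qed.

Lemma cmeasurable_poly p : cmeasurable (fun x => p.[expi x]).
Proof.
elim/poly_ind: p => [|p c IH].
  by under [X in cmeasurable X]eq_fun do rewrite horner0; apply: cmeasurable_cst.
under [X in cmeasurable X]eq_fun do rewrite hornerMXaddC.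
by apply: cmeasurableD; [apply: cmeasurableM => //; exact: cmeasurable_expi|exact: cmeasurable_cst].
Qed.

Lemma poly_circle_bounded p : exists M : R, forall x, nc p.[expi x] <= M.
Proof.
elim/poly_ind: p => [|p c [M IH]].
  by exists 0 => x; rewrite horner0 Normc.normc0.
exists (M + nc c) => x; rewrite hornerMXaddC; apply: le_trans (normc_leD _ _) _.
by rewrite lerD2r Normc.normcM normc_expi mulr1.
Qed.

Lemma unifpoly_poly p : unifpoly (fun x => p.[expi x]).
Proof. by move=> e e0; exists p => x; rewrite subrr Normc.normc0 ltW. Qed.

Lemma unifpoly_ext f g : (forall x, f x = g x) -> unifpoly f -> unifpoly g.
Proof. by move=> fg hf e e0; have [p hp] := hf e e0; exists p => x; rewrite -fg. Qed.

Lemma unifpoly_cst (c : R[i]) : unifpoly (fun=> c).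
Proof. by apply: unifpoly_ext (unifpoly_poly c%:P) => x; rewrite hornerC. Qed.

Lemma unifpoly_ket h : unifpoly (ket h).
Proof. by apply: unifpoly_ext (unifpoly_poly 'X^h) => x; rewrite hornerXn. Qed.

Lemma unifpoly_bounded f : unifpoly f -> exists2 M : R, 0 < M & forall x, nc (f x) <= M.
Proof.
move=> /(_ 1 ltr01)[p fp]; have [M pM] := poly_circle_bounded p.
have M0 : 0 <= M by apply: le_trans (normc_ge0 _) (pM 0).
exists (1 + M); first by rewrite ltr_pwDl.
move=> x; rewrite -[f x](subrK p.[expi x]); apply: le_trans (normc_leD _ _) _.
exact: lerD.
Qed.

Lemma unifpolyD f g : unifpoly f -> unifpoly g -> unifpoly (fun x => f x + g x).
Proof.
move=> hf hg e e0; have e2 : 0 < e / 2 by rewrite divr_gt0.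
have [p fp] := hf _ e2; have [q gq] := hg _ e2.
exists (p + q) => x; rewrite hornerD opprD addrACA; apply: le_trans (normc_leD _ _) _.
by rewrite [leRHS]splitr lerD.
Qed.

Lemma unifpolyM f g : unifpoly f -> unifpoly g -> unifpoly (fun x => f x * g x).
Proof.
move=> hf hg e e0.
have [M M0 fM] := unifpoly_bounded hf; have [N N0 gN] := unifpoly_bounded hg.
have e1 : 0 < e / (2 * M) by rewrite divr_gt0 // mulr_gt0.
have [q gq] := hg _ e1; have [N' qN'] := poly_circle_bounded q.
have N'1 : 0 < `|N'| + 1 by rewrite ltr_wpDl.
have e2 : 0 < e / (2 * (`|N'| + 1)) by rewrite divr_gt0 // mulr_gt0.
have [p fp] := hf _ e2.
exists (p * q) => x; rewrite hornerM.
have -> : f x * g x - p.[expi x] * q.[expi x] =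
   f x * (g x - q.[expi x]) + (f x - p.[expi x]) * q.[expi x] by ring.
apply: le_trans (normc_leD _ _) _; rewrite [leRHS]splitr !Normc.normcM; apply: lerD.
  apply: le_trans (ler_pM (normc_ge0 _) (normc_ge0 _) (fM x) (gq x)) _.
  by rewrite le_eqVlt; apply/orP; left; apply/eqP; field; rewrite gt_eqF.
have qN : nc q.[expi x] <= `|N'| + 1.
  by apply: le_trans (qN' x) _; rewrite (le_trans (ler_norm _)) // lerDl.
apply: le_trans (ler_pM (normc_ge0 _) (normc_ge0 _) (fp x) qN) _.
by rewrite le_eqVlt; apply/orP; left; apply/eqP; field; rewrite gt_eqF.
Qed.

Lemma unifpolyZ c f : unifpoly f -> unifpoly (fun x => c * f x).
Proof. exact/unifpolyM/unifpoly_cst. Qed.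

Lemma unifpolyB f g : unifpoly f -> unifpoly g -> unifpoly (fun x => f x - g x).
Proof.
move=> hf hg; apply: unifpoly_ext (unifpolyD hf (unifpolyZ (-1) hg)) => x.
by rewrite mulN1r.
Qed.

Lemma unifpoly_sum (J : Type) (r : seq J) (P : pred J) (f : J -> R -> R[i]) :
  (forall j, P j -> unifpoly (f j)) -> unifpoly (fun x => \sum_(j <- r | P j) f j x).
Proof.
move=> hf; elim: r => [|j r IH].
  by apply: unifpoly_ext (unifpoly_cst 0) => x; rewrite big_nil.
have [Pj|nPj] := boolP (P j).
  by apply: unifpoly_ext (unifpolyD (hf j Pj) IH) => x; rewrite big_cons Pj.
by apply: unifpoly_ext IH => x; rewrite big_cons (negbTE nPj).
Qed.

(** A pointwise limit of polynomials, one being chosen within 1 / (k + 1) for each k. *)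
Lemma unifpoly_cmeasurable f : unifpoly f -> cmeasurable f.
Proof.
move=> hf; have e0 (k : nat) : 0 < k.+1%:R^-1 :> R by rewrite invr_gt0.
pose p k := projT1 (cid (hf _ (e0 k))).
have pP k x : nc (f x - (p k).[expi x]) <= k.+1%:R^-1 := projT2 (cid (hf _ (e0 k))) x.
have cvg_aux (phi : R[i] -> R) : (forall z w, `|phi z - phi w| <= nc (z - w)) ->
    forall x, phi (p k).[expi x] @[k --> \oo] --> phi (f x).
  move=> phiL x; apply/cvgrPdist_le => e e_gt0.
  have [N _ HN] : \forall k \near \oo, k.+1%:R^-1 <= e.
    by have /cvgrPdist_le /(_ _ e_gt0) := @cvg_harmonic R; apply: filterS => k;
       rewrite sub0r normrN /harmonic ger0_norm ?invr_ge0.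
  exists N => // k /HN ke /=; apply: le_trans (phiL _ _) _.
  exact: le_trans (pP k x) ke.
split.
  apply: (@measurable_fun_cvg _ _ _ _ (fun k x => complex.Re (p k).[expi x])).
    by move=> k; case: (cmeasurable_poly (p k)).
  by move=> x _; apply: (cvg_aux (@complex.Re R)) => z w; rewrite -ReB; exact: normRe_le.
apply: (@measurable_fun_cvg _ _ _ _ (fun k x => complex.Im (p k).[expi x])).
  by move=> k; case: (cmeasurable_poly (p k)).
move=> x _; apply: (cvg_aux (@complex.Im R)) => z w.
have -> : complex.Im z - complex.Im w = complex.Im (z - w) by case: z; case: w.
exact: normIm_le.
Qed.

Lemma unifpoly_L2 f : unifpoly f -> L2 f.
Proof.
move=> hf; have [M _ fM] := unifpoly_bounded hf.
exact: L2_bounded (unifpoly_cmeasurable hf) fM.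
Qed.

Lemma norm2_le f (M : R) : L2 f -> (forall x, nc (f x) <= M) -> norm2 f <= M ^+ 2.
Proof.
move=> /L2P[_ tf] fM; rewrite -[leRHS]mean_cst; apply: mean_le => // [|x].
  exact: tint_cst.
by rewrite ler_pXn2r ?nnegrE ?normc_ge0 // (le_trans _ (fM x)) ?normc_ge0.
Qed.

Lemma unifpoly_hardy f : unifpoly f -> hardy f.
Proof.
move=> hf; split=> [|e e0]; first exact: unifpoly_L2.
(* [hardy] measures the square of the norm: an error M with M <= 1 and M <= e / 2 has M^2 <= e /
   2. *)
have e'0 : 0 < Num.min 1 (e / 2) by rewrite lt_min ltr01 divr_gt0.
have [p fp] := hf _ e'0; exists p.
have hfp : L2 (fun x => f x - p.[expi x]).
  exact: unifpoly_L2 (unifpolyB hf (unifpoly_poly p)).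
rewrite sqnormE // lte_fin; apply: le_lt_trans (norm2_le hfp fp) _.
apply: (@le_lt_trans _ _ (1 * (e / 2))); last by rewrite mul1r; lra.
by rewrite expr2 ler_pM ?(ltW e'0) // ge_min lexx ?orbT.
Qed.

Lemma normc_cmean_le f (M : R) : cint f -> (forall x, nc (f x) <= M) -> nc (cmean f) <= 2 * M.
Proof.
move=> [fR fI] fM; apply: le_trans (normc_le_ReIm _) _; rewrite mulrDl mul1r.
apply: lerD; apply: le_trans (norm_mean_le _) _ => //=; rewrite -[leRHS]mean_cst.
  apply: mean_le => [||x]; [exact: tint_norm|exact: tint_cst|].
  exact: le_trans (normRe_le _) (fM x).
apply: mean_le => [||x]; [exact: tint_norm|exact: tint_cst|].
exact: le_trans (normIm_le _) (fM x).
Qed.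

Lemma unifpoly_cint f : unifpoly f -> cint f.
Proof.
move=> hf; have := L2_mul (L2_cst 1) (unifpoly_L2 hf).
by under [X in cint X]eq_fun do rewrite conjC1 mul1r.
Qed.

Lemma mean_derive_periodic (F G : R -> R) : (forall x : R, is_derive x 1 F (G x)) ->
  continuous G -> F (2 * pi) = F 0 -> mean G = 0.
Proof.
move=> FG cG F0; rewrite /mean /Rintegral /torus (@continuous_FTC2 _ G F).
- by rewrite F0 -EFinB subrr mulr0.
- exact: two_pi_gt0.
- exact: continuous_subspaceT.
- have cF : continuous F.
    by move=> x; apply: differentiable_continuous; apply/derivable1_diffP; case: (FG x).
  split.
  + by move=> x _; case: (FG x).
  + exact/cvg_at_right_filter/cF.
  + exact/cvg_at_left_filter/cF.
- by move=> x _; rewrite derive1E; case: (FG x).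
Qed.

Lemma cmean_ket k : (0 < k)%N -> cmean (ket k) = 0 :> R[i].
Proof.
move=> k0; have k0' : k%:R != 0 :> R by rewrite pnatr_eq0 -lt0n.
have lin (x : R) : is_derive x 1 (fun y : R => k%:R * y) k%:R.
  apply: (is_derive_eq (is_deriveZ (k%:R : R) (is_derive_id x 1))).
  by rewrite /GRing.scale /= mulr1.
have clin : continuous (fun y : R => k%:R * y).
  by move=> x; apply: cvgM; [exact: cvg_cst|exact: cvg_id].
have per : expi (k%:R * (2 * pi) : R) = 1.
  by rewrite -expi_mulrn /expi mulr_natl cos2pi sin2pi expr1n.
have perc : cos (k%:R * (2 * pi) : R) = 1 by have := congr1 (@complex.Re R) per.
have pers : sin (k%:R * (2 * pi) : R) = 0 by have := congr1 (@complex.Im R) per.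
rewrite /cmean; apply/eqP; rewrite eq_complex /=; apply/andP; split; apply/eqP.
  under eq_fun do rewrite /ket expi_mulrn /=.
  apply: (@mean_derive_periodic (fun y => k%:R^-1 * sin (k%:R * y))).
  - move=> x; apply: (is_derive_eq (is_deriveZ (k%:R^-1 : R)
      (is_derive1_comp (g := fun y : R => k%:R * y) (is_derive_sin _) (lin x)))).
    by rewrite /GRing.scale /= mulrCA mulVf // mulr1.
  - by move=> x; apply: continuous_comp; [exact: clin|exact: continuous_cos].
  - by rewrite pers [k%:R * 0]mulr0 sin0.
under eq_fun do rewrite /ket expi_mulrn /=.
apply: (@mean_derive_periodic (fun y => - k%:R^-1 * cos (k%:R * y))).
- move=> x; apply: (is_derive_eq (is_deriveZ (- k%:R^-1 : R)
    (is_derive1_comp (g := fun y : R => k%:R * y) (is_derive_cos _) (lin x)))).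
  by rewrite /GRing.scale /=; field.
- by move=> x; apply: continuous_comp; [exact: clin|exact: continuous_sin].
- by rewrite perc [k%:R * 0]mulr0 cos0.
Qed.

Lemma cmean_poly_ket p k : (0 < k)%N -> cmean (fun x => p.[expi x] * ket k x) = 0.
Proof.
(* The exponent k is generalized because a factor 'X turns [ket k] into [ket k.+1]. *)
elim/poly_ind: p k => [|p c IH] k k0.
  by rewrite -[RHS](cmean0 R); congr cmean; apply/funext => x; rewrite horner0 mul0r.
have U (q : {poly R[i]}) l : cint (fun x : R => q.[expi x] * ket l x).
  exact: unifpoly_cint (unifpolyM (unifpoly_poly q) (unifpoly_ket l)).
have -> : (fun x : R => (p * 'X + c%:P).[expi x] * ket k x) =
    (fun x => p.[expi x] * ket k.+1 x + c * ket k x).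
  by apply/funext => x; rewrite hornerMXaddC mulrDl -mulrA /ket exprS.
have ic := unifpoly_cint (unifpolyZ c (unifpoly_ket k)).
rewrite cmeanD // IH // add0r cmeanZ ?cmean_ket ?mulr0 //.
exact: unifpoly_cint (unifpoly_ket k).
Qed.

Lemma normc_arbitrarily_small (z : R[i]) (M : R) :
  (forall e : R, 0 < e -> nc z <= M * e) -> z = 0.
Proof.
move=> zM; apply/eqP; rewrite -normc_eq0 eq_le normc_ge0 andbT.
apply/ler_addgt0Pl => e e0; rewrite addr0.
have M1 : 0 < `|M| + 1 by rewrite ltr_wpDl.
apply: le_trans (zM _ (divr_gt0 e0 M1)) _.
rewrite mulrA ler_pdivrMr // mulrC ler_wpM2l ?(ltW e0) //.
by rewrite (le_trans (ler_norm _)) // lerDl.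
Qed.

Lemma cmean_unifpoly_ket g k : unifpoly g -> (0 < k)%N ->
  cmean (fun x => g x * ket k x) = 0.
Proof.
move=> hg k0; apply: (@normc_arbitrarily_small _ 2) => e e0; have [p gp] := hg e e0.
have hU := unifpolyM (unifpolyB hg (unifpoly_poly p)) (unifpoly_ket k).
have -> : cmean (fun x => g x * ket k x) = cmean (fun x => (g x - p.[expi x]) * ket k x).
  rewrite -[LHS]subr0 -(cmean_poly_ket p k0) -[X in _ = X]addr0.
  have c1 := unifpoly_cint (unifpolyM hg (unifpoly_ket k)).
  have c2 := unifpoly_cint (unifpolyM (unifpoly_poly p) (unifpoly_ket k)).
  rewrite addr0 -[X in _ + X]mulN1r -cmeanZ // -cmeanD //; last exact: cintZ.
  by congr cmean; apply/funext => x; ring.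
apply: normc_cmean_le; first exact: unifpoly_cint.
by move=> x; rewrite Normc.normcM normc_ket mulr1.
Qed.

(** The conjugate of the integrand is analytic and divisible by w, hence of mean zero. *)
Lemma braket_poly_antianalytic p g : unifpoly g ->
  braket (fun x => p.[expi x]) (fun x => Num.conj (g x * ket 1 x)) = 0.
Proof.
move=> hg; rewrite /braket.
have hU := unifpolyM (unifpolyM (unifpoly_poly p) hg) (unifpoly_ket 1).
have -> : (fun x => Num.conj p.[expi x] * Num.conj (g x * ket 1 x)) =
    (fun x => Num.conj (p.[expi x] * g x * ket 1 x)).
  by apply/funext => x; rewrite -rmorphM mulrA.
rewrite cmean_conj; last exact: unifpoly_cint.
by rewrite cmean_unifpoly_ket ?rmorph0 //; exact: unifpolyM (unifpoly_poly p) hg.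
Qed.

(** Polynomials are dense in the Hardy space; the weight e^-1 balances the two terms of
    [normc_braket_le]. *)
Lemma braket_hardy_eq0 q b : hardy q -> L2 b ->
  (forall p, braket (fun x => p.[expi x]) b = 0) -> braket q b = 0.
Proof.
move=> [q2 qp] b2 pb; apply: (@normc_arbitrarily_small _ (1 + norm2 b)) => e e0.
have e30 : 0 < e ^+ 2 by rewrite exprn_gt0.
have [p] := qp _ e30; have hp := unifpoly_L2 (unifpoly_poly p).
rewrite sqnormE ?lte_fin; last exact: L2B.
move=> /ltW qpe; rewrite -[braket q b]subr0 -(pb p) -braketBl //.
have el : 0 < e^-1 by rewrite invr_gt0.
apply: le_trans (normc_braket_le el (L2B q2 hp) b2) _.
rewrite invrK mulrDl mul1r; apply: lerD; last by rewrite mulrC.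
by rewrite mulrC ler_pdivrMr // -expr2.
Qed.

Lemma braket_hardy_antianalytic q g : hardy q -> unifpoly g ->
  braket q (fun x => Num.conj (g x * ket 1 x)) = 0.
Proof.
move=> hq hg; apply: braket_hardy_eq0 => // [|p]; last exact: braket_poly_antianalytic.
have hU := unifpolyM hg (unifpoly_ket 1); have [M _ bM] := unifpoly_bounded hU.
apply: (@L2_bounded _ _ M); first exact: cmeasurable_conj (unifpoly_cmeasurable hU).
by move=> x; have := bM x; case: (g x * ket 1 x) => u v; rewrite /= sqrrN.
Qed.

Lemma hardyB f g : hardy f -> hardy g -> hardy (fun x => f x - g x).
Proof.
move=> [f2 fp] [g2 gp]; split=> [|e e0]; first exact: L2B.
have e40 : 0 < e / 4 by rewrite divr_gt0.
have [p] := fp _ e40; have [q] := gp _ e40.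
have hp := unifpoly_L2 (unifpoly_poly p); have hq := unifpoly_L2 (unifpoly_poly q).
rewrite !sqnormE ?lte_fin; [|exact: L2B..] => qe pe.
exists (p - q); have h := L2B (L2B f2 hp) (L2B g2 hq).
have E : (fun x => f x - g x - (p - q).[expi x]) =
    (fun x => (f x - p.[expi x]) - (g x - q.[expi x])).
  by apply/funext => x; rewrite hornerD hornerN; ring.
rewrite E sqnormE // lte_fin.
have /L2P[mF tF] := L2B f2 hp; have /L2P[mG tG] := L2B g2 hq; have /L2P[_ tH] := h.
apply: (@le_lt_trans _ _ (2 * norm2 (fun x => f x - p.[expi x]) +
    2 * norm2 (fun x => g x - q.[expi x]))); last by lra.
rewrite /norm2 -!meanZ // -meanD; [|exact: tintZ..].
apply: mean_le => // [|x]; first by apply: tintD; apply: tintZ.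
move: (f x - _) (g x - _) => z w.
have := normc_leD z (- w); rewrite normc_opp; have := normc_ge0 (z - w).
have := sqr_ge0 (nc z - nc w); nra.
Qed.

Lemma braket_ket h l : braket (ket h) (ket l) = (h == l)%:R :> R[i].
Proof.
wlog hl : h l / (h <= l)%N.
  move=> H; have [/H //|/ltnW lh] := leqP h l.
  rewrite braket_conj; try exact: unifpoly_L2 (unifpoly_ket _).
  by rewrite H // eq_sym rmorph_nat.
have -> : braket (ket h) (ket l) = cmean (ket (l - h) : R -> R[i]).
  rewrite /braket; congr cmean; apply/funext => x; rewrite /ket !expi_mulrn.
  rewrite expi_conj -expiD natrB //; congr expi; ring.
rewrite eqn_leq hl /= -subn_eq0; have [->|lh] := posnP (l - h)%N.
  by rewrite -[RHS](cmean_cst (1 : R[i])); congr cmean; apply/funext => x; rewrite /ket expr0.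
by rewrite cmean_ket // gtn_eqF.
Qed.

Lemma norm2D_orthogonal f g : L2 f -> L2 g -> braket g f = 0 ->
  norm2 (fun x => f x + g x) = norm2 f + norm2 g.
Proof.
move=> f2 g2 gf; apply: complexI; rewrite -braket_self rmorphD /= -!braket_self.
have fg2 := L2D f2 g2; rewrite (braketDl f2 g2 fg2) (braketDr f2 f2 g2) (braketDr g2 f2 g2).
by rewrite gf (braket_conj g2 f2) gf rmorph0 addr0 add0r.
Qed.

(* The Fourier partial sum of f is at least as close to f as any polynomial of the
   same degree. *)
Lemma braket_diagonal_real f d : D_graph f d -> complex.Im (braket f d) = 0.
Proof.
move=> [hf hd Dfd]; have [f2 fp] := hf; have [d2 _] := hd.
suff Im_le e : 0 < e -> `|complex.Im (braket f d)| <= (1 + norm2 d) * e.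
  have := @normc_arbitrarily_small (complex.Im (braket f d))%:C (1 + norm2 d).
  by rewrite normc_real => /(_ Im_le) [].
move=> e0; have e20 : 0 < e ^+ 2 by rewrite exprn_gt0.
have [p] := fp _ e20; have hp := unifpoly_L2 (unifpoly_poly p).
rewrite sqnormE ?lte_fin; last exact: L2B.
move=> /ltW pe.
(* [D_graph] describes d by its Fourier coefficients, so <f|d> is approached through partial sums S
   of f, for which <S|d> is a sum of terms h |<h|f>|^2 and hence real. *)
pose S := \poly_(h < size p) braket (ket h) f.
have hS := unifpoly_L2 (unifpoly_poly S).
have hk h : L2 (ket h : R -> R[i]) by exact: unifpoly_L2 (unifpoly_ket h).
have polyE (q : {poly R[i]}) : (size q <= size p)%N ->
    (fun x : R => q.[expi x]) = (fun x => \sum_(h < size p) q`_h * ket h x).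
  by move=> sq; apply/funext => x; rewrite (horner_coef_wide _ sq).
have hsum m (c : 'I_m -> R[i]) : L2 (fun x : R => \sum_(h < m) c h * ket h x).
  apply: unifpoly_L2; apply: unifpoly_sum => h _; exact: unifpolyZ (unifpoly_ket h).
have brsum m (c : 'I_m -> R[i]) g : L2 g ->
    braket (fun x => \sum_(h < m) c h * ket h x) g =
    \sum_(h < m) Num.conj (c h) * braket (ket h) g.
  move=> g2; elim: m c => [|m IH] c.
    rewrite big_ord0 /braket -[RHS](cmean0 R); congr cmean.
    by apply/funext => x; rewrite big_ord0 rmorph0 mul0r.
  have -> : (fun x : R => \sum_(h < m.+1) c h * ket h x) =
     (fun x => \sum_(h < m) c (widen_ord (leqnSn m) h) * ket h x + c ord_max * ket m x).
    by apply/funext => x; rewrite big_ord_recr.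
  rewrite (braketDl (hsum m (fun h => c (widen_ord (leqnSn m) h))) (L2Z (c ord_max) (hk m)) g2).
  by rewrite IH braketZl // big_ord_recr.
have sS : (size S <= size p)%N := size_poly _ _.
have Sd : complex.Im (braket (fun x => S.[expi x]) d) = 0.
  rewrite (polyE _ sS) brsum // raddf_sum big1 //= => h _.
  rewrite Dfd coef_poly ltn_ord mulrCA -[h%:R]/(h%:R) -(rmorph_nat (real_complex R)).
  by case: (braket (ket h) f) => u v /=; ring.
have kS h : (h < size p)%N -> braket (ket h) (fun x => S.[expi x]) = braket (ket h) f.
  move=> hsp; rewrite (polyE _ sS) braket_conj; [|exact: hsum|by []].
  rewrite brsum // rmorph_sum (bigD1 (Ordinal hsp)) //= big1 ?addr0 => [|l lh].
    by rewrite braket_ket eqxx mulr1 conjCK coef_poly hsp.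
  rewrite braket_ket (_ : (l == h :> nat) = false) ?mulr0 ?rmorph0 //.
  by apply/negbTE; apply: contra lh => /eqP lh; apply/eqP/val_inj.
have fS2 := L2B f2 hS; have Sp2 := L2B hS hp.
have orth : braket (fun x => S.[expi x] - p.[expi x]) (fun x => f x - S.[expi x]) = 0.
  have -> : (fun x : R => S.[expi x] - p.[expi x]) = (fun x => (S - p).[expi x]).
    by apply/funext => x; rewrite hornerD hornerN.
  have sSp : (size (S - p)%R <= size p)%N.
    by rewrite (leq_trans (size_polyD _ _)) // size_polyN geq_max sS leqnn.
  rewrite (polyE _ sSp) brsum // big1 // => h _.
  by rewrite braketBr // kS // subrr mulr0.
have pythagoras : norm2 (fun x => f x - S.[expi x]) <= norm2 (fun x => f x - p.[expi x]).
  have E : (fun x => f x - p.[expi x]) =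
      (fun x => (f x - S.[expi x]) + (S.[expi x] - p.[expi x])).
    by apply/funext => x; ring.
  by rewrite E (norm2D_orthogonal fS2 Sp2 orth) lerDl norm2_ge0.
have -> : complex.Im (braket f d) = complex.Im (braket (fun x => f x - S.[expi x]) d).
  rewrite braketBl // (_ : forall z w : R[i], complex.Im w = 0 -> complex.Im (z - w) = complex.Im z) //.
  by move=> [z1 z2] [w1 w2] /= ->; rewrite subr0.
apply: le_trans (normIm_le _) _.
have el : 0 < e^-1 by rewrite invr_gt0.
apply: le_trans (normc_braket_le el fS2 d2) _.
rewrite invrK mulrDl mul1r; apply: lerD; last by rewrite mulrC.
by rewrite mulrC ler_pdivrMr // -expr2 (le_trans pythagoras).
Qed.
End UniformPolynomials.

(** * The resolvent of the Lax operator *)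

Section LaxGeneral.
Variables (R : realType) (eps : R) (v : R -> R).
Local Notation nc := Normc.normc.
Local Notation mu := (@lebesgue_measure R).
Hypothesis vL2 : forall f : R -> R[i], L2 f -> L2 (fun x => (v x)%:C * f x).
Implicit Types (f g d e p q r s l : R -> R[i]) (u z : R[i]).

Lemma D_graphB f g d e : D_graph f d -> D_graph g e ->
  D_graph (fun x => f x - g x) (fun x => d x - e x).
Proof.
move=> [hf hd fd] [hg he ge]; split; [exact: hardyB|exact: hardyB|] => h.
have [f2 _] := hf; have [d2 _] := hd; have [g2 _] := hg; have [e2 _] := he.
have k2 := unifpoly_L2 (@unifpoly_ket R h).
by rewrite !braketBr // fd ge mulrBr.
Qed.

Lemma hardy_projB f g p q : hardy_proj f p -> hardy_proj g q ->
  hardy_proj (fun x => f x - g x) (fun x => p x - q x).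
Proof.
move=> [f2 hp fp] [g2 hq gq]; split; [exact: L2B|exact: hardyB|] => r hr.
have [r2 _] := hr; have [p2 _] := hp; have [q2 _] := hq.
have -> : (fun x => f x - g x - (p x - q x)) = (fun x => (f x - p x) - (g x - q x)).
  by apply/funext => x; ring.
by rewrite braketBr ?fp ?gq ?subrr //; exact: L2B.
Qed.

Lemma torus_eq_sub (f g f' g' : R -> R[i]) : torus_eq f g -> torus_eq f' g' ->
  torus_eq (fun x => f x - f' x) (fun x => g x - g' x).
Proof.
move=> fg fg'; rewrite /torus_eq.
have FF := ae_filter_ringOfSetsType mu.
have := @filterI _ _ FF _ _ fg fg'; apply: (@filterS _ _ FF).
by move=> x [E E'] Ix; rewrite E // E'.
Qed.

Lemma shifted_laxB u f g r s : shifted_lax eps v u f r -> shifted_lax eps v u g s ->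
  shifted_lax eps v u (fun x => f x - g x) (fun x => r x - s x).
Proof.
move=> [l [hl [d [p [fd fp lE]]]] rE] [m [hm [e [q [ge gq mE]]]] sE].
exists (fun x => l x - m x).
  split; first exact: hardyB.
  exists (fun x => d x - e x), (fun x => p x - q x); split; first exact: D_graphB.
    have -> : (fun x => (v x)%:C * (f x - g x)) = (fun x => (v x)%:C * f x - (v x)%:C * g x).
      by apply/funext => x; rewrite mulrBr.
    exact: hardy_projB.
  have := torus_eq_sub lE mE; congr (torus_eq _ _); apply/funext => x; ring.
have := torus_eq_sub rE sE; congr (torus_eq _ _); apply/funext => x; ring.
Qed.

Lemma torus_eq_sub0 (f g : R -> R[i]) : torus_eq (fun x => f x - g x) (fun=> 0) -> torus_eq f g.
Proof.
apply: filterS; first exact: (ae_filter_ringOfSetsType mu).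
by move=> x E Ix; apply/subr0_eq/E.
Qed.

Lemma shifted_lax_hardy u f r : shifted_lax eps v u f r -> hardy f.
Proof. by move=> [l [hl [d [p [[hf _ _] _ _]]]] _]. Qed.

(** The injectivity contained in [PhiBA] kills the difference of two preimages, so the conclusion
    holds at real u as well. *)
Lemma PhiBA_unique u z f : PhiBA eps v u z -> shifted_lax eps v u f (ket 0) ->
  z = braket (ket 0) f.
Proof.
move=> [inj [g gS ->]] fS.
have [f2 _] := shifted_lax_hardy fS; have [g2 _] := shifted_lax_hardy gS.
apply: braket_ae => //; first exact: unifpoly_L2 (unifpoly_ket 0).
apply: torus_eq_sub0; apply: inj; have := shifted_laxB gS fS.
by congr (shifted_lax _ _ _ _ _); apply/funext => x; rewrite subrr.
Qed.

(** Symmetry of L: u <f|f> = <f|L f>, and the right-hand side is real since D is diagonal with real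
    entries and v is real. *)
Lemma lax_injective u f : complex.Im u != 0 ->
  shifted_lax eps v u f (fun=> 0) -> torus_eq f (fun=> 0).
Proof.
move=> u0 [l [hl [d [p [Dfd [vf2 hp fp] lE]]]] zE].
have [hf hd _] := Dfd; have [f2 _] := hf; have [d2 _] := hd.
have [p2 _] := hp; have [l2 _] := hl.
apply: norm2_eq0 => //.
have uf2 := L2Z u f2.
have E1 : u * braket f f = braket f l.
  apply/subr0_eq; rewrite -braketZr // -braketBr //.
  rewrite -(braket_ae f2 (L2_cst 0) (L2B uf2 l2) zE).
  have -> : (fun=> 0 : R[i]) = (fun x : R => 0 * (0 : R[i])) by apply/funext => x; rewrite mul0r.
  by rewrite braketZr ?mul0r //; exact: L2_cst.
have ed2 := L2Z (- eps%:C) d2.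
have E2 : braket f l = - eps%:C * braket f d + braket f (fun x => (v x)%:C * f x).
  rewrite (braket_ae f2 l2 (L2D ed2 p2) lE) braketDr // braketZr //; congr (_ + _).
  by apply/esym/subr0_eq; rewrite -braketBr ?fp.
have Imv : complex.Im (braket f (fun x => (v x)%:C * f x)) = 0.
  rewrite /braket /cmean /=.
  have -> : (fun x => complex.Im (Num.conj (f x) * ((v x)%:C * f x))) = (fun=> 0 : R).
    by apply/funext => x; case: (f x) => f1 f2' /=; ring.
  exact: mean_cst.
have := congr1 (@complex.Im R) E1; rewrite E2 cImD Imv addr0 braket_self.
have := braket_diagonal_real Dfd.
move=> dI; rewrite !cImM dI /= !(mulr0, mul0r, oppr0, addr0, add0r) => /eqP.
by rewrite mulf_eq0 (negbTE u0) /= => /eqP.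
Qed.
End LaxGeneral.

Lemma unifpoly_lim (R : realType) (f : R -> R[i]) :
  (forall e : R, 0 < e -> exists2 g, unifpoly g &
     forall x, Normc.normc (f x - g x) <= e) -> unifpoly f.
Proof.
move=> H e e0; have e2 : 0 < e / 2 by rewrite divr_gt0.
have [g hg fg] := H _ e2; have [p gp] := hg _ e2; exists p => x.
rewrite -(subrKA (g x)); apply: le_trans (normc_leD _ _) _.
by rewrite [leRHS]splitr lerD.
Qed.

(** Multiplication by w^k shifts Fourier coefficients, and those of negative index vanish for
    analytic g. *)
Lemma braket_ket_shift (R : realType) (g : R -> R[i]) (h k : nat) : unifpoly g ->
  braket (ket h) (fun x => ket k x * g x) =
  if (k <= h)%N then braket (ket (h - k)) g else 0.
Proof.
move=> hg; rewrite /braket.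
case: leqP => [kh|hk].
  congr cmean; apply/funext => x; rewrite mulrA; congr (_ * _).
  by rewrite /ket !expi_mulrn !expi_conj -expiD natrB //; congr expi; ring.
have kh0 : (0 < k - h)%N by rewrite subn_gt0.
rewrite -(cmean_unifpoly_ket hg kh0); congr cmean; apply/funext => x.
rewrite mulrA mulrC; congr (_ * _).
by rewrite /ket !expi_mulrn expi_conj -expiD natrB ?(ltnW hk) //; congr expi; ring.
Qed.

Lemma braket_sumr (R : realType) n (f : R -> R[i]) (F : 'I_n -> R -> R[i]) :
  L2 f -> (forall l, L2 (F l)) ->
  braket f (fun x => \sum_l F l x) = \sum_l braket f (F l).
Proof.
move=> f2; elim: n F => [|n IH] F F2.
  rewrite big_ord0 /braket -[RHS](cmean0 R); congr cmean.
  by apply/funext => x; rewrite big_ord0 mulr0.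
have S2 : L2 (fun x => \sum_(l < n) F (widen_ord (leqnSn n) l) x).
  elim: n F F2 {IH} => [|n IH] F F2.
    by have := L2_cst (0 : R[i]); congr L2; apply/funext => x; rewrite big_ord0.
  have := L2D (IH _ (fun l => F2 (widen_ord (leqnSn n.+1) l))) (F2 (widen_ord (leqnSn n.+1) ord_max)).
  by congr L2; apply/funext => x; rewrite [RHS]big_ord_recr.
rewrite big_ord_recr /= -IH // -braketDr //; congr braket.
by apply/funext => x; rewrite big_ord_recr.
Qed.

(** D annihilates constants: their only coefficient has index 0 and is multiplied by 0. *)
Lemma braket_ket_cst (R : realType) (c : R[i]) h :
  h%:R * braket (ket h) (fun=> c) = 0 :> R[i].
Proof.
have -> : (fun=> c) = (fun x : R => c * ket 0 x) by apply/funext => x; rewrite /ket expr0 mulr1.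
rewrite braketZr; last 2 first.
- exact/unifpoly_L2/unifpoly_ket.
- exact/unifpoly_L2/unifpoly_ket.
by rewrite braket_ket; case: h => [|h]; rewrite ?mul0r // mulr0 mulr0.
Qed.

(** * Fourier coefficients of the matrix X *)

Section Solution.
Variables (R : realType) (n : nat) (su : 'I_n.+1 -> R) (sd chi : 'I_n -> R) (eps t : R).
Hypothesis s_ordered : forall i : 'I_n, su_below su i < sd i /\ sd i < su_above su i.
Hypothesis eps_gt0 : 0 < eps.
Variable kn : 'I_n -> nat.
Hypothesis kn_gt0 : forall i, (0 < kn i)%N.
Hypothesis knE : forall i, (su_above su i - sd i) / eps = (kn i)%:R.
Local Notation a := (su_above su).
Local Notation b := sd.
Local Notation s := (su ord_max).
Local Notation X := (Xmx su sd eps chi t).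
Local Notation Y := (Ymx su sd eps chi t).
Local Notation nc := Normc.normc.

(** The diagonal entry of W without its factor w^(kn i). *)
Definition cw i : R[i] := (Num.sqrt (qcoef su sd i))%:C *
  expi (- (kn i)%:R * (chi i + 2^-1 * (b i + a i) * t)).

Lemma Ymx_ket x i j : Y x i j = cw i * Omx su sd i j * ket (kn i) x.
Proof.
rewrite /Ymx mul_diag_mx mxE [Wrow _ _ _ _ _ _ _ _]mxE /phase knE.
have -> : (kn i)%:R * (x - chi i - 2^-1 * (b i + a i) * t) =
  (kn i)%:R * x + (- (kn i)%:R * (chi i + 2^-1 * (b i + a i) * t)) by ring.
by rewrite expiD /cw /ket expi_mulrn; ring.
Qed.

Lemma Ymx_unifpoly i j : unifpoly (fun x => Y x i j).
Proof.
apply: unifpoly_ext (unifpolyZ (cw i * Omx su sd i j) (unifpoly_ket (kn i))) => x.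
by rewrite Ymx_ket.
Qed.

Lemma Xmx_unifpoly i j : unifpoly (fun x => X x i j).
Proof.
apply: unifpoly_lim => e e0; have [m Xm] := Xmx_approx eps s_ordered e0.
have pow k i' j' : unifpoly (fun x => (Y x ^+ k) i' j').
  elim: k i' j' => [|k IH] i' j'.
    by apply: unifpoly_ext (unifpoly_cst (1%:M i' j')) => x; rewrite expr0.
  have := @unifpoly_sum R 'I_n (index_enum _) xpredT (fun l x => Y x i' l * (Y x ^+ k) l j')
    (fun l _ => unifpolyM (Ymx_unifpoly i' l) (IH l j')).
  by apply: unifpoly_ext => x; rewrite exprS -mulmxE mxE.
exists (fun x => (\sum_(k < m.+2) Y x ^+ k) i j).
  have := @unifpoly_sum R 'I_m.+2 (index_enum _) xpredT (fun k x => (Y x ^+ k) i j)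
    (fun k _ => pow k i j).
  by apply: unifpoly_ext => x; rewrite summxE.
by move=> x; have := Xm chi t x i j; rewrite !mxE.
Qed.

Lemma XmxE x : X x = 1%:M + Y x *m X x.
Proof.
have := mulmxV (Xmx_unit s_ordered eps chi t x); rewrite -/(X x) mulmxBl mul1mx => <-.
by rewrite subrK.
Qed.

(** The quotient of X - 1 = Y X by w; the predecessor is a true subtraction because all wave numbers
    are positive. *)
Definition Xred i j x : R[i] :=
  \sum_l cw i * Omx su sd i l * ket (kn i).-1 x * X x l j.

Lemma Xred_unifpoly i j : unifpoly (Xred i j).
Proof.
apply: unifpoly_sum => l _; apply: unifpolyM (Xmx_unifpoly l j).
exact: unifpolyZ (unifpoly_ket _).
Qed.

Lemma Xmx_sub1 x i j : (X x - 1%:M) i j = Xred i j x * ket 1 x.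
Proof.
rewrite {1}XmxE addrC addKr mxE /Xred mulr_suml; apply: eq_bigr => l _.
rewrite Ymx_ket -[in LHS](prednK (kn_gt0 i)) /ket exprS; ring.
Qed.

Definition Kn : 'M[R[i]]_n := diag_mx (\row_i (kn i)%:R).

Lemma epsKn : eps%:C%:M *m Kn = Amx su - Bmx sd.
Proof.
rewrite mul_scalar_mx; apply/matrixP => i j; rewrite !mxE; case: eqVneq => _; last first.
  by rewrite !mulr0n mulr0 subr0.
rewrite !mulr1n -rmorphB /= -(rmorph_nat (real_complex R)) -rmorphM /= -knE mulrC divfK //.
by rewrite gt_eqF.
Qed.

(* Zmx = -i dX/dx, because -i dY/dx = Kn Y. *)
Definition Zmx x := X x *m Kn *m (X x - 1%:M).

Lemma Zmx_unifpoly i j : unifpoly (fun x => Zmx x i j).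
Proof.
have := @unifpoly_sum R 'I_n (index_enum _) xpredT
  (fun l x => (X x i l * (kn l)%:R) * (Xred l j x * ket 1 x))
  (fun l _ => unifpolyM (unifpolyM (Xmx_unifpoly i l) (unifpoly_cst _))
     (unifpolyM (Xred_unifpoly l j) (unifpoly_ket 1))).
apply: unifpoly_ext => x; rewrite [RHS]mxE; apply: eq_bigr => l _.
rewrite Xmx_sub1; congr (_ * _); rewrite mul_mx_diag mxE mxE.
by [].
Qed.

(** The relation that differentiating X = 1 + Y X would give, obtained by algebra alone. *)
Lemma ZmxE x : Zmx x = Kn *m Y x *m X x + Y x *m Zmx x.
Proof.
have aux (X0 Y0 K0 : 'M[R[i]]_n) : X0 = 1%:M + Y0 *m X0 ->
    X0 *m K0 *m (X0 - 1%:M) = K0 *m Y0 *m X0 + Y0 *m (X0 *m K0 *m (X0 - 1%:M)).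
  move=> e; have -> : X0 - 1%:M = Y0 *m X0 by rewrite {1}e addrC addKr.
  by rewrite {1}e !mulmxDl mul1mx !mulmxA.
exact/aux/XmxE.
Qed.

(** Compare coefficients in X = 1 + Y X and Z = K Y X + Y Z. Row i of Y shifts indices by k = kn i
    >= 1, so index h is reduced to h - k, where induction gives k c + (h - k) c = h c for each
    coefficient c of X. *)
Lemma derivation_Xmx i j h :
  braket (ket h) (fun x => Zmx x i j) = h%:R * braket (ket h) (fun x => X x i j).
Proof.
elim/ltn_ind: h i j => h IH i j.
have k2 := unifpoly_L2 (@unifpoly_ket R h).
pose T l x := cw i * Omx su sd i l * (ket (kn i) x * X x l j).
pose T' l x := cw i * Omx su sd i l * (ket (kn i) x * Zmx x l j).
have TL l : L2 (T l).
  by apply/unifpoly_L2/unifpolyZ/unifpolyM; [exact: unifpoly_ket|exact: Xmx_unifpoly].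
have TL' l : L2 (T' l).
  by apply/unifpoly_L2/unifpolyZ/unifpolyM; [exact: unifpoly_ket|exact: Zmx_unifpoly].
have EX : (fun x => X x i j) = (fun x => (1%:M : 'M[R[i]]_n) i j + \sum_l T l x).
  apply/funext => x; rewrite {1}XmxE mxE; congr (_ + _); rewrite mxE.
  by apply: eq_bigr => l _; rewrite Ymx_ket /T; ring.
have EZ : (fun x => Zmx x i j) = (fun x => \sum_l ((kn i)%:R * T l x + T' l x)).
  apply/funext => x; rewrite ZmxE mxE -mulmxA {1}/Kn mul_diag_mx mxE [X in X * _]mxE.
  rewrite [(Y x *m X x) i j]mxE [(Y x *m Zmx x) i j]mxE mulr_sumr -big_split.
  apply: eq_bigr => l _ /=; rewrite Ymx_ket /T /T'; ring.
have T2 l : L2 (fun x => (kn i)%:R * T l x + T' l x) by apply: L2D => //; exact: L2Z.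
have c2 : L2 (fun _ : R => (1%:M : 'M[R[i]]_n) i j) by exact: L2_cst.
rewrite EX EZ (braket_sumr k2 T2) braketDr //; last first.
  have := Xmx_unifpoly i j; rewrite -/(unifpoly _) => /unifpoly_L2 X2.
  have := L2B X2 c2; congr L2; apply/funext => x.
  by have := congr1 (fun f => f x) EX => /= ->; rewrite addrC addKr.
rewrite mulrDr braket_ket_cst add0r (braket_sumr k2 TL) mulr_sumr; apply: eq_bigr => l _.
have XU := Xmx_unifpoly l j; have ZU := Zmx_unifpoly l j.
have kX := unifpoly_L2 (unifpolyM (unifpoly_ket (kn i)) XU).
have kZ := unifpoly_L2 (unifpolyM (unifpoly_ket (kn i)) ZU).
have ET := braketZr (cw i * Omx su sd i l) k2 kX.
have ET' := braketZr (cw i * Omx su sd i l) k2 kZ.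
rewrite (braketDr k2 (L2Z _ (TL l)) (TL' l)) (braketZr _ k2 (TL l)).
rewrite -/(T l) in ET; rewrite -/(T' l) in ET'.
rewrite ET ET' (braket_ket_shift h (kn i) XU) (braket_ket_shift h (kn i) ZU).
case: leqP => kh; last by rewrite !mulr0 addr0.
rewrite IH; last by rewrite ltn_subrL kn_gt0 (leq_trans _ kh).
by rewrite natrB //; ring.
Qed.
End Solution.

Lemma torus_eq_ext (R : realType) (f g : R -> R[i]) : f =1 g -> torus_eq f g.
Proof. by move=> fg; apply: aeW => x _; exact: fg. Qed.

(** * The explicit preimage of |0> under u - L *)

Section ExplicitSolution.
Variables (R : realType) (n : nat) (su : 'I_n.+1 -> R) (sd chi : 'I_n -> R) (eps t : R).
Hypothesis s_ordered : forall i : 'I_n, su_below su i < sd i /\ sd i < su_above su i.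
Hypothesis eps_gt0 : 0 < eps.
Variable kn : 'I_n -> nat.
Hypothesis kn_gt0 : forall i, (0 < kn i)%N.
Hypothesis knE : forall i, (su_above su i - sd i) / eps = (kn i)%:R.
Local Notation a := (su_above su).
Local Notation b := sd.
Local Notation s := (su ord_max).
Local Notation X := (Xmx su sd eps chi t).
Local Notation Y := (Ymx su sd eps chi t).
Local Notation Z := (Zmx su sd chi eps t kn).
Local Notation Xr := (Xred su sd chi eps t kn).
Local Notation be := (betaC su sd).
Local Notation nc := Normc.normc.

Let v x := multiphase eps su sd chi x t.

Lemma betaC2 j : be j 0 * be j 0 = (nu_wt a b j)%:C.
Proof.
rewrite mxE -rmorphM -expr2 (beta_vec2 (sd_lt_above s_ordered) (above_lt_sd s_ordered)).
by [].
Qed.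

Lemma bil_betaC1 : bil be be 1%:M = (\sum_i (a i - b i))%:C.
Proof.
rewrite -(sum_beta2 (sd_lt_above s_ordered) (above_lt_sd s_ordered)) rmorph_sum.
rewrite /bil mulmx1 mxE; apply: eq_bigr => j _; rewrite mxE betaC2 rmorphXn /=.
by rewrite -rmorphXn (beta_vec2 (sd_lt_above s_ordered) (above_lt_sd s_ordered)).
Qed.

Let pX x := bil be be (X x - 1%:M).

Lemma multiphase_complex x :
  (v x)%:C = (s%:C + bil be be 1%:M) + pX x + Num.conj (pX x).
Proof.
rewrite /v (multiphaseE s_ordered chi t eps_gt0) -/(pX x) bil_betaC1 !rmorphD rmorphM /=.
rewrite -[RHS]addrA; congr (_ + _).
by rewrite [RHS]addcJ rmorph_nat.
Qed.

Lemma bil_Xred (r c : 'cV[R[i]]_n) x :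
  bil r c (X x - 1%:M) = (\sum_i \sum_j r i 0 * Xr i j x * c j 0) * ket 1 x.
Proof.
rewrite bilE mulr_suml; apply: eq_bigr => i _; rewrite mulr_suml; apply: eq_bigr => j _.
by rewrite (Xmx_sub1 chi t s_ordered kn_gt0 knE); ring.
Qed.

Lemma double_sum_unifpoly (c : 'I_n -> 'I_n -> R[i]) (f : 'I_n -> 'I_n -> R -> R[i]) :
  (forall i j, unifpoly (f i j)) ->
  unifpoly (fun x => \sum_i \sum_j c i j * f i j x).
Proof.
move=> hf; apply: (@unifpoly_sum _ _ _ _ (fun i x => \sum_j c i j * f i j x)) => i _.
by apply: (@unifpoly_sum _ _ _ _ (fun j x => c i j * f i j x)) => j _; apply: unifpolyZ.
Qed.

Lemma bil_Xred_unifpoly (r c : 'cV[R[i]]_n) :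
  unifpoly (fun x => \sum_i \sum_j r i 0 * Xr i j x * c j 0).
Proof.
have := @double_sum_unifpoly (fun i j => r i 0 * c j 0) (fun i j => Xr i j)
  (Xred_unifpoly chi t s_ordered knE).
apply: unifpoly_ext => x; apply: eq_bigr => i _; apply: eq_bigr => j _; ring.
Qed.

Lemma pX_unifpoly : unifpoly pX.
Proof.
apply: unifpoly_ext (unifpolyM (bil_Xred_unifpoly be be) (unifpoly_ket 1)) => x.
by rewrite -bil_Xred.
Qed.

Lemma v_cmeasurable : cmeasurable (fun x => (v x)%:C).
Proof.
have hp := unifpoly_cmeasurable pX_unifpoly.
have := cmeasurableD (cmeasurableD (cmeasurable_cst (s%:C + bil be be 1%:M)) hp)
  (cmeasurable_conj hp).
by congr cmeasurable; apply/funext => x; rewrite multiphase_complex.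
Qed.

Lemma v_L2M (f : R -> R[i]) : L2 f -> L2 (fun x => (v x)%:C * f x).
Proof.
have [M _ pM] := unifpoly_bounded pX_unifpoly.
apply: (@L2M_bounded _ _ _ (nc (s%:C + bil be be 1%:M) + M + M)); first exact: v_cmeasurable.
move=> x; rewrite multiphase_complex; apply: le_trans (normc_leD _ _) _.
apply: lerD; last by have := pM x; case: (pX x) => u w; rewrite /= sqrrN.
by apply: le_trans (normc_leD _ _) _; rewrite lerD2l.
Qed.

(** p is divisible by w, so p and its conjugate have mean zero and only the constant term
    remains. *)
Lemma mean_v : mean v = s + \sum_i (a i - b i).
Proof.
have p0 : cmean pX = 0.
  rewrite -(cmean_unifpoly_ket (bil_Xred_unifpoly be be) (ltn0Sn 0)).
  by congr cmean; apply/funext => x; rewrite -bil_Xred.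
have cp := unifpoly_cint pX_unifpoly.
have : cmean (fun x => (v x)%:C) = s%:C + bil be be 1%:M.
  have -> : (fun x => (v x)%:C) = (fun x => (s%:C + bil be be 1%:M) + (pX x + Num.conj (pX x))).
    by apply/funext => x; rewrite multiphase_complex addrA.
  rewrite cmeanD ?cmean_cst ?cmeanD ?cmean_conj ?p0 ?conjC0 ?addr0 //.
  - exact: cint_conj.
  - exact: cint_cst.
  - by apply: cintD => //; exact: cint_conj.
by rewrite bil_betaC1 -rmorphD => /(congr1 (@complex.Re R)).
Qed.

Variable u : R[i].
Hypothesis ub : forall j, u != (b j)%:C.
Hypothesis ua : forall i, u != (a i)%:C.
Hypothesis us : u != s%:C.

Definition rho_vec : 'cV[R[i]]_n := \col_j (be j 0 / (u - (b j)%:C)).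
Definition Phi : R[i] :=
  \prod_j (u - (b j)%:C) / ((u - s%:C) * \prod_i (u - (a i)%:C)).
Local Notation rho := rho_vec.

(** Since (B - s) rho = (u - s) rho - beta, the bracket collapses to (u - s) (1 - rho^T beta), and
    [sum_nu] writes 1 - rho^T beta as prod (u - a_i) / (u - b_i). The bracket is the constant term
    of the residual equation. *)
Lemma Phi_normalization :
  Phi * (u - (s%:C + bil be be 1%:M) - bil rho be (Bmx sd - s%:C%:M)) = 1.
Proof.
have L1 : bil rho be 1%:M = 1 - \prod_i (u - (a i)%:C) / \prod_j (u - (b j)%:C).
  have inj : injective (fun j => (b j)%:C : R[i]).
    move=> i j /complexI; exact: (interlace_b_inj (sd_lt_above s_ordered) (above_lt_sd s_ordered)).
  rewrite -(@sum_nu _ _ (fun i => (a i)%:C) (fun j => (b j)%:C) inj) //.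
  rewrite /bil mulmx1 mxE; apply: eq_bigr => j _; rewrite [rho^T _ _]mxE [rho _ _]mxE mulrAC betaC2.
  congr (_ / _); rewrite /nu_wt rmorphM rmorph_prod rmorphB; congr (_ * _); apply: eq_bigr => k _.
  by rewrite !rmorphM fmorphV !rmorphB.
have ub' j : u - (b j)%:C != 0 by rewrite subr_eq0.
have LB : bil rho be (Bmx sd - s%:C%:M) = (u - s%:C) * bil rho be 1%:M - bil be be 1%:M.
  rewrite !bilE.
  have E1 (r : 'cV[R[i]]_n) : \sum_i \sum_j r i 0 * (1%:M : 'M[R[i]]_n) i j * be j 0 =
      \sum_i r i 0 * be i 0.
    apply: eq_bigr => i _; rewrite (bigD1 i) //= big1 ?addr0 => [|j ji].
      by rewrite mxE eqxx mulr1.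
    by rewrite mxE eq_sym (negbTE ji) mulr0 mul0r.
  rewrite !E1 mulr_sumr -sumrB; apply: eq_bigr => i _.
  rewrite (bigD1 i) //= big1 ?addr0 => [|j ji]; last first.
    by rewrite !mxE eq_sym (negbTE ji) !mulr0n subrr mulr0 mul0r.
  rewrite [rho i 0]mxE !mxE eqxx !mulr1n; field; exact: ub'.
rewrite LB L1 /Phi.
have Pa : \prod_i (u - (a i)%:C) != 0 by apply/prodf_neq0 => i _; rewrite subr_eq0.
have Pb : \prod_j (u - (b j)%:C) != 0 by apply/prodf_neq0 => i _; rewrite subr_eq0.
move: (bil be be _) (\prod_i (u - (a i)%:C)) (\prod_j (u - (b j)%:C)) Pa Pb => c P1 P2 P10 P20.
by move: s%:C us => s'; rewrite -subr_eq0 => s'0; field; rewrite s'0 P10 P20.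
Qed.

Definition sol x := Phi * (1 + bil rho be (X x - 1%:M)).
(* dsol = -i d/dx sol *)
Definition dsol x := Phi * bil rho be (Z x).

Lemma sol_unifpoly : unifpoly sol.
Proof.
apply: unifpoly_ext (unifpolyZ Phi (unifpolyD (unifpoly_cst 1)
  (unifpolyM (bil_Xred_unifpoly rho be) (unifpoly_ket 1)))) => x.
by rewrite -bil_Xred.
Qed.

Lemma dsol_unifpoly : unifpoly dsol.
Proof.
apply: unifpolyZ; have := @double_sum_unifpoly (fun i j => rho i 0 * be j 0)
  (fun i j x => Z x i j) (Zmx_unifpoly chi t s_ordered kn_gt0 knE).
apply: unifpoly_ext => x; rewrite bilE.
by apply: eq_bigr => i _; apply: eq_bigr => j _; rewrite mulrAC.
Qed.

Lemma braket_ket_bil (r c : 'cV[R[i]]_n) (F : R -> 'M[R[i]]_n) h :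
  (forall i j, unifpoly (fun x => F x i j)) ->
  braket (ket h) (fun x => bil r c (F x)) =
  \sum_i \sum_j r i 0 * c j 0 * braket (ket h) (fun x => F x i j).
Proof.
move=> FU; have k2 := unifpoly_L2 (@unifpoly_ket R h).
have F2 i j := unifpoly_L2 (FU i j).
have -> : (fun x => bil r c (F x)) =
    (fun x => \sum_i \sum_j r i 0 * c j 0 * F x i j).
  apply/funext => x; rewrite bilE.
  by apply: eq_bigr => i _; apply: eq_bigr => j _; rewrite mulrAC.
have U i : unifpoly (fun x => \sum_j r i 0 * c j 0 * F x i j).
  by apply: (@unifpoly_sum _ _ _ _ (fun j x => r i 0 * c j 0 * F x i j)) => j _; apply: unifpolyZ.
rewrite (@braket_sumr _ _ _ (fun i x => \sum_j r i 0 * c j 0 * F x i j)) //; last first.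
  by move=> i; apply: unifpoly_L2.
apply: eq_bigr => i _.
rewrite (@braket_sumr _ _ _ (fun j x => r i 0 * c j 0 * F x i j)) //; last first.
  by move=> j; apply: L2Z.
by apply: eq_bigr => j _; rewrite braketZr.
Qed.

Lemma D_graph_sol : D_graph sol dsol.
Proof.
split; [exact/unifpoly_hardy/sol_unifpoly|exact/unifpoly_hardy/dsol_unifpoly|move=> h].
have k2 := unifpoly_L2 (@unifpoly_ket R h).
have bilU (F : R -> 'M[R[i]]_n) : (forall i j, unifpoly (fun x => F x i j)) ->
    L2 (fun x => bil rho be (F x)).
  move=> FU; have := @double_sum_unifpoly (fun i j => rho i 0 * be j 0)
    (fun i j x => F x i j) FU => /unifpoly_L2; congr L2; apply/funext => x.
  by rewrite bilE; apply: eq_bigr => i _; apply: eq_bigr => j _; rewrite mulrAC.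
have XU := Xmx_unifpoly chi t s_ordered knE.
have ZU := Zmx_unifpoly chi t s_ordered kn_gt0 knE.
have -> : sol = (fun x => Phi * (1 - bil rho be 1%:M) + Phi * bil rho be (X x)).
  by apply/funext => x; rewrite /sol bilB; ring.
rewrite /dsol (braketZr _ k2 (bilU _ ZU)) braketDr //; last 2 first.
- exact: L2_cst.
- exact/L2Z/bilU.
rewrite (braketZr _ k2 (bilU _ XU)) mulrDr braket_ket_cst add0r.
rewrite !braket_ket_bil // mulrCA; congr (_ * _); rewrite mulr_sumr.
apply: eq_bigr => i _; rewrite mulr_sumr; apply: eq_bigr => j _.
by rewrite (derivation_Xmx chi t s_ordered kn_gt0 knE) mulrCA.
Qed.

Lemma braket_ket0_sol : braket (ket 0) sol = Phi.
Proof.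
have k2 := unifpoly_L2 (@unifpoly_ket R 0).
have k1 := unifpolyM (bil_Xred_unifpoly rho be) (unifpoly_ket 1).
have -> : sol = (fun x => Phi * ket 0 x +
    Phi * ((\sum_i \sum_j rho i 0 * Xr i j x * be j 0) * ket 1 x)).
  by apply/funext => x; rewrite /sol bil_Xred /ket expr0 mulrDr.
rewrite braketDr //; last 2 first.
- exact: L2Z.
- exact/L2Z/unifpoly_L2.
rewrite !braketZr //; last exact: unifpoly_L2.
rewrite braket_ket eqxx mulr1 -[RHS]addr0; congr (_ + _); rewrite -[RHS](mulr0 Phi).
congr (_ * _); apply: etrans (cmean_unifpoly_ket (bil_Xred_unifpoly rho be) (ltn0Sn 0)).
by rewrite /braket; congr cmean; apply/funext => x; rewrite /ket expr0 conjC1 mul1r.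
Qed.

(** Displacement moves the middle factor to the left as A - s; then O O^T = 1 leaves (A - s) |W|^2,
    which is B - s by the choice of the moduli of W. Hence the adjoint of Y can serve as Z in
    [lax_algebra]. *)
Lemma Bmx_adjoint x :
  Y x *m (Bmx sd - s%:C%:M + be *m be^T) *m (map_mx Num.conj (Y x))^T = Bmx sd - s%:C%:M.
Proof.
have -> : Y x *m (Bmx sd - s%:C%:M + be *m be^T) = (Amx su - s%:C%:M) *m Y x.
  by rewrite addrAC mulmxBr -Ymx_displacement // mulmxBl scalar_mxC.
rewrite /Ymx map_mxM Omx_real trmx_mul -!mulmxA (mulmxA (Omx su sd)) Omx_KT //.
rewrite mul1mx map_diag_mx tr_diag_mx mulmx_diag.
apply/matrixP => i j; rewrite mul_mx_diag !mxE; case: eqVneq => [->|_]; last first.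
  by rewrite !mulr0n subrr mul0r.
rewrite !mulr1n -rmorphB /=.
have := Wrow_norm s_ordered eps chi t x j; rewrite normCK mxE => ->.
rewrite -rmorphB -rmorphM /= /qcoef mulrC divfK // subr_eq0 gt_eqF //.
exact: bottom_lt_above.
Qed.

(** With Z and V the adjoints of Y and X, [lax_algebra] leaves a constant and terms in V - 1. The
    constant becomes 1 by [Phi_normalization], and V - 1 is the adjoint of X - 1, which is divisible
    by w. *)
Lemma sol_residual : exists2 g, unifpoly g & forall x,
  u * sol x + eps%:C * dsol x - (v x)%:C * sol x = 1 - Num.conj (g x * ket 1 x).
Proof.
(* Chosen so that rho^T (B - s) (V - 1) beta becomes the conjugate of beta^T (X - 1) sig. *)
pose sig : 'cV[R[i]]_n := map_mx Num.conj ((Bmx sd - s%:C%:M) *m rho).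
exists (fun x => Num.conj Phi * \sum_i \sum_j be i 0 * Xr i j x * (be + sig) j 0).
  exact/unifpolyZ/bil_Xred_unifpoly.
move=> x; rewrite -mulrA -bil_Xred rmorphM /= conjCK.
have beJ : map_mx Num.conj be = be by apply/matrixP => i j; rewrite !mxE; exact: conjc_real.
have Vx (r : 'cV[R[i]]_n) : Num.conj (bil be (map_mx Num.conj r) (X x - 1%:M)) =
    bil r be ((map_mx Num.conj (X x))^T - 1%:M).
  rewrite !bilE rmorph_sum exchange_big; apply: eq_bigr => i _; rewrite rmorph_sum.
  apply: eq_bigr => j _; rewrite !rmorphM /= -[X in _ * _ * X]/(Num.conj _).
  rewrite [map_mx _ r _ _]mxE conjCK.
  have -> : Num.conj (be i 0) = be i 0 by rewrite mxE; exact: conjc_real.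
  rewrite !mxE rmorphB /= rmorph_nat eq_sym; ring.
have XU := Xmx_unit s_ordered eps chi t x.
have YX : (1%:M - Y x) *m X x = 1%:M by exact: mulmxV.
have XY : X x *m (1%:M - Y x) = 1%:M by exact: mulVmx.
have Drho : (u%:M - Bmx sd) *m rho = be.
  rewrite mulmxBl mul_scalar_mx mul_diag_mx; apply/matrixP => i j; rewrite ord1 !mxE.
  rewrite -mulrBl mulrC divfK // subr_eq0; exact: ub.
have BT : (Bmx sd)^T = Bmx sd by rewrite tr_diag_mx.
have ZV : (1%:M - (map_mx Num.conj (Y x))^T) *m (map_mx Num.conj (X x))^T = 1%:M.
  rewrite -[in LHS](trmx1 (R[i]) n) -[in LHS](map_mx1 Num.conj) -linearB -map_mxB.
  by rewrite -trmx_mul -map_mxM XY map_mx1 trmx1.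
have E := lax_algebra Drho BT (Ymx_displacement s_ordered eps chi t x) XY YX (Bmx_adjoint x) ZV.
have N := Phi_normalization.
have pV : Num.conj (pX x) = bil be be ((map_mx Num.conj (X x))^T - 1%:M).
  by rewrite -Vx beJ.
have sigV : Num.conj (bil be sig (X x - 1%:M)) =
    bil rho be ((Bmx sd - s%:C%:M) *m ((map_mx Num.conj (X x))^T - 1%:M)).
  have DT : (Bmx sd - s%:C%:M)^T = Bmx sd - s%:C%:M by rewrite linearB /= BT tr_scalar_mx.
  by rewrite Vx /bil trmx_mul DT !mulmxA.
have LV : bil rho be ((Bmx sd - s%:C%:M) * (map_mx Num.conj (X x))^T) =
    Num.conj (bil be sig (X x - 1%:M)) + bil rho be (Bmx sd - s%:C%:M).
  rewrite sigV; have aux (D V : 'M[R[i]]_n : pzRingType) :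
    bil rho be (D * V) = bil rho be (D * (V - 1)) + bil rho be D.
    by rewrite -bilD mulrBr mulr1 subrK.
  exact: aux.
have bilDr (c d : 'cV[R[i]]_n) M : bil be (c + d) M = bil be c M + bil be d M.
  by rewrite /bil mulmxDr mxE.
have eZ : eps%:C * bil rho be (Z x) = bil rho be (X x * (Amx su - Bmx sd) * (X x - 1%:M)).
  have aux (e : R[i]) (K D X0 N0 : 'M[R[i]]_n) : e%:M *m K = D ->
      e * bil rho be (X0 *m K *m N0) = bil rho be (X0 *m D *m N0).
    move=> <-; rewrite mul_scalar_mx -scalemxAr -scalemxAl /bil -scalemxAr -scalemxAl.
    by rewrite [in RHS]mxE.
  exact: aux (epsKn eps_gt0 knE).
have cE : Num.conj (bil be (be + sig) (X x - 1%:M)) =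
    Num.conj (pX x) + Num.conj (bil be sig (X x - 1%:M)) by rewrite bilDr rmorphD.
(* The scalar identity is stated over an abstract ring, so that all matrix expressions become atoms
   for [ring]. *)
have aux (F : comPzRingType) (u0 ep p0 pc pV0 P s0 p1 L0 LZ LZ' cs LB LV0 v0 W : F) :
    (u0 - (s0 + p1) - p0 - pV0) * (1 + L0) + LZ' = u0 - (s0 + p1) - pV0 - LV0 ->
    P * (u0 - (s0 + p1) - LB) = 1 ->
    pc = pV0 -> LV0 = cs + LB -> ep * LZ = LZ' -> v0 = s0 + p1 + p0 + pc -> W = pc + cs ->
    u0 * (P * (1 + L0)) + ep * (P * LZ) - v0 * (P * (1 + L0)) = 1 - P * W.
  move=> e1 e0 e2 e3 e4 -> ->; move: e1; rewrite -e2 e3 -e4 => e1.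
  transitivity (P * ((u0 - (s0 + p1) - p0 - pc) * (1 + L0) + ep * LZ)); first by ring.
  by rewrite e1 -[in RHS]e0; ring.
exact: aux E N pV LV eZ (multiphase_complex x) cE.
Qed.

(** The residual equation identifies the projection of v [sol] as u [sol] + eps [dsol] - 1: the
    difference is anti-analytic without constant term, hence orthogonal to the Hardy space. *)
Lemma shifted_lax_sol : shifted_lax eps v u sol (ket 0).
Proof.
have [g gU gE] := sol_residual.
have hs := unifpoly_hardy sol_unifpoly.
have hp : unifpoly (fun x => u * sol x + eps%:C * dsol x - 1).
  exact: unifpolyB (unifpolyD (unifpolyZ u sol_unifpoly) (unifpolyZ _ dsol_unifpoly))
    (unifpoly_cst 1).
have hl : unifpoly (fun x => u * sol x - ket 0 x).
  exact: unifpolyB (unifpolyZ u sol_unifpoly) (unifpoly_ket 0).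
exists (fun x => u * sol x - ket 0 x); last first.
  by apply: torus_eq_ext => x; ring.
split; first exact: unifpoly_hardy.
exists dsol, (fun x => u * sol x + eps%:C * dsol x - 1); split.
- exact: D_graph_sol.
- split; [exact/v_L2M/unifpoly_L2/sol_unifpoly|exact: unifpoly_hardy|move=> q hq].
  rewrite -(braket_hardy_antianalytic hq gU); congr braket; apply/funext => x.
  have aux (F : comPzRingType) (c y1 y2 w : F) :
    y1 + y2 - w = 1 - c -> w - (y1 + y2 - 1) = c.
    by move=> e; rewrite -[c](subKr 1) -e; ring.
  exact/aux/gE.
- by apply: torus_eq_ext => x; rewrite /ket expr0; ring.
Qed.

Lemma PhiBA_Phi z : PhiBA eps v u z -> z = Phi.
Proof. by move=> /PhiBA_unique /(_ shifted_lax_sol) ->; exact: braket_ket0_sol. Qed.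

Lemma Phi_PhiBA : complex.Im u != 0 -> PhiBA eps v u Phi.
Proof.
move=> u0; split; first by move=> f; apply: lax_injective => //; exact: v_L2M.
by exists sol; [exact: shifted_lax_sol|rewrite braket_ket0_sol].
Qed.
End ExplicitSolution.

(** * Poles, zeroes and profiles *)

Section PolesAndZeros.
Variables (R : realType) (eps : R) (v : R -> R) (m n : nat) (su : 'I_m -> R) (sd : 'I_n -> R).
Hypothesis su_inj : injective su.
Hypothesis sd_inj : injective sd.
Hypothesis su_neq_sd : forall i j, su i != sd j.
Local Notation nc := Normc.normc.
Let N (u : R[i]) := \prod_j (u - (sd j)%:C).
Let D (u : R[i]) := \prod_i (u - (su i)%:C).
Hypothesis PhiE : forall u z, N u != 0 -> D u != 0 -> PhiBA eps v u z -> z = N u / D u.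
Hypothesis Phi_defined : forall u : R[i], complex.Im u != 0 -> exists z, PhiBA eps v u z.

Lemma normcM (z w : R[i]) : nc (z * w) = nc z * nc w.
Proof. exact: Normc.normcM. Qed.

Lemma normc_pos (z : R[i]) : (0 < nc z) = (z != 0).
Proof.
rewrite lt_neqAle normc_ge0 andbT eq_sym; congr (~~ _).
apply/eqP/eqP => [/Normc.eq0_normc//|->]; exact: Normc.normc0.
Qed.

Lemma prod_near (I : Type) (r : seq I) (P : pred I) (c : I -> R) (p : R) :
  (forall i, P i -> c i != p) ->
  exists d k K : R, [/\ 0 < d, 0 < k, 0 < K & forall u, nc (u - p%:C) < d ->
    k <= nc (\prod_(i <- r | P i) (u - (c i)%:C)) <= K].
Proof.
move=> cp; elim: r => [|i r [d [k [K [d0 k0 K0 H]]]]].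
  exists 1, 1, 1; split => // u _; rewrite big_nil.
  by rewrite /= expr0n /= addr0 expr1n sqrtr1 lexx.
have [Pi|nPi] := boolP (P i); last first.
  by exists d, k, K; split => // u /H; rewrite big_cons (negbTE nPi).
pose e := `|p - c i|; have e0 : 0 < e by rewrite normr_gt0 subr_eq0 eq_sym cp.
exists (Num.min d (e / 2)), (e / 2 * k), (e * 2 * K); split.
- by rewrite lt_min d0 divr_gt0.
- by rewrite mulr_gt0 // divr_gt0.
- by rewrite !mulr_gt0.
move=> u; rewrite lt_min => /andP[/H /andP[Hk HK] ue]; rewrite big_cons Pi normcM.
have pe : nc (p%:C - (c i)%:C) = e by rewrite -rmorphB normc_real.
have h1 : nc (u - (c i)%:C) <= e / 2 + e.
  rewrite -(subrKA p%:C); apply: le_trans (normc_leD _ _) _; rewrite pe lerD2r; exact: ltW.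
have h2 : e <= e / 2 + nc (u - (c i)%:C).
  rewrite -[leLHS]pe -(subrKA u); apply: le_trans (normc_leD _ _) _.
  by rewrite lerD2r normc_distC ltW.
apply/andP; split; apply: ler_pM => //.
- by rewrite divr_ge0 // ltW.
- exact: ltW.
- lra.
- exact: normc_ge0.
- exact: normc_ge0.
- lra.
Qed.

Lemma Phi_adherent_real p : Phi_adherent eps v p.
Proof.
move=> d d0; have [|z hz] := @Phi_defined (p +i* (d / 2)); first by rewrite /= gt_eqF // divr_gt0.
exists (p +i* (d / 2)), z.
have -> : p +i* (d / 2) - p%:C = 0 +i* (d / 2) by apply/eqP; rewrite eq_complex /= subrr subr0 !eqxx.
have d2 : 0 < d / 2 by rewrite divr_gt0.
have -> : nc (0 +i* (d / 2)) = d / 2.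
  by rewrite /= expr0n /= add0r sqrtr_sqr ger0_norm // ltW.
by split => //; rewrite ltr_pdivrMr // mulr_natr mulr2n ltrDl.
Qed.

(** The boolean exponent is the order of vanishing at p, at most 1 since the c_i are distinct. With
    both cases in one formula, poles, zeroes and regular points share a single estimate. *)
Lemma prod_order_near k (c : 'I_k -> R) (p : R) : injective c ->
  exists d l L : R, [/\ 0 < d, 0 < l, 0 < L & forall u, nc (u - p%:C) < d ->
    l * nc (u - p%:C) ^+ [exists i, c i == p] <= nc (\prod_i (u - (c i)%:C)) <=
    L * nc (u - p%:C) ^+ [exists i, c i == p]].
Proof.
move=> c_inj; have [/existsP[i /eqP ip]|] := boolP [exists i, c i == p].
  have ne j : j != i -> c j != p by rewrite -ip; apply: contraNneq => /c_inj ->.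
  have [d [l [L [d0 l0 L0 H]]]] := prod_near (index_enum 'I_k) ne.
  exists d, l, L; split => // u /H /andP[h1 h2]; rewrite (bigD1 i) //= ip normcM expr1.
  by rewrite mulrC [L * _]mulrC !ler_wpM2l ?normc_ge0.
move=> /existsPn ne; have [d [l [L [d0 l0 L0 H]]]] := @prod_near _ (index_enum 'I_k) xpredT c p (fun i _ => ne i).
by exists d, l, L; split => // u /H; rewrite expr0 !mulr1.
Qed.

Let eN p : nat := [exists j, sd j == p].
Let eD p : nat := [exists i, su i == p].

(** Cross-multiplied, so that the order of Phi at p, which may be negative, is expressed by two
    natural exponents. *)
Lemma Phi_order_near p : exists d l L : R, [/\ 0 < d, 0 < l, 0 < L &
  forall u z, 0 < nc (u - p%:C) -> nc (u - p%:C) < d -> PhiBA eps v u z ->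
    l * nc (u - p%:C) ^+ eN p <= nc z * nc (u - p%:C) ^+ eD p <= L * nc (u - p%:C) ^+ eN p].
Proof.
have [d1 [l1 [L1 [d10 l10 L10 H1]]]] := prod_order_near p sd_inj.
have [d2 [l2 [L2 [d20 l20 L20 H2]]]] := prod_order_near p su_inj.
exists (Num.min d1 d2), (l1 / L2), (L1 / l2); split; rewrite ?lt_min ?divr_gt0 ?d10 ?d20 //.
move=> u z r0; rewrite lt_min => /andP[/H1 h1 /H2 h2] zu.
have pw (e : nat) : 0 < nc (u - p%:C) ^+ e by rewrite exprn_gt0.
have N0 : 0 < nc (N u) by case/andP: h1 => /(lt_le_trans _) + _; apply; rewrite mulr_gt0.
have D0 : 0 < nc (D u) by case/andP: h2 => /(lt_le_trans _) + _; apply; rewrite mulr_gt0.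
have zE : nc z * nc (D u) = nc (N u).
  rewrite (PhiE _ _ zu) -?normc_pos // -normcM divfK // -normc_pos //.
have z0 := normc_ge0 z.
rewrite -/(N u) -/(eN p) -zE in h1; rewrite -/(D u) -/(eD p) in h2.
move: {pw}(pw (eD p)) (pw (eN p)) h1 h2 D0 z0.
move: (nc z) (nc (D u)) (_ ^+ eD p) (_ ^+ eN p) => Z Dn P Q P0 Q0 /andP[h1 h2] /andP[h3 h4] D0 Z0.
rewrite mulrAC ler_pdivrMr // [L1 / l2 * _]mulrAC ler_pdivlMr //; apply/andP; split.
  apply: le_trans h1 _; rewrite -mulrA ler_wpM2l //; by rewrite mulrC.
apply: le_trans h2; rewrite -mulrA ler_wpM2l //; by rewrite mulrC.
Qed.

Lemma Phi_poleE : Phi_pole eps v = range su.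
Proof.
apply/seteqP; split => p /=.
  move=> [ad H]; have [/existsP[i /eqP <-]|ne] := boolP [exists i, su i == p]; first by exists i.
  exfalso; have [d [l [L [d0 l0 L0 H1]]]] := Phi_order_near p.
  (* If no s_i^up equals p, the values near p are bounded by L times a power of the distance; the
     minimum with 1 makes that power at most 1, against the pole condition for the bound L. *)
  have [e e0 He] := H L.
  have [|u [z [r0 rd zu]]] := ad (Num.min 1 (Num.min d e)); first by rewrite !lt_min ltr01 d0.
  move: rd; rewrite !lt_min => /and3P[r1 rd re].
  have := He _ _ r0 re zu; have /andP[_] := H1 _ _ r0 rd zu.
  rewrite /eD (negbTE ne) mulr1 => zL Lz; have := lt_le_trans Lz zL.
  rewrite ltNge ler_piMr //; first exact: ltW.
  by rewrite exprn_ile1 // ltW.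
move=> [i _ ip]; split; first exact: Phi_adherent_real.
move=> K; have [d [l [L [d0 l0 L0 H1]]]] := Phi_order_near p.
have eD1 : eD p = 1%N by rewrite /eD; case: existsP => // -[]; exists i; rewrite ip.
have eN0 : eN p = 0%N.
  by rewrite /eN; case: existsP => // -[j /eqP e]; have := su_neq_sd i j; rewrite ip e eqxx.
(* At a distance r from p one has l <= |z| r, so r < l / (|K| + 1) forces |z| above |K|. *)
exists (Num.min d (l / (`|K| + 1))).
  by rewrite lt_min d0 divr_gt0 // ltr_wpDl.
move=> u z r0; rewrite lt_min => /andP[rd rl] zu.
have /andP[+ _] := H1 _ _ r0 rd zu; rewrite eD1 eN0 expr1 mulr1 => lz.
apply: le_lt_trans (ler_norm K) _; rewrite -(ltr_pM2r r0); apply: lt_le_trans lz.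
move: rl; rewrite ltr_pdivlMr ?ltr_wpDl // mulrC; apply: le_lt_trans.
by rewrite ler_wpM2r ?lerDl // ltW.
Qed.

Lemma Phi_zeroE : Phi_zero eps v = range sd.
Proof.
apply/seteqP; split => p /=.
  move=> [ad H]; have [/existsP[i /eqP <-]|ne] := boolP [exists j, sd j == p]; first by exists i.
  exfalso; have [d [l [L [d0 l0 L0 H1]]]] := Phi_order_near p.
  have [e e0 He] := H l l0.
  have [|u [z [r0 rd zu]]] := ad (Num.min 1 (Num.min d e)); first by rewrite !lt_min ltr01 d0.
  move: rd; rewrite !lt_min => /and3P[r1 rd re].
  have := He _ _ r0 re zu; have /andP[+ _] := H1 _ _ r0 rd zu.
  rewrite /eN (negbTE ne) mulr1 => lz zl; have := lt_le_trans zl lz.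
  by rewrite ltNge ler_piMr ?normc_ge0 // exprn_ile1 // ltW.
move=> [j _ jp]; split; first exact: Phi_adherent_real.
move=> e e0; have [d [l [L [d0 l0 L0 H1]]]] := Phi_order_near p.
have eN1 : eN p = 1%N by rewrite /eN; case: existsP => // -[]; exists j; rewrite jp.
have eD0 : eD p = 0%N.
  by rewrite /eD; case: existsP => // -[i /eqP e']; have := su_neq_sd i j; rewrite jp e' eqxx.
exists (Num.min d (e / L)); first by rewrite lt_min d0 divr_gt0.
move=> u z r0; rewrite lt_min => /andP[rd rl] zu.
have /andP[_] := H1 _ _ r0 rd zu; rewrite eD0 eN1 expr1 mulr1 => zl.
by apply: le_lt_trans zl _; rewrite mulrC -ltr_pdivlMr.
Qed.
End PolesAndZeros.

(** * Uniqueness and existence of profiles *)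

Section Profiles.
Variable R : realType.
Implicit Types (f g : R -> R) (c x h d : R).

Lemma near_right0P (P : R -> Prop) :
  (\forall h \near (0 : R)^'+, P h) <-> exists2 d, 0 < d & forall h, 0 < h -> h < d -> P h.
Proof.
split.
  move=> [d /= d0 H]; exists d => // h h0 hd; apply: H => //=.
  by rewrite /= sub0r normrN gtr0_norm.
move=> [d d0 H]; exists d => //= h /= hd h0; apply: H => //.
by move: hd; rewrite sub0r normrN gtr0_norm.
Qed.

Lemma nearP c (P : R -> Prop) :
  (\forall x \near c, P x) <-> exists2 d, 0 < d & forall x, `|x - c| < d -> P x.
Proof.
split.
  by move=> [d /= d0 H]; exists d => // x xd; apply: H; rewrite /= distrC.
by move=> [d d0 H]; exists d => //= x /= xd; apply: H; rewrite distrC.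
Qed.

Definition has_slopes f c (sl sr : R) := exists2 d, 0 < d &
  forall h, 0 < h -> h < d -> f (c + h) = f c + sr * h /\ f (c - h) = f c - sl * h.

Lemma slopes_local_min f c sl sr : is_slope sl -> is_slope sr -> has_slopes f c sl sr ->
  local_min f c <-> sl = -1 /\ sr = 1.
Proof.
move=> l1 r1 [d d0 H]; split.
  move=> /nearP[e e0 m]; pose h := Num.min d e / 2.
  have h0 : 0 < h by rewrite divr_gt0 // lt_min d0.
  have he : h < d /\ h < e.
    have hm : h < Num.min d e by rewrite /h ltr_pdivrMr // mulr_natr mulr2n ltrDl lt_min d0.
    by move: hm; rewrite lt_min => /andP[].
  case: he => hd he; have [Hr Hl] := H h h0 hd.
  have : f c <= f (c + h) by apply: m; rewrite addrC addKr gtr0_norm.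
  have : f c <= f (c - h) by apply: m; rewrite addrAC subrr sub0r normrN gtr0_norm.
  by rewrite Hr Hl; case: l1 => ->; case: r1 => -> // m1 m2; exfalso; nra.
move=> [lE rE]; apply/nearP; exists d => // x xd.
have [xc|cx|->//] := ltgtP x c.
  have [||_] := H (c - x); first by rewrite subr_gt0.
    by move: xd; rewrite distrC gtr0_norm // subr_gt0.
  rewrite lE opprB addrC subrK => ->; rewrite mulN1r opprK; lra.
have [||+ _] := H (x - c); first by rewrite subr_gt0.
  by move: xd; rewrite gtr0_norm // subr_gt0.
rewrite rE addrC subrK => ->; lra.
Qed.

Lemma slopes_local_max f c sl sr : is_slope sl -> is_slope sr -> has_slopes f c sl sr ->
  local_max f c <-> sl = 1 /\ sr = -1.
Proof.
move=> l1 r1 [d d0 H].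
have N : has_slopes (fun x => - f x) c (- sl) (- sr).
  by exists d => // h h0 hd; have [-> ->] := H h h0 hd; split; lra.
have sN (w : R) : is_slope w -> is_slope (- w) by case=> ->; [right|left; rewrite opprK].
have -> : local_max f c <-> local_min (fun x => - f x) c.
  by split; apply: filterS => x; rewrite lerN2.
rewrite (slopes_local_min (sN _ l1) (sN _ r1) N); split => -[e1 e2]; split; lra.
Qed.

(** The derivative is locally constant, so its own derivative vanishes and it is constant;
    subtracting a linear function leaves a function with zero derivative. *)
Lemma locally_affine_affine (d : R -> R) :
  (forall c, exists e, \forall x \near c, d x = d c + e * (x - c)) ->
  exists e k, forall x, d x = e * x + k.
Proof.
move=> H.
have aff e c k x : is_derive (x : R) (1 : R) (fun y : R => k + e * (y - c)) e.
  apply: is_derive_eq.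
  rewrite /GRing.scale /=; ring.
have loc c : exists e, \forall x \near c, is_derive (x : R) (1 : R) d e.
  have [e He] := H c; exists e; near=> x.
  have Hx : \forall y \near x, d c + e * (y - c) = d y.
    near: x; move/nbhs_interior: He; apply: filterS => x.
    by apply: filterS => y ->.
  exact: near_eq_is_derive Hx (aff _ _ _ _).
have D1 x : is_derive (x : R) (1 : R) d ('D_1 d x).
  by have [e /nbhs_singleton [h _]] := loc x; exact: DeriveDef.
have D2 x : is_derive (x : R) (1 : R) ('D_1 d) 0.
  have [e he] := loc x; apply: (near_eq_is_derive _ (is_derive_cst e x 1)).
  by apply: filterS he => y [].
exists ('D_1 d 0), (d 0) => x.
have dd y : is_derive (y : R) (1 : R) (fun z => d z - 'D_1 d 0 * z) 0.
  have D1y := D1 y; apply: is_derive_eq; rewrite (is_derive_0_is_cst 0 y D2) /GRing.scale /=; ring.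
by have := is_derive_0_is_cst x 0 dd; rewrite mulr0 subr0 => <-; rewrite addrC subrK.
Unshelve. all: by end_near. Qed.

Lemma profile_unique mins maxs a f g : is_profile mins maxs a f -> is_profile mins maxs a g ->
  f =1 g.
Proof.
move=> [f1 f2 f3 f4 _] [g1 g2 g3 g4 _].
have [e [k dE]] : exists e k, forall x, f x - g x = e * x + k.
  apply: (@locally_affine_affine (fun x => f x - g x)) => c.
  have [sl [sr [l1 r1 /near_right0P Hf]]] := f1 c.
  have [tl [tr [m1 q1 /near_right0P Hg]]] := g1 c.
  have fmin := slopes_local_min l1 r1 Hf; have fmax := slopes_local_max l1 r1 Hf.
  have gmin := slopes_local_min m1 q1 Hg; have gmax := slopes_local_max m1 q1 Hg.
  have mE : (sl = -1 /\ sr = 1) <-> (tl = -1 /\ tr = 1) by rewrite -fmin f2 -g2 gmin.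
  have ME : (sl = 1 /\ sr = -1) <-> (tl = 1 /\ tr = -1) by rewrite -fmax f3 -g3 gmax.
  (* Both functions have a minimum at c, or both a maximum, and then the slopes are determined;
     otherwise each has equal slopes on its two sides. In all cases the difference has no corner at
     c. *)
  have E : sl - tl = sr - tr.
    by case: l1 => ?; case: r1 => ?; case: m1 => ?; case: q1 => ?; subst; lra.
  case: Hf => d d0 Hf; case: Hg => d' d0' Hg.
  exists (sl - tl); apply/nearP; exists (Num.min d d'); first by rewrite lt_min d0.
  move=> x; rewrite lt_min => /andP[xd xd'].
  have [xc|cx|->] := ltgtP x c; last by rewrite subrr mulr0 addr0.
    have h0 : 0 < c - x by rewrite subr_gt0.
    move: xd xd'; rewrite distrC gtr0_norm // => xd xd'.
    have [_] := Hf _ h0 xd; have [_] := Hg _ h0 xd'; rewrite opprB addrC subrK => -> ->; ring.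
  have h0 : 0 < x - c by rewrite subr_gt0.
  move: xd xd'; rewrite gtr0_norm // => xd xd'.
  have [+ _] := Hf _ h0 xd; have [+ _] := Hg _ h0 xd'; rewrite addrC subrK => -> ->.
  rewrite E; ring.
have small (r : R) : 0 < r -> exists M, forall x, M < x -> `|e * x + k| < r.
  move=> r0; have : (fun x => f x - g x) x @[x --> +oo] --> (0 : R).
    rewrite (_ : (fun x => f x - g x) = (fun x => (f x - `|x - a|) - (g x - `|x - a|))).
      by rewrite -[X in _ --> X](subr0 0); exact: cvgB.
    by apply/funext => x; ring.
  move=> /cvgrPdist_lt /(_ r r0) [M [_ HM]]; exists M => x Mx.
  by have := HM x Mx; rewrite sub0r normrN dE.
have zero_of (w : R) : (forall r, 0 < r -> `|w| <= r) -> w = 0.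
  move=> H; apply/eqP; rewrite -normr_le0; apply/ler_addgt0Pl => r /H; by rewrite addr0.
(* The slope is the difference of the values at M + 1 and M + 2, which are both small. *)
have e0 : e = 0.
  apply: zero_of => r r0; have r2 : 0 < r / 2 by rewrite divr_gt0.
  have [M HM] := small _ r2.
  have h1 := HM (M + 1) (ltac:(lra)); have h2 := HM (M + 2) (ltac:(lra)).
  have -> : e = (e * (M + 2) + k) - (e * (M + 1) + k) by ring.
  apply: le_trans (ler_normB _ _) _; lra.
have k0 : k = 0.
  apply: zero_of => r r0; have [M HM] := small _ r0.
  by have := HM (M + 1) (ltac:(lra)); rewrite e0 mul0r add0r => /ltW.
by move=> x; apply/eqP; rewrite -subr_eq0 dE e0 k0 mul0r addr0.
Qed.

Section Existence.
Variables (n : nat) (su : 'I_n.+1 -> R) (sd : 'I_n -> R).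
Hypothesis s_ordered : forall i : 'I_n, su_below su i < sd i /\ sd i < su_above su i.
Local Notation a := (su_above su).
Local Notation b := sd.
Local Notation s := (su ord_max).

(** The slope of |c - e| jumps by 2 at e, so s and the a_j become minima and the b_j maxima; for
    large |c| the sum of absolute values is exactly the required asymptote. *)
Definition profile c := `|c - s| + \sum_j (`|c - a j| - `|c - b j|).

Lemma gaps_disjoint c i j : b i <= c <= a i -> b j <= c <= a j -> i = j.
Proof.
have H (k l : 'I_n) : (k < l)%N -> b l <= c <= a l -> b k <= c -> False.
  move=> kl /andP[_ cl] bk; have := above_lt_sd s_ordered kl.
  by rewrite ltNge (le_trans bk cl).
move=> hi hj; case: (ltngtP i j) => [ij|ji|]; last exact: val_inj.
  by case: (H _ _ ij hj); case/andP: hi.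
by case: (H _ _ ji hi); case/andP: hj.
Qed.

(** These intervals run from b_j to a_j, where the profile descends; they are not the gaps of slope
    +1. The half-open variants distinguish the right from the left slope at an end point. *)
Let gap_right c := [exists j, b j <= c < a j].
Let gap_left c := [exists j, b j < c <= a j].
Let slope_right c : R := if (s <= c) && ~~ gap_right c then 1 else -1.
Let slope_left c : R := if (s < c) && ~~ gap_left c then 1 else -1.


Lemma abs_slopes c e : has_slopes (fun x => `|x - e|) c
  (if e < c then 1 else -1) (if e <= c then 1 else -1).
Proof.
have [ec|ce|->] := ltgtP e c.
- exists (c - e); first by rewrite subr_gt0.
  by move=> h h0 hd; rewrite !ger0_norm; lra.
- exists (e - c); first by rewrite subr_gt0.
  by move=> h h0 hd; rewrite !ler0_norm; lra.
- exists 1 => // h h0 _; rewrite subrr normr0.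
  rewrite ger0_norm; last lra.
  by rewrite ler0_norm; [split; ring|lra].
Qed.

Lemma has_slopesD f g c sl sr tl tr : has_slopes f c sl sr -> has_slopes g c tl tr ->
  has_slopes (fun x => f x + g x) c (sl + tl) (sr + tr).
Proof.
move=> [d d0 H] [d' d0' H']; exists (Num.min d d'); first by rewrite lt_min d0.
move=> h h0; rewrite lt_min => /andP[hd hd'].
by have [-> ->] := H h h0 hd; have [-> ->] := H' h h0 hd'; split; ring.
Qed.

Lemma has_slopesN f c sl sr : has_slopes f c sl sr -> has_slopes (fun x => - f x) c (- sl) (- sr).
Proof. by move=> [d d0 H]; exists d => // h h0 hd; have [-> ->] := H h h0 hd; split; ring. Qed.

Lemma has_slopes_sum (I : Type) (r : seq I) (F : I -> R -> R) c (sl sr : I -> R) :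
  (forall i, has_slopes (F i) c (sl i) (sr i)) ->
  has_slopes (fun x => \sum_(i <- r) F i x) c (\sum_(i <- r) sl i) (\sum_(i <- r) sr i).
Proof.
move=> H; elim: r => [|i r IH].
  by rewrite !big_nil; exists 1 => // h _ _; rewrite !big_nil; split; ring.
rewrite !big_cons; have [d d0 E] := has_slopesD (H i) IH; exists d => // h h0 hd.
by rewrite !big_cons; exact: E.
Qed.

Lemma profile_slopes c : has_slopes profile c (slope_left c) (slope_right c).
Proof.
have := has_slopesD (abs_slopes c s)
  (has_slopes_sum (index_enum 'I_n) (fun j => has_slopesD (abs_slopes c (a j)) (has_slopesN (abs_slopes c (b j))))).
congr has_slopes.
  rewrite /slope_left; have [/existsP[j /andP[bc ca]]|/existsPn ng] := boolP (gap_left c).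
    rewrite andbF (bigD1 j) //= big1 => [|k kj].
      rewrite bc [a j < c]ltNge ca /= (lt_trans (bottom_lt_sd s_ordered j) bc); ring.
    case: ifP => [ac|/negbT]; first by rewrite (lt_trans _ ac) ?subrr ?(proj2 (s_ordered k)).
    rewrite -leNgt => cak; case: ifP => [bk|_]; last by rewrite subrr.
    by rewrite (@gaps_disjoint c k j) ?eqxx ?cak ?ca ?ltW // in kj.
  rewrite big1 ?addr0 ?andbT // => j _; have := ng j.
  case: ifP => [ac|/negbT]; first by rewrite (lt_trans _ ac) ?subrr ?(proj2 (s_ordered j)).
  by rewrite -leNgt => ->; rewrite andbT => /negbTE ->; rewrite subrr.
rewrite /slope_right; have [/existsP[j /andP[bc ca]]|/existsPn ng] := boolP (gap_right c).
  rewrite andbF (bigD1 j) //= big1 => [|k kj].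
    rewrite bc [a j <= c]leNgt ca /= (ltW (lt_le_trans (bottom_lt_sd s_ordered j) bc)); ring.
  case: ifP => [ac|/negbT]; first by rewrite (le_trans _ ac) ?subrr ?ltW ?(proj2 (s_ordered k)).
  rewrite -ltNge => cak; case: ifP => [bk|_]; last by rewrite subrr.
  by rewrite (@gaps_disjoint c k j) ?eqxx ?bk ?bc ?ltW // in kj.
rewrite big1 ?addr0 ?andbT // => j _; have := ng j.
case: ifP => [ac|/negbT]; first by rewrite (le_trans _ ac) ?subrr ?ltW ?(proj2 (s_ordered j)).
by rewrite -ltNge => ->; rewrite andbT => /negbTE ->; rewrite subrr.
Qed.

Let neq11 : (1 : R) <> -1. Proof. by move=> h; lra. Qed.

Lemma profile_min c : (slope_left c = -1 /\ slope_right c = 1) <-> range su c.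
Proof.
have base j : s < a j by exact: bottom_lt_above.
rewrite /slope_left /slope_right; split.
  case: ifP => [_ [/neq11//]|/negbT]; rewrite negb_and => hl [_].
  case: ifP => [/andP[sc nr] _|_ /esym /neq11//].
  move: hl; rewrite negbK -leNgt => /orP[cs|/existsP[j /andP[bc ca]]].
    by exists ord_max => //; apply/eqP; rewrite eq_le sc cs.
  exists (widen_ord (leqnSn n) j) => //; apply/eqP; rewrite eq_le ca andbT leNgt; apply/negP => ac.
  by move/existsPn: nr => /(_ j); rewrite (ltW bc) /su_above ac.
move=> [i _ <-]; have [lin|nli] := ltnP i n; last first.
  have -> : i = ord_max by apply/val_inj/eqP; rewrite eqn_leq nli andbT -ltnS ltn_ord.
  have gr : ~~ gap_right s.
    by apply/existsPn => j; rewrite leNgt (bottom_lt_sd s_ordered).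
  by rewrite ltxx lexx gr.
have -> : su i = a (Ordinal lin) by congr su; apply: val_inj.
move: (Ordinal lin) => j; have gl : gap_left (a j).
  by apply/existsP; exists j; rewrite lexx andbT (proj2 (s_ordered j)).
have gr : ~~ gap_right (a j).
  apply/existsPn => k; apply/negP => /andP[bk ak].
  have kj : k = j by apply: (@gaps_disjoint (a j)); rewrite ?bk ?lexx ?ltW // (proj2 (s_ordered j)).
  by rewrite kj ltxx in ak.
by rewrite gl gr base ltW ?base.
Qed.

Lemma profile_max c : (slope_left c = 1 /\ slope_right c = -1) <-> range sd c.
Proof.
rewrite /slope_left /slope_right; split.
  case: ifP => [/andP[sc nl] [_]|_ [/esym/neq11]//].
  rewrite (ltW sc) /=; case: ifP => [_ /neq11//|/negbFE].
  move=> /existsP[j /andP[bc ca]] _; exists j => //; apply/eqP; rewrite eq_le bc /= leNgt.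
  by apply/negP => cb; move/existsPn: nl => /(_ j); rewrite cb (ltW ca).
move=> [j _ <-]; have gr : gap_right (b j).
  by apply/existsP; exists j; rewrite lexx (proj2 (s_ordered j)).
have gl : ~~ gap_left (b j).
  apply/existsPn => k; apply/negP => /andP[bk ak].
  have kj : k = j.
    by apply: (@gaps_disjoint (b j)); rewrite ?(ltW bk) ?ak ?lexx //= ltW // (proj2 (s_ordered j)).
  by rewrite kj ltxx in bk.
by rewrite gl gr bottom_lt_sd // andbF.
Qed.

Lemma is_slope_left c : is_slope (slope_left c).
Proof. by rewrite /slope_left; case: ifP => _; [left|right]. Qed.

Lemma is_slope_right c : is_slope (slope_right c).
Proof. by rewrite /slope_right; case: ifP => _; [left|right]. Qed.

Lemma profile_is_profile : is_profile (range su) (range sd) (s + \sum_j (a j - b j)) profile.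
Proof.
split.
- move=> c; exists (slope_left c), (slope_right c); split.
  + exact: is_slope_left.
  + exact: is_slope_right.
  + by apply/near_right0P; exact: profile_slopes.
- move=> c; rewrite -profile_min.
  exact: slopes_local_min (is_slope_left c) (is_slope_right c) (profile_slopes c).
- move=> c; rewrite -profile_max.
  exact: slopes_local_max (is_slope_left c) (is_slope_right c) (profile_slopes c).
- have su0 i : su i <= su ord0.
    by have [->//|i0] := eqVneq i ord0; rewrite ltW // (su_decreasing s_ordered) // lt0n.
  apply: cvg_near_cst; exists (Num.max (su ord0) (s + \sum_j (a j - b j))); split.
    exact: num_real.
  move=> c; rewrite gt_max => /andP[c0 cA]; rewrite /profile.
  have sc : s <= c by apply: le_trans (su0 _) (ltW c0).
  rewrite (ger0_norm (_ : 0 <= c - s)) ?subr_ge0 // (gtr0_norm (_ : 0 < c - _)) ?subr_gt0 //.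
  have -> : \sum_j (`|c - a j| - `|c - b j|) = - \sum_j (a j - b j).
    rewrite -sumrN; apply: eq_bigr => j _.
    have ac : a j <= c by apply: le_trans (su0 _) (ltW c0).
    have ba := proj2 (s_ordered j).
    rewrite !ger0_norm; lra.
  ring.
- apply: cvg_near_cst; exists s; split; first exact: num_real.
  move=> c cs; rewrite /profile.
  have A0 : 0 <= \sum_j (a j - b j).
    by apply: sumr_ge0 => j _; rewrite subr_ge0 ltW // (proj2 (s_ordered j)).
  rewrite (ltr0_norm (_ : c - s < 0)) ?subr_lt0 // (ltr0_norm (_ : c - (_ + _) < 0)); last first.
    by rewrite subr_lt0; apply: lt_le_trans cs _; rewrite lerDl.
  have -> : \sum_j (`|c - a j| - `|c - b j|) = \sum_j (a j - b j).
    apply: eq_bigr => j _; have ba := proj2 (s_ordered j).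
    have sb := bottom_lt_sd s_ordered j.
    rewrite !ler0_norm; lra.
  ring.
Qed.

End Existence.
End Profiles.

Lemma is_nth_largest_range (R : realType) (m : nat) (x : 'I_m -> R) :
  (forall i j : 'I_m, (i < j)%N -> x j < x i) ->
  forall i : 'I_m, is_nth_largest (range x) i (x i).
Proof.
move=> xd i; split; first by exists i.
(* The elements above x_i are the x_k with k < i; [insubd] makes k an ordinal, and its default value
   i is never taken because k < i < m. *)
have -> : [set y | range x y /\ x i < y] = (fun k => x (insubd i k)) @` `I_i.
  apply/seteqP; split => y /=.
    move=> [[j _ <-] ij]; exists j; last by rewrite valKd.
    rewrite ltnNge; apply/negP; rewrite leq_eqVlt => /orP[/eqP/val_inj e|/xd].
      by rewrite e ltxx in ij.
    by rewrite ltNge ltW.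
  move=> [k /= ki <-]; split; first by exists (insubd i k).
  by apply: xd; rewrite insubdK //; exact: ltn_trans ki (ltn_ord i).
apply: inj_card_eq => k l; rewrite !inE /= => ki li.
have km := ltn_trans ki (ltn_ord i); have lm := ltn_trans li (ltn_ord i).
have inj : injective x.
  move=> p q; case: (ltngtP p q) => [/xd + e|/xd + e|/val_inj//]; by rewrite e ltxx.
by move=> /inj /(congr1 val); rewrite !insubdK.
Qed.

Lemma card_range (R : realType) (m : nat) (x : 'I_m -> R) : injective x ->
  (range x #= `I_m)%card.
Proof.
move=> x_inj; apply: (card_eq_trans (inj_card_eq _)); first by move=> i j _ _; exact: x_inj.
by rewrite card_eq_sym; exact: card_II.
Qed.

(** * Poles, zeroes and mean value for the multi-phase solution *)

Section Conclusion.
Variables (R : realType) (eps : R) (n : nat) (su : 'I_n.+1 -> R) (sd chi : 'I_n -> R) (t : R).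
Hypothesis eps_gt0 : 0 < eps.
Hypothesis s_ordered : forall i : 'I_n, su_below su i < sd i /\ sd i < su_above su i.
Hypothesis v_periodic : forall x t : R,
  multiphase eps su sd chi (x + 2 * pi) t = multiphase eps su sd chi x t.
Let v x := multiphase eps su sd chi x t.

Let sd_inj : injective sd.
Proof. exact: (interlace_b_inj (sd_lt_above s_ordered) (above_lt_sd s_ordered)). Qed.

Let su_neq_sd i j : su i != sd j.
Proof.
have [ij|ji] := leqP i j.
  rewrite gt_eqF //; apply: lt_le_trans (sd_lt_above s_ordered j) _.
  rewrite /su_above; have [->//|ne] := eqVneq (widen_ord (leqnSn n) j) i.
  by rewrite ltW // (su_decreasing s_ordered) // ltn_neqAle ij andbT eq_sym.
rewrite lt_eqF //; apply: le_lt_trans (proj1 (s_ordered j)).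
rewrite /su_below; have [->//|ne] := eqVneq (lift ord0 j) i.
by rewrite ltW // (su_decreasing s_ordered) // ltn_neqAle; apply/andP; split.
Qed.

Let frequencies : {kn : 'I_n -> nat & forall i, (0 < kn i)%N /\ (su_above su i - sd i) / eps = (kn i)%:R}.
Proof. exact: choice (frequency_nat s_ordered eps_gt0 v_periodic). Qed.

Lemma poles_and_zeros : Phi_pole eps v = range su /\ Phi_zero eps v = range sd.
Proof.
have [kn knP] := frequencies.
(* The last of the s_i^up is s and the others are the a_i; this matches the denominator of [Phi]. *)
have DE u : \prod_i (u - (su i)%:C) = (u - (su ord_max)%:C) * \prod_i (u - (su_above su i)%:C).
  by rewrite big_ord_recr mulrC.
have PhiE u z : \prod_j (u - (sd j)%:C) != 0 -> \prod_i (u - (su i)%:C) != 0 ->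
    PhiBA eps v u z -> z = \prod_j (u - (sd j)%:C) / \prod_i (u - (su i)%:C).
  move=> /prodf_neq0 N0; rewrite DE mulf_eq0 negb_or => /andP[s0 /prodf_neq0 D0].
  apply: (PhiBA_Phi s_ordered eps_gt0 (fun i => proj1 (knP i)) (fun i => proj2 (knP i))).
  - by move=> j; have := N0 j isT; rewrite subr_eq0.
  - by move=> j; have := D0 j isT; rewrite subr_eq0.
  - by rewrite -subr_eq0.
have def (u : R[i]) : complex.Im u != 0 -> exists z, PhiBA eps v u z.
  move=> u0; have ne (r : R) : u != r%:C by apply: contraNneq u0 => ->.
  exists (Phi su sd u).
  by apply: (Phi_PhiBA chi t s_ordered eps_gt0 (fun i => proj1 (knP i)) (fun i => proj2 (knP i))).
have su_i := su_inj s_ordered.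
split; first exact: (Phi_poleE su_i sd_inj su_neq_sd PhiE def).
exact: (Phi_zeroE su_i sd_inj su_neq_sd PhiE def).
Qed.

Lemma mean_multiphase : mean v = su ord_max + \sum_j (su_above su j - sd j).
Proof.
have [kn knP] := frequencies.
exact: (mean_v chi t s_ordered eps_gt0 (fun i => proj1 (knP i)) (fun i => proj2 (knP i))).
Qed.
End Conclusion.

Theorem theorem1p3p3 (R : realType) (eps : R) (n : nat)
    (su : 'I_n.+1 -> R) (sd chi : 'I_n -> R)
    (eps_gt0 : 0 < eps)
    (s_ordered : forall i : 'I_n, su_below su i < sd i /\ sd i < su_above su i)
    (v_periodic : forall x t : R,
       multiphase eps su sd chi (x + 2 * pi) t = multiphase eps su sd chi x t) :
  forall (t : R), let v := fun x : R => multiphase eps su sd chi x t in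
    [/\ exists2 f, is_dispersive_action_profile eps v f & is_DK_profile su sd f,
        forall f g, is_dispersive_action_profile eps v f -> is_DK_profile su sd g ->
          forall c : R, f c = g c,
        (n_star eps v < +oo)%E /\ n_star eps v = (n%:R)%:E,
        forall i : 'I_n.+1, is_S_up eps v i (su i) &
        forall i : 'I_n, is_S_down eps v i.+1 (sd i)].
Proof.
move=> t v.
have [poleE zeroE] := poles_and_zeros t eps_gt0 s_ordered v_periodic.
have meanE := mean_multiphase t eps_gt0 s_ordered v_periodic.
have gapE : \sum_(i < n) `|sd i - su_above su i| = \sum_j (su_above su j - sd j).
  by apply: eq_bigr => i _; rewrite distrC gtr0_norm // subr_gt0 (proj2 (s_ordered i)).
have sd_decreasing (i j : 'I_n) : (i < j)%N -> sd j < sd i.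
  by move=> ij; apply: lt_trans (sd_lt_above s_ordered j) (above_lt_sd s_ordered ij).
have sd_inj := interlace_b_inj (sd_lt_above s_ordered) (above_lt_sd s_ordered).
rewrite /is_dispersive_action_profile /is_DK_profile /n_star /is_S_up /is_S_down.
(* Both kinds of profile have now become the same predicate, with the same extrema and the same
   asymptotic constant, so existence and uniqueness of profiles settle the first two claims. *)
rewrite poleE zeroE meanE gapE; split.
- by exists (profile su sd); exact: profile_is_profile.
- by move=> f g fP gP; exact: profile_unique fP gP.
- have cd := card_range sd_inj.
  have fin : finite_set (range sd) by exists n.
  rewrite /counting; case: asboolP => // _; rewrite (card_fset_set cd); split => //.
  exact: ltry.
- exact/is_nth_largest_range/su_decreasing.
- by move=> i; split => //; exact: is_nth_largest_range.
Qed.
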